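(* Consider the Stochastic Block Model under random dyad sampling, assume (A1)–(A4) of the context and $\rho=\rho_n\gg\log(n)/n$ (i.e. $n\rho_n/\log n\to\infty$). Let $\widehat\theta_{var}=(\widehat\alpha_{var},\widehat\pi_{var})$ be the variational estimator $$\widehat\theta_{var}\in\arg\max_{\theta\in\Theta}\ \max_{\mathbb Q\in\mathcal Q}\ J(\mathbb Q,\theta).$$ Then there exist permutations $s$ of $\{1,\dots,Q\}$ (depending on $n$ and on the data) such that, as $n\to\infty$, $$\hat\alpha(\mathbf z^\star)-\widehat\alpha_{var}^{\,s}=o_P\bigl(n^{-1/2}\bigr),\qquad \hat\pi(\mathbf z^\star)-\widehat\pi_{var}^{\,s}=o_P\bigl(n^{-1}\bigr).$$
   Context: **Model.** $Q\ge1$ is fixed and known; there are $n$ nodes. Let $\varphi(y,\pi)=b(y)\exp(\pi y-\psi(\pi))$, $\pi\in\mathcal A\subset\mathbb R$, be a regular one-dimensional exponential family in canonical form (densities with respect to a fixed dominating measure); on the interior $\mathring{\mathcal A}$, $\psi$ is smooth and convex, and $\psi'(\pi)$, $\psi''(\pi)>0$ are the mean and variance of $\varphi(\cdot,\pi)$. A parameter is $\theta=(\alpha,\pi)$ with $\alpha=(\alpha_1,\dots,\alpha_Q)$ a probability vector and $\pi=(\pi_{q\ell})$ a $Q\times Q$ matrix. Under $\theta$: $z_1,\dots,z_n$ are i.i.d. with $\mathbb P(z_i=q)=\alpha_q$; conditionally on $\mathbf z$, the variables $y_{ij}$ (ordered pairs $i\ne j$) are independent with $y_{ij}\sim\varphi(\cdot,\pi_{z_iz_j})$.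 Data are generated under a fixed true parameter $\theta^\star=(\alpha^\star,\pi^\star)$, with true memberships $\mathbf z^\star$. Write $z_{iq}=1$ if $z_i=q$ and $0$ otherwise. **Random dyad sampling.** The $r_{ij}$ ($i\ne j$) are i.i.d. Bernoulli($\rho$), independent of everything else; one observes $\mathbf r$ and $\mathbf y^{o}=\{y_{ij}:r_{ij}=1\}$. **Variational objective.** $p(\mathbf y^o,\mathbf z;\theta)=\prod_i\alpha_{z_i}\prod_{i\neq j:\,r_{ij}=1}\varphi(y_{ij},\pi_{z_iz_j})$. $\mathcal Q$ is the set of product probability distributions on assignments, $\mathbb Q(\mathbf z)=\prod_{i,q}\mathbb Q(z_{iq}=1)^{z_{iq}}$, and $$J(\mathbb Q,\theta)=\mathbb E_{\mathbb Q}[\log p(\mathbf y^o,\mathbf z;\theta)]-\mathbb E_{\mathbb Q}[\log\mathbb Q(\mathbf z)]$$ (expectations over $\mathbf z\sim\mathbb Q$, data fixed). **Estimators with known memberships.** For an assignment $\mathbf z$: $\hat\alpha_q(\mathbf z)=\frac1n\sum_i z_{iq}$, $\hat y_{q\ell}(\mathbf z)=\frac{\sum_{i\ne j}y_{ij}r_{ij}z_{iq}z_{j\ell}}{\sum_{i\ne j}r_{ij}z_{iq}z_{j\ell}}$, $\hat\pi_{q\ell}(\mathbf z)=(\psi')^{-1}(\hat y_{q\ell}(\mathbf z))$ (with an arbitrary value when undefined). **Assumptions.** (A1) There are a constant $c>0$ and a compact interval $C_\pi\subset\mathring{\mathcal A}$ with $\Theta\subset[c,1-c]^Q\times C_\pi^{Q\times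 Q}$, where $\Theta$ is the parameter space. (A2) $\theta^\star$ lies in the interior of $\Theta$. (A3) The map $\pi\mapsto\varphi(\cdot,\pi)$ is injective. (A4) The coordinates of the vector $\psi'(\pi^\star)\alpha^\star$ ($\psi'$ applied entrywise to the matrix $\pi^\star$) are pairwise distinct. **Permutations.** $\alpha^s=(\alpha_{s(q)})_q$ and $\pi^s=(\pi_{s(q)s(\ell)})_{q,\ell}$. Stochastic orders are under $\mathbb P_{\theta^\star}$. *)

(* Defs.v *)
(* Mathematical Components + MathComp-Analysis *)
From HB Require Import structures.
From mathcomp Require Import all_boot all_order all_algebra all_fingroup.
From mathcomp Require Import all_classical all_reals all_analysis.

Set Implicit Arguments.
Unset Strict Implicit.
Unset Printing Implicit Defensive.

Import Order.TTheory GRing.Theory Num.Theory.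
Import numFieldNormedType.Exports.

Local Open Scope classical_set_scope.
Local Open Scope ring_scope.

Definition expfam (R : realType) (b psi : R -> R) (y p : R) : R :=
  b y * expR (p * y - psi p).

(* Regular one-dimensional exponential family in canonical form, with
   densities [expfam b psi ^~ p] with respect to the dominating measure [mu].
   On the interior of [A], [psi'] and [psi''] are the mean and the variance.
   [A] is only required to be an interval (as natural parameter sets in
   dimension one are); convexity of [psi] on the interior of [A] is contained
   in [psi'' > 0]. *)
Record regular_expfam (R : realType)
    (mu : {measure set (measurableTypeR R) -> \bar R})
    (A : set R) (b psi : R -> R) : Prop := RegularExpfam {
  expfam_interval : is_interval A;
  expfam_base_meas : measurable_fun [set: R] b;
  expfam_base_ge0 : forall y, 0 <= b y;
  expfam_mass : forall p, A p ->
    (\int[mu]_y (expfam b psi y p)%:E = 1)%E;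
  expfam_smooth : forall (k : nat) p, interior A p ->
    derivable (derive1n k psi) p 1;
  expfam_mean : forall p, interior A p ->
    (\int[mu]_y (y * expfam b psi y p)%:E = (derive1 psi p)%:E)%E;
  expfam_var : forall p, interior A p ->
    (\int[mu]_y ((y - derive1 psi p) ^+ 2 * expfam b psi y p)%:E
       = (derive1n 2 psi p)%:E)%E;
  expfam_var_gt0 : forall p, interior A p -> 0 < derive1n 2 psi p
}.

(* A parameter is a pair (alpha, pi). *)
Definition param (R : realType) (Q : nat) : Type := ('rV[R]_Q * 'M[R]_Q)%type.

Definition is_param (R : realType) (Q : nat) (t : param R Q) : Prop :=
  (forall q, 0 <= t.1 0 q) /\ \sum_q t.1 0 q = 1.

Definition perm_alpha (R : realType) (Q : nat) (s : 'S_Q) (a : 'rV[R]_Q)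
  : 'rV[R]_Q := \row_q a 0 (s q).

Definition perm_pi (R : realType) (Q : nat) (s : 'S_Q) (p : 'M[R]_Q)
  : 'M[R]_Q := \matrix_(q, l) p (s q) (s l).

Definition assignment (n Q : nat) := {ffun 'I_n -> 'I_Q}.

(* Data on ordered dyads; the diagonal entries [y i i], [r i i] are never
   used. *)
Section Model.
Context {R : realType} {n Q : nat}.

(* [z], [y], [r] follow the SBM with parameter [t] under random dyad sampling
   of rate [rho], on the probability space [P]:
   - the z_i are i.i.d. with law alpha;
   - given z, the y_ij (i != j) are independent with density
     phi(., pi_{z_i z_j});
   - the r_ij (i != j) are i.i.d. Bernoulli(rho), independent of (z, y).
   (Rectangles [z = z0, y_ij in B_ij] generate the sigma-algebra of (z, y).) *)
Record sbm_dyad_sampling (mu : {measure set (measurableTypeR R) -> \bar R})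
    (b psi : R -> R) (t : param R Q) (rho : R)
    (d : measure_display) (T : measurableType d) (P : probability T R)
    (z : T -> assignment n Q) (y : T -> 'I_n -> 'I_n -> R)
    (r : T -> 'I_n -> 'I_n -> bool) : Prop := SbmDyadSampling {
  sbm_meas_z : forall z0, measurable [set w | z w = z0];
  sbm_meas_y : forall i j, i != j ->
    measurable_fun [set: T] (fun w => y w i j);
  sbm_meas_r : forall i j, i != j -> measurable [set w | r w i j];
  sbm_law_z : forall z0 : assignment n Q,
    P [set w | z w = z0] = (\prod_i t.1 0 (z0 i))%:E;
  sbm_law_y : forall (z0 : assignment n Q) (B : 'I_n -> 'I_n -> set R),
    (forall i j, measurable (B i j)) ->
    P [set w | z w = z0 /\ forall i j, i != j -> B i j (y w i j)] =
      (P [set w | z w = z0] *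
       (\prod_i \prod_(j | j != i)
          \int[mu]_(u in B i j) expfam b psi u (t.2 (z0 i) (z0 j)))%:E)%E;
  sbm_law_r : forall (z0 : assignment n Q) (B : 'I_n -> 'I_n -> set R)
      (r0 : 'I_n -> 'I_n -> bool),
    (forall i j, measurable (B i j)) ->
    P [set w | [/\ z w = z0,
                   forall i j, i != j -> B i j (y w i j) &
                   forall i j, i != j -> r w i j = r0 i j]] =
      (P [set w | z w = z0 /\ forall i j, i != j -> B i j (y w i j)] *
       (\prod_i \prod_(j | j != i)
          (if r0 i j then rho else 1 - rho))%:E)%E
}.

(* Complete-data likelihood of (y^o, z) *)
Definition lik (b psi : R -> R) (y : 'I_n -> 'I_n -> R)
    (r : 'I_n -> 'I_n -> bool) (z : assignment n Q) (t : param R Q) : R :=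
  (\prod_i t.1 0 (z i)) *
  \prod_i \prod_(j | (j != i) && r i j) expfam b psi (y i j) (t.2 (z i) (z j)).

Definition marginal (q : {ffun assignment n Q -> R}) (i : 'I_n) (k : 'I_Q) : R :=
  \sum_(z : assignment n Q | z i == k) q z.

Definition product_distr : set {ffun assignment n Q -> R} :=
  [set q : {ffun assignment n Q -> R} |
    [/\ forall z, 0 <= q z, \sum_z q z = 1 &
               forall z, q z = \prod_i marginal q i (z i)]].

(* Since [ln 0 = 0] here, the entropy term uses the convention 0 log 0 = 0.
   The likelihood vanishes (for positive alpha) only if b(y_ij) = 0 for some
   observed dyad, which has probability zero. *)
Definition elbo (b psi : R -> R) (y : 'I_n -> 'I_n -> R)
    (r : 'I_n -> 'I_n -> bool) (q : {ffun assignment n Q -> R})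
    (t : param R Q) : R :=
  \sum_z q z * ln (lik b psi y r z t) - \sum_z q z * ln (q z).

(* The supremum is a maximum: [product_distr] is compact, [elbo] continuous. *)
Definition elbo_max (b psi : R -> R) (y : 'I_n -> 'I_n -> R)
    (r : 'I_n -> 'I_n -> bool) (t : param R Q) : R :=
  sup [set elbo b psi y r q t | q in product_distr].

Definition is_variational_estimate (b psi : R -> R) (Theta : set (param R Q))
    (y : 'I_n -> 'I_n -> R) (r : 'I_n -> 'I_n -> bool) (t : param R Q) : Prop :=
  Theta t /\ forall t', Theta t' -> elbo_max b psi y r t' <= elbo_max b psi y r t.

Definition alpha_hat (z : assignment n Q) : 'rV[R]_Q :=
  \row_q (n%:R^-1 * \sum_(i < n) (z i == q)%:R).

Definition dyad_count (r : 'I_n -> 'I_n -> bool) (z : assignment n Q)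
    (q l : 'I_Q) : R :=
  \sum_i \sum_(j | j != i) (r i j)%:R * (z i == q)%:R * (z j == l)%:R.

Definition y_hat (y : 'I_n -> 'I_n -> R) (r : 'I_n -> 'I_n -> bool)
    (z : assignment n Q) (q l : 'I_Q) : R :=
  (\sum_i \sum_(j | j != i)
     y i j * (r i j)%:R * (z i == q)%:R * (z j == l)%:R) / dyad_count r z q l.

(* (psi')^{-1} (y_hat), with psi' restricted to the interior of [A]; the
   arbitrary value [pi0 q l] is used if the denominator of [y_hat] is zero or
   [y_hat] is not in the range of psi'. *)
Definition pi_hat (A : set R) (psi : R -> R) (pi0 : 'M[R]_Q)
    (y : 'I_n -> 'I_n -> R) (r : 'I_n -> 'I_n -> bool) (z : assignment n Q)
    : 'M[R]_Q :=
  \matrix_(q, l)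
    if dyad_count r z q l == 0 then pi0 q l
    else xget (pi0 q l)
           [set p | interior A p /\ derive1 psi p = y_hat y r z q l].

End Model.

(* X_n = o_P(a_n), i.e. P_n(|X_n| > eps a_n) -> 0 for every eps > 0. The
   probability is read as an outer probability (the event is covered by
   measurable events of vanishing probability), so that X_n need not be
   measurable; for measurable X_n this is the usual notion. *)
Definition small_oP (R : realType) (V : normedModType R)
    (d : nat -> measure_display) (T : forall n, measurableType (d n))
    (P : forall n, probability (T n) R)
    (X : forall n, T n -> V) (a : nat -> R) : Prop :=
  forall eps : R, 0 < eps ->
  exists B : forall n, set (T n),
    [/\ forall n, measurable (B n),
        forall n, [set w | eps * a n < `|X n w|] `<=` B n &
        (fun n => P n (B n)) @ \oo --> 0%E].

(* Main.v *)
Require Import Defs.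
From HB Require Import structures.
From mathcomp Require Import all_boot all_order all_algebra all_fingroup.
From mathcomp Require Import all_classical all_reals all_analysis.
From mathcomp Require Import ring lra.
Import Order.TTheory GRing.Theory Num.Theory.
From mathcomp Require Import measurable_realfun.
Import numFieldNormedType.Exports.
Import HBNNSimple.
Local Open Scope classical_set_scope.
Local Open Scope ring_scope.

(** The proof compares three quantities. Since point masses are product
    distributions, the variational objective maximised over [q] lies between
    the complete-data likelihood at the true memberships [zs] and the evidence,
    the sum of the likelihoods over all the assignments. Hence the complete-data
    likelihood of the maximum likelihood estimator that knows [zs] is at most
    the evidence at the variational estimator ([variational_evidence]).

    The heart of the matter is that near the orbit of the true parameter the
    evidence is, up to a relative error that is polynomially small of any order,
    the sum over the permutations [s] of the complete-data likelihoods at the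
    permuted parameters ([posterior_sum]): an assignment at Hamming distance [h]
    from the closest relabelling of [zs] loses a factor exponential in
    [rho * n * h], because enough dyads separate two classes ([separation],
    [fit_near]), and [rho * n] dominates [ln n]. Summing
    over assignments then gives a power [(1 + (Q - 1) q) ^ n] with [n q] small.
    Parameters far from the orbit are excluded by a cruder form of the same
    comparison, with an error negligible against [rho * n ^ 2] ([fit_far],
    [that_near_orbit]).

    The complete-data likelihood is strongly concave ([loglik_gap]), with
    curvature [n] in the proportions and [rho * n ^ 2] in the connection
    parameters. A constant loss of likelihood therefore already puts one
    permutation of the estimator next to the true parameter; the other
    permutations are then at a positive distance from it, contribute
    exponentially little to the evidence, and the loss of the first one is in
    fact of order [n ^ -2] ([selection], [estimator_close]). Concavity turns this
    into squared errors of order [n ^ -3], which is more than is claimed.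

    All this is deterministic on a good event, where the classes are balanced
    and, for every assignment, the noise sums over the blocks of dyads with given
    true and proposed labels are small, on a scale proportional to the Hamming
    distance for the blocks whose labels change ([balanced], [quiet]). The union
    bound over assignments closes for the same reason as above ([good_event]). It
    needs Chernoff bounds for the dyads ([dyad_chernoff]), whose law is only
    prescribed on rectangles; expectations of products are computed by
    exchanging indicators for general functions one coordinate at a time
    ([integral_prod_law]). *)

Set Implicit Arguments.
Unset Strict Implicit.

(** * Integrals that agree on indicators *)

Section IndicatorExtension.
Context (R : realType) (d1 d2 : measure_display).
Context (T1 : measurableType d1) (T2 : measurableType d2).
Context (mu1 : {measure set T1 -> \bar R}) (mu2 : {measure set T2 -> \bar R}).
Variables (H1 : T1 -> R) (X1 : T1 -> R) (H2 : T2 -> R) (X2 : T2 -> R).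
Hypotheses (mH1 : measurable_fun [set: T1] H1) (mX1 : measurable_fun [set: T1] X1).
Hypotheses (mH2 : measurable_fun [set: T2] H2) (mX2 : measurable_fun [set: T2] X2).
Hypotheses (H1_ge0 : forall x, 0 <= H1 x) (H2_ge0 : forall x, 0 <= H2 x).

Let agree (f : R -> R) :=
  (\int[mu1]_x (H1 x * f (X1 x))%:E = \int[mu2]_x (H2 x * f (X2 x))%:E)%E.

(** Dyadic simple functions reduce the claim to linearity, and monotone
    convergence does the rest. A weight on each side is what makes one
    coordinate at a time replaceable below, and it also covers laws given by a
    density with respect to an arbitrary measure. *)
Lemma ge0_agree_indic :
  (forall B, measurable B -> agree \1_B) ->
  forall f : R -> R, measurable_fun [set: R] f -> (forall u, 0 <= f u) -> agree f.
Proof.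
move=> h1 f mf f0.
have mE1 (g : R -> R) : measurable_fun [set: R] g ->
    measurable_fun [set: T1] (EFin \o (fun x => H1 x * g (X1 x) : R)).
  by move=> mg; apply/measurable_EFinP; apply: measurable_funM => //;
     exact: measurableT_comp.
have mE2 (g : R -> R) : measurable_fun [set: R] g ->
    measurable_fun [set: T2] (EFin \o (fun x => H2 x * g (X2 x) : R)).
  by move=> mg; apply/measurable_EFinP; apply: measurable_funM => //;
     exact: measurableT_comp.
have pos1 (g : R -> R) : (forall u, 0 <= g u) ->
    forall x, (0 <= (H1 x * g (X1 x))%:E)%E.
  by move=> g0 x; rewrite lee_fin mulr_ge0.
have pos2 (g : R -> R) : (forall u, 0 <= g u) ->
    forall x, (0 <= (H2 x * g (X2 x))%:E)%E.
  by move=> g0 x; rewrite lee_fin mulr_ge0.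
have agD (g h : R -> R) : measurable_fun [set: R] g -> measurable_fun [set: R] h ->
   (forall u, 0 <= g u) -> (forall u, 0 <= h u) -> agree g -> agree h ->
   agree (fun u => g u + h u).
  move=> mg mh g0 h0 ag ah; rewrite /agree.
  under eq_integral do rewrite mulrDr EFinD.
  under [RHS]eq_integral do rewrite mulrDr EFinD.
  rewrite !ge0_integralD //.
  all: try (by rewrite ag ah).
  all: try by [exact: mE1|exact: mE2|move=> ? _; exact: pos1|move=> ? _; exact: pos2].
have agZ (g : R -> R) c : measurable_fun [set: R] g ->
   (forall u, 0 <= g u) -> 0 <= c -> agree g -> agree (fun u => c * g u).
  move=> mg g0 c0 ag; rewrite /agree.
  under eq_integral do rewrite mulrCA EFinM.
  under [RHS]eq_integral do rewrite mulrCA EFinM.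
  rewrite !ge0_integralZl ?lee_fin //; first by rewrite ag.
  all: try by [exact: mE1|exact: mE2|move=> ? _; exact: pos1|move=> ? _; exact: pos2].
have mEf : measurable_fun [set: R] (EFin \o f) by exact/measurable_EFinP.
pose g_ n : R -> R := nnsfun_approx measurableT mEf n.
have mg n : measurable_fun [set: R] (g_ n) by exact: measurable_funP.
have g0 n u : 0 <= g_ n u by exact: fun_ge0.
have agg n : agree (g_ n).
  have : g_ n = (fun u =>
     \sum_(k < n * 2 ^ n) (k%:R * 2 ^- n) * \1_(dyadic_approx setT (EFin \o f) n k) u
     + n%:R * \1_(integer_approx setT (EFin \o f) n) u).
    by rewrite /g_ nnsfun_approxE.
  move=> ->.
  have mA k : measurable (dyadic_approx setT (EFin \o f) n k).
    rewrite /dyadic_approx; case: ifP => // _.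
    rewrite -preimage_comp.
    by apply: (mEf) => //; apply/measurable_image_EFin; exact: measurable_itv.
  have mB : measurable (integer_approx setT (EFin \o f) n).
    by rewrite /integer_approx; exact: emeasurable_fun_c_infty.
  apply: (agD).
  - by apply: measurable_sum => k; apply: measurable_funM => //;
      exact: measurable_indic.
  - by apply: measurable_funM => //; exact: measurable_indic.
  - by move=> u; apply: sumr_ge0 => k _; rewrite !mulr_ge0 ?invr_ge0 ?exprn_ge0.
  - by move=> u; rewrite mulr_ge0.
  - elim: (n * 2 ^ n)%N => [|N IH].
      rewrite /agree; under eq_integral do rewrite big_ord0 mulr0.
      under [RHS]eq_integral do rewrite big_ord0 mulr0.
      by rewrite !integral0.
    have -> : (fun u : R => (\sum_(k < N.+1) k%:R * 2 ^- n *
         \1_(dyadic_approx setT (EFin \o f) n k) u : R)) = (fun u : R =>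
        \sum_(k < N) k%:R * 2 ^- n * \1_(dyadic_approx setT (EFin \o f) n k) u +
        (N%:R * 2 ^- n) * \1_(dyadic_approx setT (EFin \o f) n N) u).
      by apply/funext => u; rewrite big_ord_recr.
    apply: (agD) => //.
    + by apply: measurable_sum => k; apply: measurable_funM => //;
        exact: measurable_indic.
    + by apply: measurable_funM => //; exact: measurable_indic.
    + by move=> u; apply: sumr_ge0 => k _; rewrite !mulr_ge0 ?invr_ge0 ?exprn_ge0.
    + apply: (agZ \1_(dyadic_approx setT (EFin \o f) n N));
        [exact: measurable_indic|by []| |exact: h1].
      by rewrite mulr_ge0 ?invr_ge0 ?exprn_ge0.
  - by apply: (agZ \1_(integer_approx setT (EFin \o f) n));
      [exact: measurable_indic|by []|by []|exact: h1].
have nd u : {homo (fun n => g_ n u) : m n / (m <= n)%N >-> m <= n}.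
  by move=> m n mn; have /lefP := nd_nnsfun_approx measurableT mEf mn; apply.
have cg u : (g_ n u)%:E @[n --> \oo] --> (f u)%:E.
  by apply: (cvg_nnsfun_approx measurableT mEf) => // x _; rewrite lee_fin.
have lim1 x : limn (fun n => (H1 x * g_ n (X1 x))%:E) = (H1 x * f (X1 x))%:E.
  apply: cvg_lim => //; rewrite EFinM.
  by under eq_fun do rewrite EFinM; apply: cvgeZl.
have lim2 x : limn (fun n => (H2 x * g_ n (X2 x))%:E) = (H2 x * f (X2 x))%:E.
  apply: cvg_lim => //; rewrite EFinM.
  by under eq_fun do rewrite EFinM; apply: cvgeZl.
have c1 := @cvg_monotone_convergence _ _ _ mu1 setT measurableT
  (fun n x => (H1 x * g_ n (X1 x))%:E).
have c2 := @cvg_monotone_convergence _ _ _ mu2 setT measurableT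
  (fun n x => (H2 x * g_ n (X2 x))%:E).
rewrite /agree.
under eq_integral do rewrite -lim1; under [RHS]eq_integral do rewrite -lim2.
apply: (@cvg_unique _ _ (\int[mu1]_x (H1 x * g_ n (X1 x))%:E @[n --> \oo])%E) => //.
  apply: c1.
  - by move=> n; exact: mE1.
  - by move=> n x _; exact: pos1.
  - by move=> x _ m n mn; rewrite lee_fin ler_wpM2l ?nd.
have -> : (fun n => \int[mu1]_x (H1 x * g_ n (X1 x))%:E)%E =
          (fun n => \int[mu2]_x (H2 x * g_ n (X2 x))%:E)%E.
  by apply/funext => n; exact: agg.
apply: c2.
- by move=> n; exact: mE2.
- by move=> n x _; exact: pos2.
- by move=> x _ m n mn; rewrite lee_fin ler_wpM2l ?nd.
Qed.

End IndicatorExtension.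

(** * Expectations of products over independent dyads *)

Section ProductRule.
Context (R : realType) (d : measure_display) (T : measurableType d).
Context (P : probability T R) (mu : {measure set (measurableTypeR R) -> \bar R}).
Context (K : finType) (D : pred K) (E : set T) (Y : K -> T -> R) (f : K -> R -> R) (c : R).
Hypotheses (mE : measurable E) (mY : forall k, D k -> measurable_fun [set: T] (Y k)).
Hypotheses (mf : forall k, measurable_fun [set: R] (f k)) (f_ge0 : forall k u, 0 <= f k u).
Hypotheses (f_mass : forall k, D k -> (\int[mu]_u (f k u)%:E = 1)%E) (c_ge0 : 0 <= c).
Hypothesis law : forall B : K -> set R, (forall k, measurable (B k)) ->
  P (E `&` [set w | forall k, D k -> B k (Y k w)]) =
  (c * \prod_(k | D k) \int[mu]_(u in B k) f k u)%:E.

(** The law of the data is stated with real-valued integrals, which carry no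
    information when the extended integral is infinite; for a density this does
    not happen. *)
Lemma density_indic_fin k (B : set R) : D k -> measurable B ->
  (\int[mu]_u (f k u * \1_B u)%:E = (\int[mu]_(u in B) f k u)%R%:E)%E.
Proof.
move=> Dk mB.
have -> : (\int[mu]_u (f k u * \1_B u)%:E = \int[mu]_(u in B) (f k u)%:E)%E.
  rewrite [RHS]integral_mkcond; apply: eq_integral => u _.
  by rewrite /patch indicE; case: ifP => _; rewrite ?mulr1 ?mulr0.
rewrite /Rintegral fineK // ge0_fin_numE; last first.
  by apply: integral_ge0 => u _; rewrite lee_fin.
apply: (@le_lt_trans _ _ (\int[mu]_u (f k u)%:E)%E); last by rewrite f_mass ?ltry.
apply: ge0_subset_integral => //; first by apply/measurable_EFinP; exact: mf.
by move=> u _; rewrite lee_fin.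
Qed.

(** Independence is available only as a rule for rectangles. The proof
    enlarges, one coordinate at a time, the set [s] of coordinates that may
    carry a general function while the others still carry indicators; each step
    is [ge0_agree_indic] with the remaining factors absorbed in the weight. *)
Lemma integral_prod_law (g : K -> R -> R) (G : K -> R) :
  (forall k, measurable_fun [set: R] (g k)) -> (forall k u, 0 <= g k u) ->
  (forall k, D k -> (\int[mu]_u (f k u * g k u)%:E = (G k)%:E)%E) ->
  (\int[P]_w (\1_E w * \prod_(k | D k) g k (Y k w))%:E
   = (c * \prod_(k | D k) G k)%:E)%E.
Proof.
(* Outside [s] the functions are indicators. *)
have main (s : seq K) : forall (g : K -> R -> R) (G : K -> R),
  (forall k, measurable_fun [set: R] (g k)) -> (forall k u, 0 <= g k u) ->
  (forall k, D k -> (\int[mu]_u (f k u * g k u)%:E = (G k)%:E)%E) ->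
  (forall k, D k -> k \notin s -> exists2 B : set R, measurable B & g k = \1_B) ->
  (\int[P]_w (\1_E w * \prod_(k | D k) g k (Y k w))%:E
   = (c * \prod_(k | D k) G k)%:E)%E.
  elim: s => [|k0 s IH] {}g {}G mg g0 gG gI.
    have /boolp.choice[B BP] : forall k, exists B : set R,
        measurable B /\ (D k -> g k = \1_B).
      move=> k; have [Dk|nDk] := boolP (D k).
        by have [B mB gB] := gI k Dk isT; exists B.
      by exists set0.
    have mB k : measurable (B k) by case: (BP k).
    transitivity (P (E `&` [set w | forall k, D k -> B k (Y k w)])).
      rewrite -[in RHS](setIT (_ `&` _)) -integral_indic //; last first.
        apply: measurableI => //.
        rewrite (_ : [set w | _] = \bigcap_(k in [set` D]) (Y k @^-1` B k)) //.
        apply: fin_bigcap_measurable; first exact: finite_finset.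
        by move=> k Dk; rewrite -[X in measurable X]setTI; apply: mY.
      apply: eq_integral => w _; congr (_%:E); rewrite !indicE in_setI.
      case: (w \in E) => /=; rewrite ?mul1r ?mul0r //.
      rewrite (eq_bigr (fun k => (Y k w \in B k)%:R)); last first.
        by move=> k Dk; rewrite (BP k).2 // indicE.
      case: (pselect (forall k, D k -> B k (Y k w))) => h.
        by rewrite [in RHS]mem_set // big1 // => k Dk; rewrite (mem_set (h k Dk)).
      move/existsNP: (h) => [k /not_implyP[Dk nB]].
      by rewrite [in RHS]memNset // (bigD1 k) //= memNset // mul0r.
    rewrite law //; congr (_ * _)%:E; apply: eq_bigr => k Dk.
    by apply: EFin_inj; rewrite -gG // (BP k).2 // density_indic_fin.
  have [Dk0|nDk0] := boolP (D k0); last first.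
    apply: IH => // k Dk ks; apply: gI => //; rewrite inE negb_or ks andbT.
    by apply: contraNN nDk0 => /eqP <-.
  have G0 k : D k -> 0 <= G k.
    move=> Dk; rewrite -lee_fin -gG //; apply: integral_ge0 => u _.
    by rewrite lee_fin mulr_ge0.
  pose C := c * \prod_(k | D k && (k != k0)) G k.
  have C0 : 0 <= C by rewrite mulr_ge0 // prodr_ge0 // => k /andP[/G0].
  pose H w := \1_E w * \prod_(k | D k && (k != k0)) g k (Y k w).
  have mH : measurable_fun [set: T] H.
    apply: measurable_funM; first exact: measurable_indic.
    under eq_fun do rewrite -big_filter.
    apply: measurable_prod => k; rewrite mem_filter => /andP[/andP[Dk _] _].
    by apply: measurableT_comp; [exact: mg|exact: mY].
  have mCf : measurable_fun [set: R] (fun u => C * f k0 u).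
    by apply: measurable_funM => //; exact: mf.
  have H0 w : 0 <= H w by rewrite /H mulr_ge0 ?prodr_ge0 // indicE.
  have Cf0 u : 0 <= C * f k0 u by rewrite mulr_ge0.
  have agI (B : set R) : measurable B ->
    (\int[P]_w (H w * \1_B (Y k0 w))%:E = \int[mu]_u (C * f k0 u * \1_B u)%:E)%E.
    move=> mB.
    pose g' k := if k == k0 then \1_B else g k.
    pose G' k := if k == k0 then \int[mu]_(u in B) f k0 u else G k.
    have mg' k : measurable_fun [set: R] (g' k).
      by rewrite /g'; case: ifP => // _; exact: measurable_indic.
    have g'0 k u : 0 <= g' k u by rewrite /g'; case: ifP => // _; rewrite indicE.
    have gG' k : D k -> (\int[mu]_u (f k u * g' k u)%:E = (G' k)%:E)%E.
      move=> Dk; rewrite /g' /G'; case: eqP => [->|_]; last exact: gG.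
      exact: density_indic_fin.
    have gI' k : D k -> k \notin s -> exists2 B : set R, measurable B & g' k = \1_B.
      move=> Dk ks; rewrite /g'; case: eqP => [_|/eqP kk0]; first by exists B.
      by apply: gI => //; rewrite inE negb_or kk0.
    have EG : c * \prod_(k | D k) G' k = C * \int[mu]_(u in B) f k0 u.
      rewrite (bigD1 k0) //= {1}/G' eqxx mulrCA mulrC; congr (c * _ * _).
      by apply: eq_bigr => k /andP[_ /negPf kk0]; rewrite /G' kk0.
    have e := IH g' G' mg' g'0 gG' gI'; rewrite EG in e.
    transitivity (\int[P]_w (\1_E w * \prod_(k | D k) g' k (Y k w))%:E)%E.
      apply: eq_integral => w _; congr (_%:E); rewrite [in RHS](bigD1 k0) //= /H.
      rewrite {1}/g' eqxx -mulrA [X in _ * X]mulrC; congr (_ * (_ * _)).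
      by apply: eq_bigr => k /andP[_ /negPf kk0]; rewrite /g' kk0.
    rewrite e EFinM -density_indic_fin // -/C.
    under [RHS]eq_integral do rewrite -mulrA EFinM.
    rewrite ge0_integralZl ?lee_fin // 1?muleC //.
      apply/measurable_EFinP/measurable_funM; first exact: mf.
      exact: measurable_indic.
    by move=> u _; rewrite lee_fin mulr_ge0 // indicE.
  have e := @ge0_agree_indic R _ _ T (measurableTypeR R) P mu H (Y k0) _ id
    mH (mY Dk0) mCf (@measurable_id _ _ _) H0 Cf0 agI (g k0) (mg k0) (g0 k0).
  transitivity (\int[P]_w (H w * g k0 (Y k0 w))%:E)%E.
    apply: eq_integral => w _; congr (_%:E).
    by rewrite (bigD1 k0) //= /H -mulrA [_ * g k0 _]mulrC.
  rewrite e (bigD1 k0) //= mulrCA -mulrC EFinM -gG //.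
  under eq_integral do rewrite -mulrA EFinM.
  rewrite ge0_integralZl ?lee_fin // 1?muleC //.
    apply/measurable_EFinP/measurable_funM; [exact: mf|exact: mg].
  by move=> u _; rewrite lee_fin mulr_ge0.
move=> mg g0 gG; apply: (main (enum K)) => // k _; by rewrite mem_enum.
Qed.

End ProductRule.

(** * The law of the observed dyads given the memberships *)

Lemma measurable_expfam (R : realType) (b psi : R -> R) (p : R) :
  measurable_fun [set: R] b -> measurable_fun [set: R] (fun u => expfam b psi u p).
Proof.
move=> mb; apply: measurable_funM => //.
by apply: measurableT_comp => //; apply: measurable_funB.
Qed.

Definition off (n : nat) (k : 'I_n * 'I_n) : bool := k.1 != k.2.

Section DyadLaw.
Context (R : realType) (Q n : nat).
Context (mu : {measure set (measurableTypeR R) -> \bar R}).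
Context (A : set R) (b psi : R -> R) (hfam : regular_expfam mu A b psi).
Context (t : param R Q) (rho : R) (d : measure_display) (T : measurableType d).
Context (P : probability T R) (z : T -> assignment n Q).
Context (y : T -> 'I_n -> 'I_n -> R) (r : T -> 'I_n -> 'I_n -> bool).
Hypotheses (hdata : sbm_dyad_sampling mu b psi t rho P z y r).
Hypotheses (rho01 : 0 <= rho <= 1) (t_ge0 : forall q, 0 <= t.1 0 q).
Hypothesis tA : forall q l, A (t.2 q l).

Let dyad := ('I_n * 'I_n)%type.

Definition bit_rate (c : bool) : R := if c then rho else 1 - rho.

Lemma bit_rate_ge0 c : 0 <= bit_rate c.
Proof. by case/andP: rho01 => *; case: c; rewrite /= ?subr_ge0. Qed.

Lemma prod_off (F : 'I_n -> 'I_n -> R) :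
  \prod_i \prod_(j | j != i) F i j = \prod_(k | off k) F k.1 k.2.
Proof.
by rewrite pair_big_dep /=; apply: eq_bigl => k; rewrite /off eq_sym.
Qed.

Lemma measurable_dyad (k : dyad) (g : bool -> R -> R) : off k ->
  (forall c, measurable_fun [set: R] (g c)) ->
  measurable_fun [set: T] (fun w => g (r w k.1 k.2) (y w k.1 k.2)).
Proof.
move=> ok mg; pose rk := [set w | r w k.1 k.2].
have mr : measurable rk := sbm_meas_r hdata ok.
rewrite (_ : (fun w => _) = (fun w => \1_rk w * g true (y w k.1 k.2) +
   \1_(~` rk) w * g false (y w k.1 k.2))); last first.
  apply/funext => w; rewrite !indicE in_setC.
  have -> : (w \in rk) = r w k.1 k.2 by apply/asboolP/idP.
  by case: (r w k.1 k.2); rewrite /= ?mul1r ?mul0r ?addr0 ?add0r.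
apply: measurable_funD; apply: measurable_funM;
  try by apply: measurable_indic => //; exact: measurableC.
all: by apply: measurableT_comp; [exact: mg|exact: (sbm_meas_y hdata)].
Qed.

(** The sampling indicators take finitely many values, so the expectation is a
    sum over the sampling patterns [r0] of product integrals in the [y] alone,
    and the sum over patterns factorizes again. Patterns are normalised to be
    false on the diagonal, where the model says nothing. *)
Lemma dyad_expectation (z0 : assignment n Q) (g : dyad -> bool -> R -> R)
    (G : dyad -> bool -> R) :
  (forall k c, measurable_fun [set: R] (g k c)) -> (forall k c u, 0 <= g k c u) ->
  (forall k c, off k ->
    (\int[mu]_u (expfam b psi u (t.2 (z0 k.1) (z0 k.2)) * g k c u)%:E = (G k c)%:E)%E) ->
  (\int[P]_w (\1_[set w | z w = z0] w *
       \prod_(k | off k) g k (r w k.1 k.2) (y w k.1 k.2))%:E =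
   (\prod_i t.1 0 (z0 i) *
       \prod_(k | off k) (rho * G k true + (1 - rho) * G k false))%:E)%E.
Proof.
move=> mg g0 gG.
pose E (r0 : {ffun dyad -> bool}) :=
  [set w | z w = z0 /\ forall k, off k -> r w k.1 k.2 = r0 k].
pose F := pfamily false (@off n) (fun _ : dyad => pred_of_simpl (@predT bool)).
have mE r0 : measurable (E r0).
  rewrite (_ : E r0 = [set w | z w = z0] `&`
     \bigcap_(k in [set` @off n]) [set w | r w k.1 k.2 = r0 k]); last first.
    by apply/seteqP; split => w [h1 h2]; split.
  apply: measurableI; first exact: (sbm_meas_z hdata).
  apply: fin_bigcap_measurable; first exact: finite_finset.
  move=> k /= ok; have := sbm_meas_r hdata ok; case: (r0 k) => //.
  move=> /measurableC; congr (measurable _); apply/seteqP; split => w /=.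
    by move/negP/negbTE.
  by move=> ->.
have law r0 : forall B : dyad -> set R, (forall k, measurable (B k)) ->
  P (E r0 `&` [set w | forall k, off k -> B k (y w k.1 k.2)]) =
  ((\prod_i t.1 0 (z0 i) * \prod_(k | off k) bit_rate (r0 k)) *
   \prod_(k | off k) \int[mu]_(u in B k) expfam b psi u (t.2 (z0 k.1) (z0 k.2)))%:E.
  move=> B mB.
  have := sbm_law_r hdata z0 (fun i j => r0 (i, j)) (fun i j => mB (i, j)).
  rewrite (sbm_law_y hdata z0 (fun i j => mB (i, j))) (sbm_law_z hdata) -!EFinM.
  rewrite !prod_off [X in X%:E]mulrAC => h.
  transitivity (P [set w | [/\ z w = z0,
      forall i j : 'I_n, i != j -> B (i, j) (y w i j) &
      forall i j : 'I_n, i != j -> r w i j = r0 (i, j)]]).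
    congr (P _); apply/seteqP; split => w /=.
      by move=> [[h1 h2] h3]; split => // i j ij; [exact: (h3 (i, j))|exact: (h2 (i, j))].
    by move=> [h1 h2 h3]; split; [split|] => // -[i j] ij; [exact: h3|exact: h2].
  rewrite h; congr (_ * _ * _)%:E; apply: eq_bigr => -[i j] _ //.
transitivity (\sum_(r0 in F) \int[P]_w (\1_(E r0) w *
    \prod_(k | off k) g k (r0 k) (y w k.1 k.2))%:E)%E.
  rewrite -big_enum -ge0_integral_sum //=; last 2 first.
    move=> r0; apply/measurable_EFinP/measurable_funM; first exact: measurable_indic.
    under eq_fun do rewrite -big_filter.
    apply: measurable_prod => k; rewrite mem_filter => /andP[ok _].
    by apply: measurableT_comp; [exact: mg|exact: (sbm_meas_y hdata)].
    by move=> r0 w _; rewrite lee_fin mulr_ge0 ?prodr_ge0 // indicE.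
  apply: eq_integral => w _; rewrite sumEFin; congr (_%:E).
  rewrite big_enum /=.
  (* Only the observed pattern contributes. *)
  pose rw : {ffun dyad -> bool} := [ffun k => off k && r w k.1 k.2].
  have rwF : rw \in F.
    apply/pfamilyP; split => //; apply/finfun.supportP => k nk.
    by rewrite ffunE (negbTE (nk : ~~ off k)).
  rewrite (bigD1 rw) //= [X in _ + X]big1 ?addr0.
    rewrite !indicE; have -> : (w \in E rw) = (w \in [set w | z w = z0]).
      apply/idP/idP; rewrite !inE /E /=; first by case.
      by move=> h; split => // k ok; rewrite ffunE ok.
    congr (_ * _); apply: eq_bigr => k ok; by rewrite ffunE ok.
  move=> r0 /andP[/pfamilyP[r0F _] nr]; rewrite indicE memNset ?mul0r //.
  move=> [_ hr]; move/negP : nr; apply; apply/eqP/ffunP => k; rewrite ffunE.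
  have [ok|nok] := boolP (off k); first by rewrite -hr.
  by move/finfun.supportP : r0F => ->.
transitivity (\sum_(r0 in F) (\prod_i t.1 0 (z0 i) *
   \prod_(k | off k) (bit_rate (r0 k) * G k (r0 k)))%:E)%E.
  apply: eq_bigr => r0 _.
  rewrite (@integral_prod_law R d T P mu dyad (@off n) (E r0)
    (fun k w => y w k.1 k.2) (fun k u => expfam b psi u (t.2 (z0 k.1) (z0 k.2)))
    _ (mE r0) _ _ _ _ _ (law r0) (fun k => g k (r0 k)) (fun k => G k (r0 k))) //.
  - by rewrite -mulrA big_split.
  - by move=> k ok; exact: (sbm_meas_y hdata).
  - by move=> k; apply: measurable_expfam; case: hfam.
  - by move=> k u; rewrite mulr_ge0 ?expR_ge0 //; case: hfam.
  - by move=> k ok; case: hfam => _ _ _ + _ _ _ _; apply.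
  - by rewrite mulr_ge0 ?prodr_ge0 // => *; exact: bit_rate_ge0.
  - by move=> k ok; exact: gG.
rewrite sumEFin; congr (_%:E); rewrite -big_distrr /=; congr (_ * _).
rewrite -(@big_distr_big_dep _ _ _ _ _ dyad bool false (@off n) (fun _ => predT)
  (fun k c => bit_rate c * G k c)).
by apply: eq_bigr => k _; rewrite big_bool.
Qed.

(** Markov's inequality for the exponential of the sum. The scaling factor
    of the exponential moment is part of [h]. *)
Lemma dyad_chernoff (z0 : assignment n Q) (h : dyad -> bool -> R -> R)
    (G : dyad -> bool -> R) (kap : dyad -> R) (s : R) :
  (forall k c, measurable_fun [set: R] (h k c)) ->
  (forall k c, off k ->
    (\int[mu]_u (expfam b psi u (t.2 (z0 k.1) (z0 k.2)) * expR (h k c u))%:E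
      = (G k c)%:E)%E) ->
  (forall k, off k -> rho * G k true + (1 - rho) * G k false <= expR (kap k)) ->
  measurable [set w | z w = z0 /\
      s <= \sum_(k | off k) h k (r w k.1 k.2) (y w k.1 k.2)] /\
  (P [set w | z w = z0 /\
      (s <= \sum_(k | off k) h k (r w k.1 k.2) (y w k.1 k.2))%R] <=
   ((\prod_i t.1 0 (z0 i)) * expR (\sum_(k | off k) kap k - s))%:E)%E.
Proof.
move=> mh hG hkap.
pose S w := \sum_(k | off k) h k (r w k.1 k.2) (y w k.1 k.2).
have mS : measurable_fun [set: T] S.
  rewrite /S; under eq_fun do rewrite -big_filter.
  rewrite (_ : (fun w => _) = (fun w => \sum_(k <- [seq k <- index_enum _ | @off n k])
      (fun w => if off k then h k (r w k.1 k.2) (y w k.1 k.2) else 0) w)); last first.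
    apply/funext => w; rewrite big_seq [RHS]big_seq.
    by apply: eq_bigr => k; rewrite mem_filter => /andP[-> _].
  apply: measurable_sum => k; have [ok|//] := boolP (off k).
  exact: (measurable_dyad (g := h k) ok).
have mz : measurable [set w | z w = z0] := sbm_meas_z hdata z0.
have mSz : measurable [set w | s <= S w].
  have := mS measurableT _ (measurable_itv `[s, +oo[); rewrite setTI.
  by congr (measurable _); apply/seteqP; split => x /=; rewrite in_itv /= andbT.
have mA : measurable [set w | z w = z0 /\ s <= S w].
  exact: (measurableI _ _ mz mSz).
split=> //.
rewrite -[X in P X]setTI setIC -integral_indic //.
apply: (@le_trans _ _ (\int[P]_w ((expR (- s))%:E * (\1_[set w | z w = z0] w *
       \prod_(k | off k) expR (h k (r w k.1 k.2) (y w k.1 k.2)))%:E))%E).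
  apply: ge0_le_integral => //.
  - by apply/measurable_EFinP; exact: measurable_indic.
  - apply: emeasurable_funM => //; apply/measurable_EFinP/measurable_funM.
      exact: measurable_indic.
    under eq_fun do rewrite -expR_sum.
    exact: measurableT_comp.
  - move=> w _; rewrite lee_fin -expR_sum !indicE.
    have [|] := boolP (w \in [set w | z w = z0 /\ s <= S w]); rewrite ?inE /=.
      move=> [zw sw]; rewrite mem_set // mul1r -expRD.
      by rewrite -[X in X <= _]expR0 ler_expR addrC subr_ge0.
    by move=> _; rewrite !mulr_ge0 ?expR_ge0.
rewrite ge0_integralZl //; last 2 first.
- apply/measurable_EFinP/measurable_funM; first exact: measurable_indic.
  under eq_fun do rewrite -expR_sum.
  exact: measurableT_comp.
- by move=> w _; rewrite lee_fin mulr_ge0 ?indicE ?prodr_ge0 // => *; exact: expR_ge0.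
rewrite (@dyad_expectation z0 (fun k c u => expR (h k c u)) G) //; last first.
  by move=> k c; exact: measurableT_comp.
rewrite -EFinM lee_fin mulrCA ler_wpM2l ?prodr_ge0 //.
rewrite expRD mulrC ler_wpM2r ?expR_ge0 // expR_sum.
apply: ler_prod => k ok; rewrite hkap // andbT.
have G0 c : 0 <= G k c.
  rewrite -lee_fin -hG //; apply: integral_ge0 => u _.
  by rewrite lee_fin !mulr_ge0 ?expR_ge0 //; case: hfam.
by case/andP: rho01 => ? ?; rewrite addr_ge0 // mulr_ge0 // subr_ge0.
Qed.

End DyadLaw.

(** * Exponential tails of the centred dyad sums *)

(** The Kullback-Leibler divergence from the member [p0] of the family to the
    member [p]. *)
Definition bregman (R : realType) (psi : R -> R) (p0 p : R) : R :=
  psi p - psi p0 - (p - p0) * derive1 psi p0.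

(** [ctr] selects the noise of the observation, as opposed to that of the
    sampling indicator. *)
Definition dyad_noise (R : realType) (rho m : R) (ctr c : bool) (u : R) : R :=
  if ctr then c%:R * (u - m) else c%:R - rho.

(** From 1 - x <= exp (- x), by inversion. *)
Lemma expR_le_quad (R : realType) (x : R) : x <= 1 / 2 -> expR x <= 1 + x + 2 * x ^+ 2.
Proof.
move=> x2; have x1 : 0 < 1 - x by lra.
have : 1 + (- x) <= expR (- x) := expR_ge1Dx _.
rewrite expRN => h.
have : expR x <= (1 - x)^-1.
  by rewrite -[expR x]invrK lef_pV2 ?posrE ?invr_gt0 ?expR_gt0.
move=> /le_trans; apply; rewrite -[X in X <= _]mul1r ler_pdivrMr //.
have h2 : 0 <= x ^+ 2 * (1 - 2 * x) by rewrite mulr_ge0 ?sqr_ge0 //; lra.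
by rewrite -subr_ge0 (_ : _ - _ = x ^+ 2 * (1 - 2 * x)) //; ring.
Qed.

Lemma bernoulli_mgf (R : realType) (p x : R) : 0 <= p <= 1 -> x <= 1 / 2 ->
  p * expR (x * (1 - p)) + (1 - p) * expR (- (x * p)) <= expR (2 * p * x ^+ 2).
Proof.
move=> /andP[p0 p1] x2.
rewrite (_ : _ + _ = expR (- (x * p)) * (1 + p * (expR x - 1))); last first.
  rewrite (_ : x * (1 - p) = - (x * p) + x); last by ring.
  by rewrite expRD; ring.
rewrite (_ : 2 * p * x ^+ 2 = - (x * p) + (x * p + 2 * p * x ^+ 2)); last by ring.
rewrite expRD ler_wpM2l ?expR_ge0 //; apply: (le_trans _ (expR_ge1Dx _)).
have h : 0 <= p * (1 + x + 2 * x ^+ 2 - expR x) by rewrite mulr_ge0 ?subr_ge0 ?expR_le_quad.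
by rewrite -subr_ge0 (_ : _ - _ = p * (1 + x + 2 * x ^+ 2 - expR x)) //; ring.
Qed.

Section NoiseTail.
Context (R : realType) (Q n : nat).
Context (mu : {measure set (measurableTypeR R) -> \bar R}).
Context (A : set R) (b psi : R -> R) (hfam : regular_expfam mu A b psi).
Context (t : param R Q) (rho : R) (d : measure_display) (T : measurableType d).
Context (P : probability T R) (z : T -> assignment n Q).
Context (y : T -> 'I_n -> 'I_n -> R) (r : T -> 'I_n -> 'I_n -> bool).
Hypotheses (hdata : sbm_dyad_sampling mu b psi t rho P z y r).
Hypotheses (rho01 : 0 <= rho <= 1) (t_ge0 : forall q, 0 <= t.1 0 q).
Hypothesis tA : forall q l, A (t.2 q l).

(** Tilting an exponential family moves its parameter, so the centred moment
    generating function is read off the total mass at [p + x]; the cost of the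
    move is the Bregman divergence, that is the Kullback-Leibler divergence
    between the two members. *)
Lemma expfam_mgf (p x : R) : A (p + x) ->
  (\int[mu]_u (expfam b psi u p * expR (x * (u - derive1 psi p)))%:E
    = (expR (bregman psi p (p + x)))%:E)%E.
Proof.
move=> Apx.
transitivity (\int[mu]_u ((expR (bregman psi p (p + x)))%:E *
   (expfam b psi u (p + x))%:E))%E.
  apply: eq_integral => u _; rewrite -EFinM /expfam -mulrA -expRD mulrCA -expRD /bregman.
  by congr ((_ * expR _)%:E); ring.
rewrite ge0_integralZl //.
- by case: hfam => _ _ _ + _ _ _ _ => /(_ _ Apx) ->; rewrite mule1.
- by apply/measurable_EFinP; apply: measurable_expfam; exact: expfam_base_meas hfam.
- by move=> u _; rewrite lee_fin mulr_ge0 ?expR_ge0 //; exact: expfam_base_ge0 hfam _.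
Qed.

(** The factor [rho] in the exponent is essential: it makes a sum of [M]
    dyads deviate by [eps * rho * M] with probability exponentially small in
    [rho * M], the only scale compatible with sparse sampling. *)
Lemma noise_mgf (ctr : bool) (V p x : R) : A p -> A (p + x) -> x <= 1 / 2 ->
  bregman psi p (p + x) <= V * x ^+ 2 -> V * x ^+ 2 <= 1 / 2 -> 0 <= V ->
  0 <= bregman psi p (p + x) ->
  exists G : bool -> R,
    (forall c, (\int[mu]_u (expfam b psi u p *
        expR (x * dyad_noise rho (derive1 psi p) ctr c u))%:E = (G c)%:E)%E) /\
    rho * G true + (1 - rho) * G false <= expR (rho * (2 + 2 * V) * x ^+ 2).
Proof.
move=> Ap Apx x2 DV V2 V0 D0; have /andP[r0 r1] := rho01.
have exp_mono (a c : R) : a <= c -> 1 + a <= expR c.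
  by move=> ac; apply: (le_trans (expR_ge1Dx _)); rewrite ler_expR.
have mass1 (k : R) : 0 <= k -> (\int[mu]_u (expfam b psi u p * k)%:E = k%:E)%E.
  move=> k0; transitivity (\int[mu]_u (k%:E * (expfam b psi u p)%:E))%E.
      by apply: eq_integral => u _; rewrite -EFinM mulrC.
    rewrite ge0_integralZl //.
    - by case: hfam => _ _ _ + _ _ _ _ => /(_ _ Ap) ->; rewrite mule1.
    - by apply/measurable_EFinP; apply: measurable_expfam; exact: expfam_base_meas hfam.
    - by move=> u _; rewrite lee_fin mulr_ge0 ?expR_ge0 //; exact: expfam_base_ge0 hfam _.
case: ctr.
  exists (fun c => if c then expR (bregman psi p (p + x)) else 1); split.
    case; rewrite /dyad_noise.
      by under eq_integral do rewrite mul1r; exact: expfam_mgf.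
    by under eq_integral do rewrite mul0r mulr0 expR0; exact: mass1.
  have := @expR_le_quad R (bregman psi p (p + x)); move: D0 DV V2.
  set D := bregman _ _ _ => D0 DV V2 /(_ (le_trans DV V2)) eD.
  rewrite (_ : _ + _ = 1 + rho * (expR D - 1)); last by ring.
  apply: exp_mono; rewrite -mulrA ler_wpM2l //.
  set v := V * _ in DV V2; have x20 : 0 <= x ^+ 2 by exact: sqr_ge0.
  have -> : (2 + 2 * V) * x ^+ 2 = 2 * x ^+ 2 + 2 * v by rewrite /v; ring.
  have DD : 0 <= D * (1 / 2 - D) by rewrite mulr_ge0 //; lra.
  rewrite expr2 in eD; rewrite mulrBr in DD; lra.
exists (fun c => expR (x * (c%:R - rho))); split.
  by move=> c; rewrite /dyad_noise; apply: mass1; exact: expR_ge0.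
rewrite /= sub0r mulrN; apply: (le_trans (bernoulli_mgf rho01 x2)).
rewrite ler_expR [2 * rho]mulrC -!mulrA ler_wpM2l //.
by rewrite ler_wpM2r ?sqr_ge0 // lerDl mulr_ge0.
Qed.

(** [M] may exceed the number of dyads in [D]: blocks of very different sizes
    are later compared on the common scale of the Hamming distance. *)
Lemma noise_tail (z0 : assignment n Q) (ctr : bool) (D : pred ('I_n * 'I_n))
    (V M lam eps : R) :
  \sum_(k | off k && D k) 1 <= M -> 0 <= V -> 0 < lam -> lam <= 1 / 2 ->
  V * lam ^+ 2 <= 1 / 2 -> (2 + 2 * V) * lam <= eps / 2 ->
  (forall q l x, `|x| = lam -> A (t.2 q l + x) /\
     0 <= bregman psi (t.2 q l) (t.2 q l + x) <= V * lam ^+ 2) ->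
  let E := [set w | z w = z0 /\ eps * rho * M <=
      `|\sum_(k | off k && D k) dyad_noise rho (derive1 psi (t.2 (z0 k.1) (z0 k.2)))
           ctr (r w k.1 k.2) (y w k.1 k.2)|] in
  measurable E /\
  (P E <= ((\prod_i t.1 0 (z0 i)) * (2 * expR (- (lam * eps / 2) * (rho * M))))%:E)%E.
Proof.
move=> DM V0 lam0 lam2 V2 We hA E; have /andP[r0 r1] := rho01.
pose N k c u := dyad_noise rho (derive1 psi (t.2 (z0 k.1) (z0 k.2))) ctr c u.
pose S w := \sum_(k | off k && D k) N k (r w k.1 k.2) (y w k.1 k.2).
have mN k c : measurable_fun [set: R] (N k c).
  rewrite /N /dyad_noise; case: (ctr) => //; apply: measurable_funM => //.
  exact: measurable_funB.
pose h (sg : R) k c u := if D k then sg * lam * N k c u else 0.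
have Sh sg w : \sum_(k | off k) h sg k (r w k.1 k.2) (y w k.1 k.2) = lam * (sg * S w).
  rewrite -big_mkcondr mulrA [lam * _]mulrC /S mulr_sumr.
  by apply: eq_bigr.
have one (sg : R) : `|sg| = 1 ->
  measurable [set w | z w = z0 /\ eps * rho * M <= sg * S w] /\
  (P [set w | z w = z0 /\ (eps * rho * M <= sg * S w)%R] <=
     ((\prod_i t.1 0 (z0 i)) * expR (- (lam * eps / 2) * (rho * M)))%:E)%E.
  move=> sg1; have sgl : `|sg * lam| = lam by rewrite normrM sg1 mul1r gtr0_norm.
  have sgl2 : (sg * lam) ^+ 2 = lam ^+ 2.
    by rewrite -real_normK ?num_real // sgl.
  have HG : forall k, exists G : bool -> R,
    (forall c, (\int[mu]_u (expfam b psi u (t.2 (z0 k.1) (z0 k.2)) *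
        expR (h sg k c u))%:E = (G c)%:E)%E) /\
    rho * G true + (1 - rho) * G false <=
     expR ((D k)%:R * (rho * (2 + 2 * V) * lam ^+ 2)).
    move=> k; rewrite /h; case: (D k); last first.
      exists (fun=> 1); split; last by rewrite mul0r expR0; lra.
      move=> c; under eq_integral do rewrite expR0 mulr1.
      by case: hfam => _ _ _ + _ _ _ _; apply.
    have [Ax /andP[Dx0 DxV]] := hA (z0 k.1) (z0 k.2) _ sgl.
    have x2 : sg * lam <= 1 / 2 by rewrite (le_trans (ler_norm _)) // sgl.
    rewrite -sgl2 in DxV; have V2' := V2; rewrite -sgl2 in V2'.
    have [G0 [g1 g2]] := noise_mgf ctr (tA _ _) Ax x2 DxV V2' V0 Dx0.
    by exists G0; split => //; rewrite /= mul1r -sgl2.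
  have [G /all_and2[G1 G2]] := boolp.choice HG.
  have mh k c : measurable_fun [set: R] (h sg k c).
    by rewrite /h; case: (D k) => //; apply: measurable_funM.
  have := @dyad_chernoff R Q n mu A b psi hfam t rho d T P z y r hdata rho01 t_ge0 tA
    z0 (h sg) G _ (lam * (eps * rho * M)) mh (fun k c _ => G1 k c) (fun k _ => G2 k).
  under eq_set do rewrite Sh ler_pM2l //.
  case=> m1 p1; split => //; apply: (le_trans p1); rewrite lee_fin ler_wpM2l ?prodr_ge0 //.
  rewrite ler_expR -mulr_suml lerBlDr.
  have DM' : \sum_(k : 'I_n * 'I_n | off k) (D k)%:R <= M.
    by apply: le_trans DM; rewrite [X in _ <= X]big_mkcondr /= ler_sum // => k _; case: (D k).
  have rl : 0 <= rho * (2 + 2 * V) * lam ^+ 2 by rewrite !mulr_ge0 //; [lra|exact: ltW|exact: ltW].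
  apply: (le_trans (ler_wpM2r rl DM')).
  have M0 : 0 <= M by apply: le_trans DM'; apply: sumr_ge0.
  have -> : M * (rho * (2 + 2 * V) * lam ^+ 2) = ((2 + 2 * V) * lam) * (lam * (rho * M)) by ring.
  have -> : - (lam * eps / 2) * (rho * M) + lam * (eps * rho * M) = (eps / 2) * (lam * (rho * M)).
    by field.
  by rewrite ler_wpM2r // !mulr_ge0 // ltW.
have [m1 p1] := one 1 (normr1 _).
have [m2 p2] := one (-1) (normrN1 _).
have EU : E = [set w | z w = z0 /\ eps * rho * M <= 1 * S w] `|`
   [set w | z w = z0 /\ eps * rho * M <= -1 * S w].
  apply/seteqP; split => w /=; rewrite mul1r mulN1r.
    by move=> [h1]; rewrite ler_normr => /orP[]; [left|right].
  by move=> [] [h1 h2]; split => //; rewrite ler_normr h2 ?orbT.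
rewrite EU; split; first exact: measurableU.
apply: (le_trans (measureU2 _ m1 m2)).
by apply: (le_trans (leeD p1 p2)); rewrite -EFinD lee_fin -mulrDr mulr_natl.
Qed.

End NoiseTail.

(** * Assignments at a given Hamming distance, and the good event *)

Definition hamming (n Q : nat) (zs z : assignment n Q) : nat :=
  (\sum_i (z i != zs i))%N.

(** This identity replaces the usual count of assignments at distance [h]
    from [zs], both in the union bound and in the sum of the likelihoods. *)
Lemma sum_exp_hamming (R : realType) (n Q : nat) (zs : assignment n Q) (q : R) :
  \sum_z q ^+ hamming zs z = (1 + Q.-1%:R * q) ^+ n.
Proof.
transitivity (\sum_(z : assignment n Q) \prod_i q ^+ (z i != zs i)).
  by apply: eq_bigr => z _; rewrite prodrXr.
rewrite -(bigA_distr_bigA (fun i (l : 'I_Q) => q ^+ (l != zs i))).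
rewrite -[in RHS](card_ord n) -prodr_const.
apply: eq_bigr => i _; rewrite (bigD1 (zs i)) //= eqxx expr0; congr (_ + _).
rewrite (eq_bigr (fun=> q)); last by move=> l ->; rewrite expr1.
rewrite sumr_const -[q *+ _]mulr_natl; congr (_%:R * _).
by have := cardC1 (zs i); rewrite card_ord => <-; apply: eq_card => l; rewrite !inE.
Qed.

Definition joint_label (n Q : nat) (zs z : assignment n Q) (k : 'I_n * 'I_n) :=
  ((zs k.1, zs k.2), (z k.1, z k.2)).

(** The scale on which the noise of a block is controlled: blocks with a
    changed pair of labels must be controlled proportionally to the Hamming
    distance, because so is what is gained from them. *)
Definition block_scale (n Q : nat) (zs z : assignment n Q)
    (tau : ('I_Q * 'I_Q) * ('I_Q * 'I_Q)) : nat :=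
  if tau.1 == tau.2 then (n * n)%N else (2 * n * hamming zs z)%N.

(** A dyad whose pair of labels changes has an endpoint whose label changes,
    hence the factor [2 * n] times the Hamming distance. *)
Lemma block_card (R : realType) (n Q : nat) (zs z : assignment n Q) tau :
  \sum_(k | off k && (joint_label zs z k == tau)) 1 <= (block_scale zs z tau)%:R :> R.
Proof.
rewrite sumr_const ler_nat /block_scale; case: eqP => [_|/eqP ne].
  by rewrite -[X in (_ <= X * X)%N]card_ord -card_prod max_card.
rewrite -sum1_card; apply: (@leq_trans (\sum_(k : 'I_n * 'I_n)
   ((z k.1 != zs k.1) + (z k.2 != zs k.2)))%N).
  rewrite big_mkcond; apply: leq_sum => -[i j] _; rewrite unfold_in /=.
  case: ifP => // /andP[_ /eqP]; rewrite /joint_label /= => e; move: ne; rewrite -e /=.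
  rewrite xpair_eqE negb_and ![zs _ == _]eq_sym.
  by case: (z i != zs i); case: (z j != zs j).
rewrite -(pair_bigA _ (fun i j => (z i != zs i) + (z j != zs j))%N) /=.
under eq_bigr do rewrite big_split sum_nat_const card_ord /=.
by rewrite big_split /= -big_distrr /= sum_nat_const card_ord -mulnA mul2n -addnn mulnC.
Qed.

Section GoodEvent.
Context (R : realType) (Q n : nat) (m : 'I_Q -> 'I_Q -> R) (alpha : 'rV[R]_Q) (rho eps : R).

Definition block_noise (zs : assignment n Q) (y : 'I_n -> 'I_n -> R)
    (r : 'I_n -> 'I_n -> bool) (z : assignment n Q) (ctr : bool) tau : R :=
  \sum_(k | off k && (joint_label zs z k == tau))
    dyad_noise rho (m (zs k.1) (zs k.2)) ctr (r k.1 k.2) (y k.1 k.2).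

Definition balanced (zs : assignment n Q) : Prop :=
  forall q, `|\sum_i (zs i == q)%:R - n%:R * alpha 0 q| <= eps * n%:R.

Definition quiet (zs : assignment n Q) (y : 'I_n -> 'I_n -> R)
    (r : 'I_n -> 'I_n -> bool) : Prop :=
  forall z ctr tau,
    `|block_noise zs y r z ctr tau| <= eps * rho * (block_scale zs z tau)%:R.

End GoodEvent.

Lemma measure_fin_bigcup_le (R : realType) (d : measure_display) (T : measurableType d)
    (P : {measure set T -> \bar R}) (I : finType) (E : I -> set T) (p : I -> R) :
  (forall i, measurable (E i)) -> (forall i, (P (E i) <= (p i)%:E)%E) ->
  measurable (\bigcup_i E i) /\ (P (\bigcup_i E i) <= (\sum_i p i)%:E)%E.
Proof.
move=> mE pE.
have -> : \bigcup_i E i = \big[setU/set0]_i E i.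
  apply/seteqP; split => w.
    by move=> [i _ Ei]; rewrite (bigD1 i) //=; left.
  by elim/big_ind: _ => [//|A B hA hB [/hA|/hB] //|i _ Ei]; exists i.
apply: (big_ind2 (fun (A : set T) (a : R) => measurable A /\ (P A <= a%:E)%E)) => //.
- by rewrite measure0.
- move=> A1 a1 A2 a2 [mA1 h1] [mA2 h2]; split; first exact: measurableU.
  by apply: (le_trans (measureU2 _ mA1 mA2)); rewrite EFinD leeD.
Qed.

(** Chernoff's bound again, now by summing over the finitely many values of
    the memberships. *)
Lemma balanced_tail (R : realType) (Q n : nat) (alpha : 'rV[R]_Q) (eps : R) (q : 'I_Q) :
  (forall l, 0 <= alpha 0 l) -> \sum_l alpha 0 l = 1 -> 0 < eps -> eps <= 1 ->
  \sum_(z : assignment n Q | eps * n%:R < `|\sum_i (z i == q)%:R - n%:R * alpha 0 q|)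
     \prod_i alpha 0 (z i) <= 2 * expR (- (eps ^+ 2 / 8) * n%:R).
Proof.
move=> a0 a1 e0 e1.
have aq1 : alpha 0 q <= 1.
  by rewrite -a1 (bigD1 q) //= lerDl sumr_ge0.
(* [eps / 4] minimises [2 * x ^ 2 - x * eps], which bounds the exponent per node. *)
have one (x : R) : `|x| = eps / 4 ->
  \sum_(z : assignment n Q) (\prod_i alpha 0 (z i)) *
    expR (x * (\sum_i (z i == q)%:R - n%:R * alpha 0 q) - eps / 4 * (eps * n%:R))
   <= expR (- (eps ^+ 2 / 8) * n%:R).
  move=> xe; have x2 : x <= 1 / 2 by rewrite (le_trans (ler_norm x)) // xe; lra.
  have xx : x ^+ 2 = (eps / 4) ^+ 2 by rewrite -xe real_normK ?num_real.
  under eq_bigr do rewrite expRD mulrA.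
  rewrite -mulr_suml.
  rewrite (eq_bigr (fun z : assignment n Q => \prod_i (alpha 0 (z i) *
     expR (x * ((z i == q)%:R - alpha 0 q))))); last first.
    move=> z _; rewrite big_split /= -expR_sum -mulr_sumr sumrB sumr_const card_ord.
    by rewrite mulr_natl.
  rewrite -(bigA_distr_bigA (fun (i : 'I_n) (l : 'I_Q) => alpha 0 l *
     expR (x * ((l == q)%:R - alpha 0 q)))).
  rewrite prodr_const card_ord.
  have hin : \sum_l alpha 0 l * expR (x * ((l == q)%:R - alpha 0 q)) <=
      expR (2 * (eps / 4) ^+ 2).
    rewrite (bigD1 q) //= eqxx.
    rewrite (eq_bigr (fun l => alpha 0 l * expR (- (x * alpha 0 q)))); last first.
      by move=> l /negPf ->; rewrite sub0r mulrN.
    rewrite -mulr_suml (_ : \sum_(l | l != q) alpha 0 l = 1 - alpha 0 q); last first.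
      by rewrite -a1 [in RHS](bigD1 q) //= addrAC subrr add0r.
    apply: le_trans (bernoulli_mgf _ x2) _; first by rewrite a0 aq1.
    rewrite ler_expR xx; have := sqr_ge0 (eps / 4); nra.
  have h0 : 0 <= \sum_l alpha 0 l * expR (x * ((l == q)%:R - alpha 0 q)).
    by apply: sumr_ge0 => l _; rewrite mulr_ge0 ?expR_ge0.
  apply: (@le_trans _ _ (expR (2 * (eps / 4) ^+ 2) ^+ n * expR (- (eps / 4 * (eps * n%:R))))).
    by rewrite ler_wpM2r ?expR_ge0 // lerXn2r // nnegrE expR_ge0.
  rewrite -expRM_natl -expRD ler_expR le_eqVlt; apply/orP; left; apply/eqP; by field.
pose f (x : R) (z : assignment n Q) : R := (\prod_i alpha 0 (z i)) *
  expR (x * (\sum_i (z i == q)%:R - n%:R * alpha 0 q) - eps / 4 * (eps * n%:R)).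
have : \sum_(z : assignment n Q | eps * n%:R < `|\sum_i (z i == q)%:R - n%:R * alpha 0 q|)
     \prod_i alpha 0 (z i) <= \sum_z (f (eps / 4) z + f (- (eps / 4)) z).
  rewrite big_mkcond; apply: ler_sum => z _; rewrite /f -mulrDr.
  have p0 : 0 <= \prod_i alpha 0 (z i) by apply: prodr_ge0.
  case: ifP => [|_]; last by rewrite mulr_ge0 // addr_ge0 ?expR_ge0.
  set S := \sum_i _ - _ => h; apply: ler_peMr => //.
  have e4 : 0 < eps / 4 by lra.
  move: h; rewrite ltr_normr => /orP[] h.
    apply: (@le_trans _ _ (expR (eps / 4 * S - eps / 4 * (eps * n%:R)))).
      by rewrite -[X in X <= _]expR0 ler_expR -mulrBr mulr_ge0 ?subr_ge0 ?ltW.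
    by rewrite lerDl expR_ge0.
  apply: (@le_trans _ _ (expR (- (eps / 4) * S - eps / 4 * (eps * n%:R)))).
    by rewrite -[X in X <= _]expR0 ler_expR mulNr -mulrN -mulrBr mulr_ge0 ?subr_ge0 ?ltW.
  by rewrite lerDr expR_ge0.

move=> /le_trans; apply; rewrite big_split /= mulr_natl mulr2n; apply: lerD; apply: one.
  by rewrite ger0_norm //; lra.
by rewrite normrN ger0_norm //; lra.
Qed.

(** * Probability of the good event *)

Section GoodEventProbability.
Context (R : realType) (Q n : nat).
Context (mu : {measure set (measurableTypeR R) -> \bar R}).
Context (A : set R) (b psi : R -> R) (hfam : regular_expfam mu A b psi).
Context (t : param R Q) (rho : R) (d : measure_display) (T : measurableType d).
Context (P : probability T R) (z : T -> assignment n Q).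
Context (y : T -> 'I_n -> 'I_n -> R) (r : T -> 'I_n -> 'I_n -> bool).
Hypotheses (hdata : sbm_dyad_sampling mu b psi t rho P z y r).
Hypotheses (rho01 : 0 <= rho <= 1) (t_param : is_param t).
Hypothesis tA : forall q l, A (t.2 q l).
Context (V lam eps : R).
Hypotheses (V0 : 0 <= V) (lam0 : 0 < lam) (lam2 : lam <= 1 / 2) (Vlam : V * lam ^+ 2 <= 1 / 2).
Hypotheses (eps0 : 0 < eps) (eps1 : eps <= 1) (lam_eps : (2 + 2 * V) * lam <= eps / 2).
Hypothesis tlam : forall q l x, `|x| = lam -> A (t.2 q l + x) /\
  0 <= bregman psi (t.2 q l) (t.2 q l + x) <= V * lam ^+ 2.

Let m q l := derive1 psi (t.2 q l).
Let prior (z0 : assignment n Q) : R := \prod_i t.1 0 (z0 i).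

Let prior_ge0 z0 : 0 <= prior z0.
Proof. by apply: prodr_ge0 => i _; exact: t_param.1. Qed.

Lemma prior_sum : \sum_z0 prior z0 = 1.
Proof.
rewrite -(bigA_distr_bigA (fun (i : 'I_n) l => t.1 0 l)).
by rewrite big1 // => i _; exact: t_param.2.
Qed.

Let rate := lam * eps / 2.

(** The three terms come from the class sizes, from the blocks with
    unchanged labels, and from the blocks with changed labels. *)
Definition failure_bound : R :=
  2 * Q%:R * expR (- (eps ^+ 2 / 8) * n%:R) +
  4 * Q%:R ^+ 4 * (Q%:R ^+ n * expR (- rate * (rho * (n * n)%:R)) +
      ((1 + Q.-1%:R * expR (- rate * (rho * (2 * n)%:R))) ^+ n - 1)).

Lemma unbalanced_prob : exists B : set T, [/\ measurable B,
  [set w | ~ balanced t.1 eps (z w)] `<=` B &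
  (P B <= (2 * Q%:R * expR (- (eps ^+ 2 / 8) * n%:R))%:E)%E].
Proof.
pose bad q (z0 : assignment n Q) :=
  eps * n%:R < `|\sum_i (z0 i == q)%:R - n%:R * t.1 0 q|.
pose E (qz : 'I_Q * assignment n Q) :=
  if bad qz.1 qz.2 then [set w | z w = qz.2] else set0.
pose p (qz : 'I_Q * assignment n Q) := if bad qz.1 qz.2 then prior qz.2 else 0.
have mE qz : measurable (E qz).
  by rewrite /E; case: ifP => // _; exact: (sbm_meas_z hdata).
have pE qz : (P (E qz) <= (p qz)%:E)%E.
  by rewrite /E /p; case: ifP => _; rewrite ?measure0 // (sbm_law_z hdata).
have [mU pU] := measure_fin_bigcup_le mE pE.
exists (\bigcup_i E i); split => //.
  move=> w /= /existsNP[q /negP]; rewrite -ltNge => h.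
  by exists (q, z w) => //; rewrite /E /= /bad h.
apply: (le_trans pU); rewrite lee_fin -(pair_bigA _ (fun q z0 => p (q, z0))) /=.
apply: (@le_trans _ _ (\sum_(q < Q) 2 * expR (- (eps ^+ 2 / 8) * n%:R))).
  apply: ler_sum => q _; rewrite /p /= -big_mkcond /=.
  by apply: balanced_tail => //; case: t_param.
by rewrite sumr_const card_ord -[_ *+ Q]mulr_natl mulrCA mulrA.
Qed.

(** Outside this null event the likelihoods are positive, so the convention
    [ln 0 = 0] does not interfere with the variational objective. *)
Lemma base_pos_prob : exists B : set T, [/\ measurable B,
  [set w | ~ forall i j, i != j -> 0 < b (y w i j)] `<=` B &
  (P B <= 0%:E)%E].
Proof.
have mb := expfam_base_meas hfam; have b0 := expfam_base_ge0 hfam.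
pose Z := b @^-1` [set 0].
have mZ : measurable Z by rewrite -[X in measurable X]setTI; apply: mb.
pose E (kz : ('I_n * 'I_n) * assignment n Q) :=
  [set w | z w = kz.2 /\ off kz.1 /\ b (y w kz.1.1 kz.1.2) = 0].
have mPE kz : measurable (E kz) /\ (P (E kz) <= 0%:E)%E.
  case: kz => k z0; rewrite /E /=; have [ok|nok] := boolP (off k); last first.
    rewrite (_ : [set w | _] = set0) ?measure0 //.
    by apply/seteqP; split => w //= -[_ []].
  pose B i j := if (i, j) == k then Z else setT.
  have mB i j : measurable (B i j) by rewrite /B; case: ifP.
  have EB : [set w | z w = z0 /\ true /\ b (y w k.1 k.2) = 0] =
    [set w | z w = z0 /\ forall i j, i != j -> B i j (y w i j)].
    apply/seteqP; split => w /= [zw].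
      move=> [_ bw]; split => // i j _; rewrite /B; case: eqP => // e.
      by rewrite /Z /=; rewrite -e /= in bw.
    move=> h; split => //; split => //.
    by have := h _ _ ok; rewrite /B -surjective_pairing eqxx.
  split.
    rewrite (_ : [set w | _] = [set w | z w = z0] `&` (fun w => y w k.1 k.2) @^-1` Z); last first.
      by apply/seteqP; split => w /=; [move=> [? []]|move=> [? ?]].
    apply: measurableI; first exact: (sbm_meas_z hdata).
    by rewrite -[X in measurable X]setTI; apply: (sbm_meas_y hdata).
  rewrite EB (sbm_law_y hdata z0 mB) (bigD1 k.1) //= (bigD1 k.2) /=; last first.
    by rewrite eq_sym.
  rewrite {1}/B -surjective_pairing eqxx (_ : \int[mu]_(u in Z) _ = 0) ?mul0r ?mule0 //.
  rewrite /Rintegral integral0_eq // => u; rewrite /Z /= => bu.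
  by rewrite /expfam bu mul0r.
have [mU pU] := measure_fin_bigcup_le (fun kz => (mPE kz).1) (fun kz => (mPE kz).2).
exists (\bigcup_i E i); split => //.
  move=> w /= /existsNP[i /existsNP[j /not_implyP[ij /negP]]]; rewrite -leNgt => h.
  exists ((i, j), z w) => //; rewrite /E /=; split => //; split => //.
  by apply/eqP; rewrite eq_le h b0.
by apply: (le_trans pU); rewrite big1.
Qed.

(** Blocks with two different pairs of labels are empty when [z1 = z0], so
    the union bound only meets assignments at positive Hamming distance and the
    summand [1] of the geometric identity cancels. *)
Lemma loud_prob : exists B : set T, [/\ measurable B,
  [set w | ~ quiet m rho eps (z w) (y w) (r w)] `<=` B &
  (P B <= (4 * Q%:R ^+ 4 * (Q%:R ^+ n * expR (- rate * (rho * (n * n)%:R)) +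
      ((1 + Q.-1%:R * expR (- rate * (rho * (2 * n)%:R))) ^+ n - 1)))%:E)%E].
Proof.
pose block := (('I_Q * 'I_Q) * ('I_Q * 'I_Q))%type.
pose relevant (z0 z1 : assignment n Q) (tau : block) := (tau.1 == tau.2) || (z1 != z0).
pose E (x : assignment n Q * (assignment n Q * (bool * block))) :=
  let: (z0, (z1, (ctr, tau))) := x in
  if relevant z0 z1 tau then
    [set w | z w = z0 /\ eps * rho * (block_scale z0 z1 tau)%:R <=
       `|\sum_(k | off k && (joint_label z0 z1 k == tau))
           dyad_noise rho (m (z0 k.1) (z0 k.2)) ctr (r w k.1 k.2) (y w k.1 k.2)|]
  else set0.
pose e1 := expR (- rate * (rho * (n * n)%:R)).
pose e2 := expR (- rate * (rho * (2 * n)%:R)).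
pose bnd (z0 z1 : assignment n Q) := 2 * (e1 + if z1 != z0 then e2 ^+ hamming z0 z1 else 0).
have e10 : 0 <= e1 by exact: expR_ge0.
have e20 : 0 <= e2 by exact: expR_ge0.
have mPE x : measurable (E x) /\ (P (E x) <= (prior x.1 * bnd x.1 x.2.1)%:E)%E.
  case: x => z0 [z1 [ctr tau]]; rewrite /E /=; case: ifP => rel; last first.
    rewrite measure0; split => //; rewrite lee_fin !mulr_ge0 // addr_ge0 //.
    by case: ifP => // _; rewrite exprn_ge0.
  have [mE pE] := @noise_tail R Q n mu A b psi hfam t rho d T P z y r hdata rho01
    t_param.1 tA z0 ctr (fun k => joint_label z0 z1 k == tau) V
    (block_scale z0 z1 tau)%:R lam eps (block_card _ _ _ _) V0 lam0 lam2 Vlam lam_eps tlam.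
  split => //; apply: (le_trans pE); rewrite lee_fin; apply: (ler_wpM2l (prior_ge0 z0)).
  apply: ler_wpM2l => //.
  rewrite /block_scale; move: rel; rewrite /relevant; case: (tau.1 == tau.2) => /= [_|->].
    by rewrite lerDl; case: ifP => // _; rewrite exprn_ge0.
  have -> : - (lam * eps / 2) * (rho * (2 * n * hamming z0 z1)%:R) =
    - rate * (rho * (2 * n)%:R) * (hamming z0 z1)%:R by rewrite /rate !natrM; ring.
  by rewrite expRM_natr -/e2 lerDr.
have [mU pU] := measure_fin_bigcup_le (fun x => (mPE x).1) (fun x => (mPE x).2).
exists (\bigcup_x E x); split => //.
  move=> w /= /existsNP[z1 /existsNP[ctr /existsNP[tau /negP]]]; rewrite -ltNge => h.
  exists (z w, (z1, (ctr, tau))) => //; rewrite /E.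
  have -> : relevant (z w) z1 tau.
    rewrite /relevant; apply: contraTT h; rewrite negb_or negbK => /andP[nt /eqP ->].
    rewrite -leNgt /block_noise big1 ?normr0; last first.
      move=> k /andP[_ /eqP e]; move: nt; rewrite -e /joint_label /= eqxx //.
    by case/andP: rho01 => *; rewrite !mulr_ge0 // ltW.
  by split => //; exact: ltW.
apply: (le_trans pU); rewrite lee_fin.
rewrite -(pair_bigA _ (fun z0 (x : assignment n Q * (bool * block)) => prior z0 * bnd z0 x.1)) /=.
apply: (@le_trans _ _ (\sum_z0 prior z0 * (4 * Q%:R ^+ 4 * (Q%:R ^+ n * e1 +
      ((1 + Q.-1%:R * e2) ^+ n - 1))))); last by rewrite -mulr_suml prior_sum mul1r.
apply: ler_sum => z0 _; rewrite -mulr_sumr ler_wpM2l //.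
rewrite -(pair_bigA _ (fun z1 (x : bool * block) => bnd z0 z1)) /=.
under eq_bigr do rewrite sumr_const !card_prod card_bool !card_ord.
rewrite sumrMnl -mulr_natl /bnd -mulr_sumr big_split /= sumr_const card_ffun !card_ord.
rewrite -big_mkcond /= -(sum_exp_hamming z0 e2) [X in _ <= _ * (_ + (X - _))](bigD1 z0) //=.
have -> : hamming z0 z0 = 0%N by rewrite /hamming big1 // => i _; rewrite eqxx.
rewrite expr0 [1 + _ - 1]addrAC subrr add0r -[e1 *+ _]mulr_natl natrX.
set X := Q%:R ^+ n * e1 + _; rewrite -[X in X <= _]mulr_natr !natrM.
by rewrite le_eqVlt; apply/orP; left; apply/eqP; ring.
Qed.

Lemma good_event : exists B : set T, [/\ measurable B,
  [set w | ~ [/\ balanced t.1 eps (z w), quiet m rho eps (z w) (y w) (r w) &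
     forall i j, i != j -> 0 < b (y w i j)]] `<=` B &
  (P B <= failure_bound%:E)%E].
Proof.
have [B1 [m1 s1 p1]] := unbalanced_prob.
have [B2 [m2 s2 p2]] := loud_prob.
have [B3 [m3 s3 p3]] := base_pos_prob.
have m12 := measurableU _ _ m1 m2.
exists (B1 `|` B2 `|` B3); split; first exact: measurableU.
  move=> w /= h; case: (pselect (B1 w)) => [|n1]; first by left; left.
  case: (pselect (B2 w)) => [|n2]; first by left; right.
  right; apply: s3 => /= h3; apply: h; split => //.
    by apply: contrapT => h1; apply: n1; exact: s1.
  by apply: contrapT => h2; apply: n2; exact: s2.
apply: (le_trans (measureU2 _ m12 m3)).
rewrite -[X in (_ <= X)%E]adde0; apply: leeD => //.
apply: (le_trans (measureU2 _ m1 m2)).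
by rewrite /failure_bound EFinD; exact: leeD.
Qed.

End GoodEventProbability.

(** * Curvature of the log-partition function *)

Section Curvature.
Context (R : realType) (psi : R -> R).

(** Quantitative strict convexity: on the range of the parameters the
    variance function lies between positive constants. *)
Definition curved (a1 a2 v V : R) : Prop :=
  [/\ 0 < v, 0 < V,
      (forall p0 p, a1 <= p0 <= a2 -> a1 <= p <= a2 -> p0 <= p ->
        v * (p - p0) <= derive1 psi p - derive1 psi p0 <= V * (p - p0)) &
      (forall p0 p, a1 <= p0 <= a2 -> a1 <= p <= a2 ->
        v * (p - p0) ^+ 2 <= bregman psi p0 p <= V * (p - p0) ^+ 2)].

Section FromSlopes.
Variables (a1 a2 v V : R).
Hypotheses (v0 : 0 < v) (V0 : 0 < V).
Hypothesis mvt : forall x y, a1 <= x -> x <= y -> y <= a2 ->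
  exists2 c, x <= c <= y & psi y - psi x = derive1 psi c * (y - x).
Hypothesis slope : forall x y, a1 <= x -> x <= y -> y <= a2 ->
  v * (y - x) <= derive1 psi y - derive1 psi x <= V * (y - x).

(** The lower bound splits the interval at its midpoint: the mean value
    points of the first half may stick to [p0], those of the second half may
    not. This costs the factor 4. *)
Lemma curved_of_slopes : curved a1 a2 (v / 4) V.
Proof.
split => //; first by rewrite divr_gt0.
  move=> p0 p /andP[h1 h2] /andP[h3 h4] h5; have /andP[s1 s2] := slope h1 h5 h4.
  rewrite s2 andbT; apply: le_trans s1; rewrite ler_wpM2r ?subr_ge0 //; have := v0; lra.
move=> p0 p /andP[h1 h2] /andP[h3 h4]; rewrite /bregman.
have [h5|h5] := leP p0 p.
  have mm : p0 <= (p0 + p) / 2 <= p by lra.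
  set m := (p0 + p) / 2 in mm; case/andP: mm => m1 m2.
  have [c1 /andP[c1a c1b] e1] := mvt h1 m1 (le_trans m2 h4).
  have [c2 /andP[c2a c2b] e2] := mvt (le_trans h1 m1) m2 h4.
  have [c /andP[ca cb] e] := mvt h1 h5 h4.
  apply/andP; split.
    have /andP[s1 _] := slope h1 c1a (le_trans c1b (le_trans m2 h4)).
    have /andP[s2 _] := slope h1 (le_trans m1 c2a) (le_trans c2b h4).
    have -> : psi p - psi p0 - (p - p0) * derive1 psi p0 =
       (derive1 psi c1 - derive1 psi p0) * ((p - p0) / 2) +
       (derive1 psi c2 - derive1 psi p0) * ((p - p0) / 2).
      transitivity ((psi p - psi m) + (psi m - psi p0) - (p - p0) * derive1 psi p0).
        by ring.
      by rewrite e1 e2 /m; field.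
    have d0 : 0 <= (p - p0) / 2 by lra.
    have t1 : 0 <= derive1 psi c1 - derive1 psi p0.
      by apply: le_trans s1; rewrite mulr_ge0 ?subr_ge0 // ltW.
    have t2 : v * ((p - p0) / 2) <= derive1 psi c2 - derive1 psi p0.
      have c2m : (p0 + p) / 2 <= c2 := c2a.
      by apply: le_trans s2; apply: ler_wpM2l; [exact: ltW|lra].
    have -> : v / 4 * (p - p0) ^+ 2 = v * ((p - p0) / 2) * ((p - p0) / 2) by field.
    rewrite -[X in X <= _]add0r.
    by apply: lerD; [exact: mulr_ge0|exact: ler_wpM2r].
  have /andP[_ s] := slope h1 ca (le_trans cb h4).
  rewrite e -[derive1 psi c * _]mulrC -mulrBr expr2 mulrCA ler_wpM2l ?subr_ge0 //.
  by apply: (le_trans s); apply: ler_wpM2l; [exact: ltW|rewrite lerD2r].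
have h6 := ltW h5.
have mm : p <= (p0 + p) / 2 <= p0 by lra.
set m := (p0 + p) / 2 in mm; case/andP: mm => m1 m2.
have [c1 /andP[c1a c1b] e1] := mvt h3 m1 (le_trans m2 h2).
have [c2 /andP[c2a c2b] e2] := mvt (le_trans h3 m1) m2 h2.
have [c /andP[ca cb] e] := mvt h3 h6 h2.
apply/andP; split.
  have /andP[s1 _] := slope (le_trans h3 c1a) (le_trans c1b m2) h2.
  have /andP[s2 _] := slope (le_trans (le_trans h3 m1) c2a) c2b h2.
  have -> : psi p - psi p0 - (p - p0) * derive1 psi p0 =
     (derive1 psi p0 - derive1 psi c1) * ((p0 - p) / 2) +
     (derive1 psi p0 - derive1 psi c2) * ((p0 - p) / 2).
    transitivity (- ((psi p0 - psi m) + (psi m - psi p)) - (p - p0) * derive1 psi p0).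
      by ring.
    by rewrite e1 e2 /m; field.
  have d0 : 0 <= (p0 - p) / 2 by lra.
  have t1 : 0 <= derive1 psi p0 - derive1 psi c2.
    by apply: le_trans s2; rewrite mulr_ge0 ?subr_ge0 // ltW.
  have t2 : v * ((p0 - p) / 2) <= derive1 psi p0 - derive1 psi c1.
    have c1m : c1 <= (p0 + p) / 2 := c1b.
    by apply: le_trans s1; apply: ler_wpM2l; [exact: ltW|lra].
  have -> : v / 4 * (p - p0) ^+ 2 = v * ((p0 - p) / 2) * ((p0 - p) / 2) by field.
  rewrite -[X in X <= _]addr0.
  by apply: lerD; [exact: ler_wpM2r|exact: mulr_ge0].
have /andP[_ s] := slope (le_trans h3 ca) cb h2.
have -> : psi p - psi p0 - (p - p0) * derive1 psi p0 =
   (p0 - p) * (derive1 psi p0 - derive1 psi c).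
  by rewrite -[psi p - psi p0]opprB e; ring.
have -> : V * (p - p0) ^+ 2 = (p0 - p) * (V * (p0 - p)) by ring.
rewrite ler_wpM2l ?subr_ge0 //; apply: (le_trans s).
by apply: ler_wpM2l; [exact: ltW|rewrite lerD2l lerN2].
Qed.

End FromSlopes.

Context (mu : {measure set (measurableTypeR R) -> \bar R}) (A : set R) (b : R -> R).
Hypothesis hfam : regular_expfam mu A b psi.
Variables (a1 a2 : R).
Hypotheses (a12 : a1 <= a2) (aA : [set` `[a1, a2]] `<=` interior A).

Let smooth (k : nat) x : a1 <= x <= a2 -> derivable (derive1n k psi) x 1.
Proof. by move=> h; apply: (expfam_smooth hfam); apply: aA; rewrite /= in_itv. Qed.

Lemma derive1n_mvt (k : nat) x y : a1 <= x -> x <= y -> y <= a2 ->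
  exists2 c, x <= c <= y &
    derive1n k psi y - derive1n k psi x = derive1n k.+1 psi c * (y - x).
Proof.
move=> h1 h2 h3; have := @MVT_segment R (derive1n k psi) (derive1n k.+1 psi) x y h2.
case.
- move=> u; rewrite in_itv => /andP[u1 u2].
  rewrite (_ : derive1n k.+1 psi u = derive1 (derive1n k psi) u) // derive1E.
  apply: derivableP; apply: smooth.
  by rewrite (le_trans h1 (ltW u1)) (le_trans (ltW u2) h3).
- apply: derivable_within_continuous => u; rewrite in_itv /= => /andP[u1 u2].
  by apply: smooth; rewrite (le_trans h1 u1) (le_trans u2 h3).
- by move=> c; rewrite in_itv /= => cxy e; exists c.
Qed.

Lemma mean_ivt x y u : a1 <= x -> x <= y -> y <= a2 ->
  derive1 psi x <= u <= derive1 psi y -> exists2 c, x <= c <= y & derive1 psi c = u.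
Proof.
move=> h1 h2 h3 /andP[u1 u2]; have := @IVT R (derive1 psi) x y u h2; case.
- apply: derivable_within_continuous => w; rewrite in_itv /= => /andP[w1 w2].
  by apply: (@smooth 1%N); rewrite (le_trans h1 w1) (le_trans w2 h3).
- by rewrite ge_min u1 le_max u2 orbT.
- by move=> c; rewrite in_itv /= => cxy e; exists c.
Qed.

(** The second derivative is continuous and positive on a compact interval,
    so it is bounded above and below there. *)
Lemma expfam_curved : exists v V, curved a1 a2 v V.
Proof.
have c2 : {within `[a1, a2], continuous (derive1n 2 psi)}.
  by apply: derivable_within_continuous => u; rewrite in_itv => ui; exact: (@smooth 2 u ui).
have [c1 c1i hmin] := EVT_min a12 c2; have [c3 c3i hmax] := EVT_max a12 c2.
have v0 : 0 < derive1n 2 psi c1 by apply: (expfam_var_gt0 hfam); exact: aA.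
have V0 : 0 < derive1n 2 psi c3 by apply: (expfam_var_gt0 hfam); exact: aA.
exists (derive1n 2 psi c1 / 4), (derive1n 2 psi c3).
apply: curved_of_slopes => //.
  by move=> x y h1 h2 h3; exact: (@derive1n_mvt 0 x y).
move=> x y h1 h2 h3; have [c /andP[ca cb] e] := @derive1n_mvt 1 x y h1 h2 h3.
have ci : c \in `[a1, a2] by rewrite in_itv /= (le_trans h1 ca) (le_trans cb h3).
rewrite -/(derive1n 1 psi) e.
have xy0 : 0 <= y - x by rewrite subr_ge0.
by apply/andP; split; apply: (ler_wpM2r xy0); [exact: hmin|exact: hmax].
Qed.

End Curvature.

(** Needed on the whole interior of [A], where [pi_hat] looks for a preimage
    of the observed mean. *)
Lemma mean_inj (R : realType) (psi : R -> R) (mu : {measure set (measurableTypeR R) -> \bar R})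
    (A : set R) (b : R -> R) (hfam : regular_expfam mu A b psi) (p q : R) :
  interior A p -> interior A q -> derive1 psi p = derive1 psi q -> p = q.
Proof.
wlog pq : p q / p <= q => [wl Ap Aq e|Ap Aq e].
  by have [pq|/ltW qp] := leP p q; [exact: wl|apply/esym; exact: wl].
move: pq; rewrite le_eqVlt => /orP[/eqP //|pq].
have inA : [set` `[p, q]] `<=` interior A.
  move=> u; rewrite /= in_itv /= => /andP[].
  rewrite le_eqVlt => /orP[/eqP <- //|pu]; rewrite le_eqVlt => /orP[/eqP -> //|uq].
  have : nbhs u [set` `]p, q[] by apply: near_in_itvoo; rewrite in_itv /= pu uq.
  apply: filterS => w; rewrite /= in_itv /= => /andP[pw wq].
  apply: (expfam_interval hfam (interior_subset Ap) (interior_subset Aq)).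
  by rewrite !ltW.
have [c /andP[c1 c2]] := derive1n_mvt hfam inA 1 (lexx p) (ltW pq) (lexx q).
have e' : derive1n 1 psi p = derive1n 1 psi q := e.
rewrite e' subrr => /esym/eqP; rewrite mulf_eq0 subr_eq0 => /orP[/eqP h|/eqP ->//].
have : 0 < derive1n 2 psi c.
  by apply: (expfam_var_gt0 hfam); apply: inA; rewrite /= in_itv /= c1 c2.
by rewrite h ltxx.
Qed.

(** * Separation of assignments *)

(** Pigeonhole: inside each true class some label is taken by at least one
    [Q]-th of the nodes. *)
Lemma majority_map (R : realType) (n Q : nat) (zs z : assignment n Q) (N : R) :
  (forall q, Q%:R * N <= \sum_i (zs i == q)%:R) ->
  exists s : 'I_Q -> 'I_Q, forall q, N <= \sum_i ((zs i == q) && (z i == s q))%:R.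
Proof.
move=> hN.
suff /boolp.choice[s hs] : forall q, exists l, N <= \sum_i ((zs i == q) && (z i == l))%:R.
  by exists s.
move=> q; apply: contrapT => /forallNP h.
have := hN q; apply/negP; rewrite -ltNge.
have Q0 : (0 < Q)%N by apply: leq_ltn_trans (ltn_ord q).
have -> : \sum_i (zs i == q)%:R = \sum_(l < Q) \sum_i ((zs i == q) && (z i == l))%:R :> R.
  rewrite exchange_big /=; apply: eq_bigr => i _.
  rewrite (bigD1 (z i)) //= eqxx andbT big1 ?addr0 // => l ne.
  by rewrite [z i == l]eq_sym (negPf ne) andbF.
rewrite mulr_natl -[X in N *+ X]card_ord -sumr_const.
apply: ltr_sum => [|l _]; last by rewrite ltNge; apply/negP; exact: h.
by apply/hasP; exists q; rewrite ?mem_index_enum.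
Qed.

(** The [- 1] pays for the diagonal. *)
Lemma count_off_ge (R : realType) (n : nat) (f : 'I_n * 'I_n -> R) (U : pred 'I_n)
    (W : 'I_n -> pred 'I_n) (N f0 : R) :
  (forall k, off k -> 0 <= f k) -> 0 <= f0 ->
  (forall i, U i -> N <= \sum_j (W i j)%:R) ->
  (forall i j, U i -> W i j -> i != j -> f0 <= f (i, j)) ->
  (\sum_i (U i)%:R) * ((N - 1) * f0) <= \sum_(k | off k) f k.
Proof.
move=> fge f00 hN hf.
rewrite mulr_suml (_ : \sum_(k | off k) f k = \sum_i \sum_(j | j != i) f (i, j)); last first.
  rewrite pair_big_dep /=; apply: eq_big => [k|[i j] //]; by rewrite /off eq_sym.
apply: ler_sum => i _; have [Ui|nUi] := boolP (U i); last first.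
  by rewrite mul0r sumr_ge0 // => j ji; rewrite fge // /off eq_sym.
rewrite mul1r; apply: (@le_trans _ _ (\sum_(j | j != i) (W i j)%:R * f0)).
  rewrite -mulr_suml ler_wpM2r // lerBlDr.
  apply: (le_trans (hN i Ui)); rewrite (bigD1 i) //= addrC lerD2l.
  by case: (W i i).
apply: ler_sum => j ji; have [Wj|nWj] := boolP (W i j).
  by rewrite mul1r hf // eq_sym.
by rewrite mul0r fge // /off eq_sym.
Qed.

Lemma sum_hamming (R : realType) (n Q : nat) (zs z : assignment n Q) :
  \sum_i (z i != zs i)%:R = (hamming zs z)%:R :> R.
Proof. by rewrite /hamming natr_sum. Qed.

Lemma hamming_le (n Q : nat) (zs z : assignment n Q) : (hamming zs z <= n)%N.
Proof.
rewrite /hamming; apply: (@leq_trans (\sum_(i < n) 1)%N).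
  by apply: leq_sum => i _; case: (z i != zs i).
by rewrite sum_nat_const card_ord muln1.
Qed.

Definition relabel (n Q : nat) (s : 'I_Q -> 'I_Q) (z : assignment n Q) : assignment n Q :=
  [ffun i => s (z i)].

Section Separation.
Context (R : realType) (n Q : nat) (D : R -> R -> R) (ps : 'M[R]_Q) (zs : assignment n Q).
Context (N : R).
Hypothesis D_ge0 : forall q l q' l', 0 <= D (ps q l) (ps q' l').
Hypothesis rows : forall q q', (forall l, ps q l = ps q' l) -> q = q'.
Hypothesis sizes : forall q, Q%:R * N <= \sum_i (zs i == q)%:R.
Hypothesis N1 : 1 <= N.

(** The majority label of each true class defines a map [s]. Either [s]
    changes some connection parameter, and then a positive fraction of all the
    dyads sees it; or [s] is an automorphism of [ps] (a permutation, as rows are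
    distinct), and then each node outside the majority of its class differs in
    some column [l] from what [s] prescribes, which is seen by the majority
    nodes of class [l]. Automorphisms cannot be excluded: the distinguishing
    hypothesis on the rows also involves the class proportions. *)
Lemma separation (f0 : R) (z : assignment n Q) : 0 <= f0 ->
  (forall q l q' l', ps q l != ps q' l' -> f0 <= D (ps q l) (ps q' l')) ->
  exists s : 'S_Q, (forall q l, ps (s q) (s l) = ps q l) /\
    ((hamming (relabel s zs) z)%:R * ((N - 1) * f0) <=
       \sum_(k | off k) D (ps (zs k.1) (zs k.2)) (ps (z k.1) (z k.2)) \/
     N * ((N - 1) * f0) <=
       \sum_(k | off k) D (ps (zs k.1) (zs k.2)) (ps (z k.1) (z k.2))).
Proof.
move=> f00 hf; have [s hs] := majority_map z sizes.
have [inv|] := pselect (forall q l, ps (s q) (s l) = ps q l); last first.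
  move=> /existsNP[q /existsNP[l ne]]; exists 1%g; split; first by move=> *; rewrite !perm1.
  right.
  have := @count_off_ge R n (fun k => D (ps (zs k.1) (zs k.2)) (ps (z k.1) (z k.2)))
    (fun i => (zs i == q) && (z i == s q)) (fun _ j => (zs j == l) && (z j == s l))
    N f0 _ f00 (fun _ _ => hs l).
  move=> h; apply: le_trans (h _ _) => //.
    by rewrite ler_wpM2r ?mulr_ge0 ?subr_ge0.
  move=> i j /= /andP[/eqP -> /eqP ->] /andP[/eqP -> /eqP ->] _.
  by apply: hf; apply/eqP => e; apply: ne.
have sinj : injective s.
  move=> q q' e; apply: rows => l; by rewrite -inv e inv.
exists (perm sinj); split; first by move=> q l; rewrite !permE.
left; rewrite -sum_hamming.
have hl i : exists l, z i != s (zs i) -> ps (zs i) l != ps (z i) (s l).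
  have [->|ne] := eqVneq (z i) (s (zs i)); first by exists (zs i).
  apply: contrapT => /forallNP h; move/eqP: ne; apply.
  have [s' ss' s's] := injF_bij sinj.
  rewrite -(s's (z i)); congr (s _); apply: rows => l.
  have /not_implyP[_ /negP] := h l; rewrite negbK => /eqP ->.
  by rewrite -{2}(s's (z i)) inv.
have [lf hlf] := boolp.choice hl.
apply: (@count_off_ge R n (fun k => D (ps (zs k.1) (zs k.2)) (ps (z k.1) (z k.2)))
    (fun i => z i != relabel (perm sinj) zs i)
    (fun i j => (zs j == lf i) && (z j == s (lf i)))) => //.
move=> i j; rewrite ffunE permE => /hlf h /andP[/eqP -> /eqP ->] _ /=.
exact: hf.
Qed.

(** If the divergence is small then all blocks between majorities have close
    parameters; the majority map is injective because two true rows sent to the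
    same row would be too close to each other. *)
Lemma consistency (p : 'M[R]_Q) (z : assignment n Q) (e del v : R) :
  0 < v -> 0 <= del -> 1 < N ->
  (forall q l q' l', v * (p q' l' - ps q l) ^+ 2 <= D (ps q l) (p q' l')) ->
  (forall q l q' l', ps q l != ps q' l' -> 2 * del < `|ps q l - ps q' l'|) ->
  \sum_(k | off k) D (ps (zs k.1) (zs k.2)) (p (z k.1) (z k.2)) <= e ->
  e <= N * ((N - 1) * (v * del ^+ 2)) ->
  exists s : 'S_Q, forall q l, `|p (s q) (s l) - ps q l| <= del.
Proof.
move=> v0 del0 N1' hD gap hsum he; have [s hs] := majority_map z sizes.
have close q l : `|p (s q) (s l) - ps q l| <= del.
  set x := p _ _ - _; have hx : 0 <= v * x ^+ 2 by rewrite mulr_ge0 ?sqr_ge0 ?ltW.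
  have fge k : off k -> 0 <= D (ps (zs k.1) (zs k.2)) (p (z k.1) (z k.2)).
    by move=> _; apply: le_trans (hD _ _ _ _); rewrite mulr_ge0 ?sqr_ge0 // ltW.
  have flow i j : (zs i == q) && (z i == s q) -> (zs j == l) && (z j == s l) ->
      i != j -> v * x ^+ 2 <= D (ps (zs i) (zs j)) (p (z i) (z j)).
    by move=> /andP[/eqP -> /eqP ->] /andP[/eqP -> /eqP ->] _; exact: hD.
  have := @count_off_ge R n (fun k => D (ps (zs k.1) (zs k.2)) (p (z k.1) (z k.2)))
    (fun i => (zs i == q) && (z i == s q)) (fun _ j => (zs j == l) && (z j == s l))
    N (v * x ^+ 2) fge hx (fun _ _ => hs l) flow.
  move=> h2; have N0 : 0 < N by apply: lt_trans N1'.
  have N10 : 0 < N - 1 by rewrite subr_gt0.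
  have h1 : N * ((N - 1) * (v * x ^+ 2)) <=
     (\sum_i ((zs i == q) && (z i == s q))%:R) * ((N - 1) * (v * x ^+ 2)).
    by apply: ler_wpM2r; [rewrite mulr_ge0 // ltW|exact: hs].
  have := le_trans (le_trans (le_trans h1 h2) hsum) he.
  rewrite ler_pM2l // ler_pM2l // ler_pM2l // => h3.
  by rewrite -(ler_pXn2r (n := 2)) ?nnegrE // real_normK ?num_real.
have sinj : injective s.
  move=> q q' e'; apply: rows => l; apply/eqP; apply: contraT => ne.
  have := gap _ _ _ _ ne; rewrite ltNge => /negP[].
  have -> : ps q l - ps q' l = (p (s q') (s l) - ps q' l) - (p (s q) (s l) - ps q l).
    by rewrite e'; ring.
  apply: (le_trans (ler_normB _ _)); rewrite mulr_natl mulr2n; exact: lerD.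
by exists (perm sinj) => q l; rewrite !permE.
Qed.

End Separation.

(** * Comparison of the dyad parts of two likelihoods *)

Definition dyad_fit (R : realType) (n Q : nat) (psi : R -> R) (y : 'I_n -> 'I_n -> R)
    (r : 'I_n -> 'I_n -> bool) (z : assignment n Q) (p : 'M[R]_Q) : R :=
  \sum_(k | off k) (r k.1 k.2)%:R *
    (p (z k.1) (z k.2) * y k.1 k.2 - psi (p (z k.1) (z k.2))).

Section FitComparison.
Context (R : realType) (n Q : nat) (psi : R -> R) (ps : 'M[R]_Q).
Context (a1 a2 v V : R) (hpsi : curved psi a1 a2 v V) (a12 : a1 <= a2).
Context (rho eps : R) (rho0 : 0 <= rho) (eps0 : 0 <= eps).
Context (zs : assignment n Q) (y : 'I_n -> 'I_n -> R) (r : 'I_n -> 'I_n -> bool).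
Hypothesis hquiet : quiet (fun q l => derive1 psi (ps q l)) rho eps zs y r.
Hypothesis hps : forall q l, a1 <= ps q l <= a2.

Let block := (('I_Q * 'I_Q) * ('I_Q * 'I_Q))%type.
Let noise ctr (k : 'I_n * 'I_n) : R :=
  dyad_noise rho (derive1 psi (ps (zs k.1) (zs k.2))) ctr (r k.1 k.2) (y k.1 k.2).

(** Grouping the dyads by their block reduces a bound uniform in the
    coefficients [G], hence in the connection parameters, to finitely many
    noise sums. *)
Lemma noise_sum_le ctr z (G : block -> R) (C : R) :
  (forall tau, `|G tau| * (block_scale zs z tau)%:R <= C) ->
  `|\sum_(k | off k) noise ctr k * G (joint_label zs z k)| <= Q%:R ^+ 4 * (eps * rho * C).
Proof.
move=> hG.
rewrite (partition_big (joint_label zs z) predT) //=.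
rewrite (eq_bigr (fun tau => G tau *
  block_noise (fun q l => derive1 psi (ps q l)) rho zs y r z ctr tau)); last first.
  move=> tau _; rewrite /block_noise mulr_sumr; apply: eq_bigr => k /andP[_ /eqP ->].
  by rewrite mulrC.
apply: (le_trans (ler_norm_sum _ _ _)).
apply: (@le_trans _ _ (\sum_(tau : block) eps * rho * C)); last first.
  by rewrite sumr_const !card_prod !card_ord -[X in X <= _]mulr_natl !natrM !exprSr expr0 mul1r !mulrA.
apply: ler_sum => tau _; rewrite normrM.
apply: (@le_trans _ _ (`|G tau| * (eps * rho * (block_scale zs z tau)%:R))).
  by apply: ler_wpM2l => //; exact: hquiet.
rewrite mulrCA; apply: ler_wpM2l => //; exact: mulr_ge0.
Qed.

Let KL := bregman psi.
Let gain (p0 p : 'M[R]_Q) (tau : block) : R :=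
  KL (ps tau.1.1 tau.1.2) (p0 tau.1.1 tau.1.2) - KL (ps tau.1.1 tau.1.2) (p tau.2.1 tau.2.2).
Let shift (p0 p : 'M[R]_Q) (tau : block) : R := p tau.2.1 tau.2.2 - p0 tau.1.1 tau.1.2.

(** The two noise sums are centred; the last sum is minus the excess
    Kullback-Leibler divergence, multiplied by the sampling rate. *)
Lemma fit_diff z (p0 p : 'M[R]_Q) :
  dyad_fit psi y r z p - dyad_fit psi y r zs p0 =
  \sum_(k | off k) noise true k * shift p0 p (joint_label zs z k) +
  \sum_(k | off k) noise false k * gain p0 p (joint_label zs z k) +
  rho * \sum_(k | off k) gain p0 p (joint_label zs z k).
Proof.
rewrite /dyad_fit -sumrB mulr_sumr -!big_split /=; apply: eq_bigr => k _.
rewrite /noise /dyad_noise /shift /gain /KL /bregman /=; ring.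
Qed.

Let w := a2 - a1.
Let g := w + V * w ^+ 2.

Let V0 : 0 < V. Proof. by case: hpsi. Qed.

Let range_dist x x' : a1 <= x <= a2 -> a1 <= x' <= a2 -> `|x - x'| <= w.
Proof.
move=> /andP[h1 h2] /andP[h3 h4]; rewrite ler_norml /w; apply/andP; split; lra.
Qed.

Lemma bregman_ge0 x x' : a1 <= x <= a2 -> a1 <= x' <= a2 -> 0 <= KL x x'.
Proof.
move=> h1 h2; case: hpsi => v0 _ _ /(_ _ _ h1 h2) /andP[h _].
by apply: le_trans h; rewrite mulr_ge0 ?sqr_ge0 // ltW.
Qed.

Lemma bregman_le x x' : a1 <= x <= a2 -> a1 <= x' <= a2 -> KL x x' <= V * w ^+ 2.
Proof.
move=> h1 h2; case: hpsi => _ _ _ /(_ _ _ h1 h2) /andP[_ h].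
apply: (le_trans h); apply: ler_wpM2l; first exact: ltW.
by rewrite -[X in X <= _]real_normK ?num_real // lerXn2r ?nnegrE ?(le_trans (normr_ge0 (x' - x))) ?range_dist.
Qed.

(** Three-point identity for Bregman divergences. *)
Lemma bregman_lip x x' x'' del : a1 <= x <= a2 -> a1 <= x' <= a2 -> a1 <= x'' <= a2 ->
  `|x' - x''| <= del -> `|KL x x' - KL x x''| <= 2 * V * w * del.
Proof.
move=> h1 h2 h3 hd.
have d0 : 0 <= del by apply: le_trans hd.
have w0 : 0 <= w by apply: le_trans (range_dist h1 h1).
have -> : KL x x' - KL x x'' = KL x'' x' + (x' - x'') * (derive1 psi x'' - derive1 psi x).
  by rewrite /KL /bregman; ring.
apply: (le_trans (ler_normD _ _)).
have e1 : `|KL x'' x'| <= V * w * del.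
  rewrite ger0_norm ?bregman_ge0 //; case: hpsi => _ _ _ /(_ _ _ h3 h2) /andP[_ h].
  apply: (le_trans h); rewrite -mulrA; apply: ler_wpM2l; first exact: ltW.
  rewrite -real_normK ?num_real // expr2; apply: ler_pM => //; exact: range_dist.
have e2 : `|derive1 psi x'' - derive1 psi x| <= V * w.
  case: hpsi => v0 _ hs _.
  have [xx|/ltW xx] := leP x x''.
    have /andP[s1 s2] := hs _ _ h1 h3 xx.
    rewrite ger0_norm; last by apply: le_trans s1; rewrite mulr_ge0 ?subr_ge0 // ltW.
    apply: (le_trans s2); apply: ler_wpM2l; first exact: ltW.
    by apply: le_trans (ler_norm _) _; exact: range_dist.
  have /andP[s1 s2] := hs _ _ h3 h1 xx.
  rewrite distrC ger0_norm; last by apply: le_trans s1; rewrite mulr_ge0 ?subr_ge0 // ltW.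
  apply: (le_trans s2); apply: ler_wpM2l; first exact: ltW.
  by apply: le_trans (ler_norm _) _; exact: range_dist.
rewrite normrM (_ : 2 * V * w * del = V * w * del + del * (V * w)); last by ring.
by apply: lerD => //; apply: ler_pM.
Qed.

Lemma gain_le (p0 p : 'M[R]_Q) tau : (forall q l, a1 <= p0 q l <= a2) ->
  (forall q l, a1 <= p q l <= a2) -> `|gain p0 p tau| <= V * w ^+ 2.
Proof.
move=> h0 h; have i1 := bregman_ge0 (hps tau.1.1 tau.1.2) (h0 tau.1.1 tau.1.2).
have i2 := bregman_ge0 (hps tau.1.1 tau.1.2) (h tau.2.1 tau.2.2).
have j1 := bregman_le (hps tau.1.1 tau.1.2) (h0 tau.1.1 tau.1.2).
have j2 := bregman_le (hps tau.1.1 tau.1.2) (h tau.2.1 tau.2.2).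
rewrite /gain ler_norml; apply/andP; split; lra.
Qed.

Lemma noise_part_le z (p0 p : 'M[R]_Q) (M : R) :
  (forall q l, a1 <= p0 q l <= a2) -> (forall q l, a1 <= p q l <= a2) ->
  (forall tau : block, shift p0 p tau != 0 \/ gain p0 p tau != 0 ->
     (block_scale zs z tau)%:R <= M) -> 0 <= M ->
  dyad_fit psi y r z p - dyad_fit psi y r zs p0 <=
  Q%:R ^+ 4 * g * eps * rho * M + rho * \sum_(k | off k) gain p0 p (joint_label zs z k).
Proof.
move=> h0 h hM M0; rewrite fit_diff lerD2r.
have w0 : 0 <= V * w ^+ 2 by rewrite mulr_ge0 ?sqr_ge0 // ltW.
have s1 : \sum_(k | off k) noise true k * shift p0 p (joint_label zs z k) <=
    Q%:R ^+ 4 * (eps * rho * (w * M)).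
  apply: le_trans (ler_norm _) _; apply: noise_sum_le => tau.
  have [->|ne] := eqVneq (shift p0 p tau) 0.
    rewrite normr0 mul0r mulr_ge0 //.
    exact: le_trans (range_dist (h tau.2.1 tau.2.2) (h0 tau.1.1 tau.1.2)).
  by apply: ler_pM => //; [exact: range_dist|apply: hM; left].
have s2 : \sum_(k | off k) noise false k * gain p0 p (joint_label zs z k) <=
    Q%:R ^+ 4 * (eps * rho * (V * w ^+ 2 * M)).
  apply: le_trans (ler_norm _) _; apply: noise_sum_le => tau.
  have [->|ne] := eqVneq (gain p0 p tau) 0; first by rewrite normr0 mul0r mulr_ge0.
  by apply: ler_pM => //; [exact: gain_le|apply: hM; right].
apply: (le_trans (lerD s1 s2)); rewrite le_eqVlt; apply/orP; left; apply/eqP.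
by rewrite /g; ring.
Qed.

Lemma block_scale_le z (tau : block) : (block_scale zs z tau <= 2 * n * n)%N.
Proof.
rewrite /block_scale; case: ifP => _; first by rewrite -mulnA mul2n -addnn leq_addr.
by rewrite leq_mul // hamming_le.
Qed.

(** Crude version, with an error of the order of the number of sampled
    dyads; it is enough to exclude parameters far from the true orbit. *)
Lemma fit_far z (p : 'M[R]_Q) : (forall q l, a1 <= p q l <= a2) ->
  dyad_fit psi y r z p - dyad_fit psi y r zs ps <=
  2 * Q%:R ^+ 4 * g * eps * (rho * (n * n)%:R) -
    rho * \sum_(k | off k) KL (ps (zs k.1) (zs k.2)) (p (z k.1) (z k.2)).
Proof.
move=> h; have := @noise_part_le z ps p (2 * n * n)%:R hps h.
move=> /(_ _ _)/le_trans; apply => //.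
  by move=> tau _; rewrite ler_nat block_scale_le.
rewrite -[X in _ <= _ - rho * X]opprK -sumrN mulrN opprK.
rewrite (_ : 2 * _ * g * eps * _ = Q%:R ^+ 4 * g * eps * rho * (2 * n * n)%:R); last first.
  by rewrite !natrM; ring.
rewrite lerD2l; apply: ler_wpM2l => //; apply: ler_sum => k _.
rewrite /gain /joint_label /= -[X in _ <= X]add0r lerD2r /KL /bregman.
by rewrite !subrr mul0r subrr.
Qed.

(** Sharp version: only the dyads with a changed block contribute, so both
    the error and the gain are proportional to the Hamming distance. *)
Lemma fit_near z (p : 'M[R]_Q) (kap del : R) : 0 <= del -> (forall q l, a1 <= p q l <= a2) ->
  (forall q l, `|p q l - ps q l| <= del) ->
  4 * Q%:R ^+ 4 * g * eps <= kap -> 12 * V * w * del <= kap ->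
  kap * (n%:R * (hamming zs z)%:R) * 2 <=
    \sum_(k | off k) KL (ps (zs k.1) (zs k.2)) (ps (z k.1) (z k.2)) ->
  dyad_fit psi y r z p - dyad_fit psi y r zs p <= - kap * rho * n%:R * (hamming zs z)%:R / 2.
Proof.
move=> d0 h hd e1 e2 hsum.
have := @noise_part_le z p p (2 * n * hamming zs z)%:R h h.
move=> /(_ _ _)/le_trans; apply => //.
  move=> tau ht; rewrite ler_nat /block_scale; case: eqP => [e|//].
  by case: ht; rewrite /shift /gain e subrr eqxx.
have changed : \sum_(k : 'I_n * 'I_n | off k) ((zs k.1, zs k.2) != (z k.1, z k.2))%:R
    <= 2 * n%:R * (hamming zs z)%:R :> R.
  apply: (@le_trans _ _ (\sum_(k : 'I_n * 'I_n)
       ((z k.1 != zs k.1)%:R + (z k.2 != zs k.2)%:R))).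
    rewrite big_mkcond; apply: ler_sum => k _; case: ifP => _; last by rewrite addr_ge0.
    rewrite xpair_eqE negb_and ![zs _ == _]eq_sym -natrD ler_nat.
    by case: (z k.1 != zs k.1); case: (z k.2 != zs k.2).
  pose c i : R := (z i != zs i)%:R.
  rewrite -(pair_bigA _ (fun i j => c i + c j)) /=.
  rewrite (eq_bigr (fun i => n%:R * c i + (hamming zs z)%:R)); last first.
    by move=> i _; rewrite big_split /= sumr_const card_ord sum_hamming mulr_natl.
  rewrite big_split /= -mulr_sumr sum_hamming sumr_const card_ord.
  by rewrite -[_ *+ n]mulr_natl le_eqVlt; apply/orP; left; apply/eqP; ring.
set H : R := (hamming zs z)%:R in changed hsum *.
have K0 : 0 <= V * w * del by rewrite !mulr_ge0 ?subr_ge0 // ltW.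
have KLaa q l : KL (ps q l) (ps q l) = 0 by rewrite /KL /bregman !subrr mul0r subrr.
have hg : \sum_(k : 'I_n * 'I_n | off k) gain p p (joint_label zs z k) <=
   4 * V * w * del * (2 * n%:R * H) - kap * (n%:R * H) * 2.
  apply: (@le_trans _ _ (\sum_(k : 'I_n * 'I_n | off k)
     (4 * V * w * del * ((zs k.1, zs k.2) != (z k.1, z k.2))%:R -
      KL (ps (zs k.1) (zs k.2)) (ps (z k.1) (z k.2))))); last first.
    rewrite sumrB -mulr_sumr; apply: lerB => //; apply: ler_wpM2l => //.
    by rewrite -!mulrA mulr_ge0 // mulrA.
  apply: ler_sum => k _; rewrite /gain /joint_label /=.
  have [e|ne] := eqVneq (zs k.1, zs k.2) (z k.1, z k.2).
    by case: e => -> ->; rewrite KLaa mulr0 !subrr.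
  have t1 := bregman_lip (hps (zs k.1) (zs k.2)) (h (zs k.1) (zs k.2)) (hps (zs k.1) (zs k.2)) (hd _ _).
  have t2 := bregman_lip (hps (zs k.1) (zs k.2)) (h (z k.1) (z k.2)) (hps (z k.1) (z k.2)) (hd _ _).
  have := le_trans (ler_norm _) t1; rewrite KLaa subr0 /= => u1.
  have := le_trans (ler_norm _) t2 => _.
  have : - (KL (ps (zs k.1) (zs k.2)) (p (z k.1) (z k.2)) -
            KL (ps (zs k.1) (zs k.2)) (ps (z k.1) (z k.2))) <= 2 * V * w * del.
    by apply: le_trans t2; rewrite -normrN; exact: ler_norm.
  by move=> u2; rewrite mulr1; lra.
have nH : 0 <= n%:R * H by rewrite mulr_ge0.
have rnH : 0 <= rho * (n%:R * H) by rewrite mulr_ge0.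
apply: (@le_trans _ _ (Q%:R ^+ 4 * g * eps * rho * (2 * n * hamming zs z)%:R +
   rho * (4 * V * w * del * (2 * n%:R * H) - kap * (n%:R * H) * 2))).
  by rewrite lerD2l; apply: ler_wpM2l.
rewrite !natrM -/H.
have -> : Q%:R ^+ 4 * g * eps * rho * (2%:R * n%:R * H) +
   rho * (4 * V * w * del * (2 * n%:R * H) - kap * (n%:R * H) * 2) =
   (2 * (Q%:R ^+ 4 * g * eps) + 8 * (V * w * del) - 2 * kap) * (rho * (n%:R * H)) by ring.
have -> : - kap * rho * n%:R * H / 2 = (- kap / 2) * (rho * (n%:R * H)) by field.
apply: ler_wpM2r => //.
rewrite (_ : 4 * Q%:R ^+ 4 * g * eps = 4 * (Q%:R ^+ 4 * g * eps)) in e1; last by ring.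
rewrite (_ : 12 * V * w * del = 12 * (V * w * del)) in e2; last by ring.
have kap0 : 0 <= kap by apply: le_trans e2; rewrite mulr_ge0.
lra.
Qed.

End FitComparison.

(** * Sums of likelihoods over all assignments *)

Definition complete_loglik (R : realType) (n Q : nat) (psi : R -> R) (y : 'I_n -> 'I_n -> R)
    (r : 'I_n -> 'I_n -> bool) (z : assignment n Q) (t : param R Q) : R :=
  \sum_i ln (t.1 0 (z i)) + dyad_fit psi y r z t.2.

Definition perm_param (R : realType) (Q : nat) (s : 'S_Q) (t : param R Q) : param R Q :=
  (perm_alpha s t.1, perm_pi s t.2).

Lemma complete_loglik_relabel (R : realType) (n Q : nat) (psi : R -> R)
    (y : 'I_n -> 'I_n -> R) (r : 'I_n -> 'I_n -> bool) (z : assignment n Q) (t : param R Q)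
    (s : 'S_Q) :
  complete_loglik psi y r (relabel s z) t = complete_loglik psi y r z (perm_param s t).
Proof.
rewrite /complete_loglik /dyad_fit; congr (_ + _).
  by apply: eq_bigr => i _; rewrite ffunE mxE.
by apply: eq_bigr => k _; rewrite !ffunE mxE.
Qed.

Lemma relabel_bij (n Q : nat) (s : 'S_Q) : bijective (@relabel n Q s).
Proof.
exists (@relabel n Q (s^-1)%g) => z; apply/ffunP => i; rewrite !ffunE.
  by rewrite permK.
by rewrite permKV.
Qed.

Lemma ln_sum_hamming_le (R : realType) (n Q : nat) (c : R) (a : 'I_Q -> R) (zs z : assignment n Q) :
  0 < c -> (forall q, c <= a q <= 1) ->
  \sum_i ln (a (z i)) - \sum_i ln (a (zs i)) <= (hamming zs z)%:R * - ln c.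
Proof.
move=> c0 ha; rewrite -sumrB -sum_hamming mulr_suml; apply: ler_sum => i _.
have [->|_] := eqVneq (z i) (zs i); first by rewrite subrr mul0r.
rewrite mul1r; have /andP[h1 h2] := ha (z i); have /andP[h3 h4] := ha (zs i).
have l1 : ln (a (z i)) <= 0 by apply: ln_le0.
have l2 : ln c <= ln (a (zs i)) by rewrite ler_ln ?posrE // (lt_le_trans c0).
lra.
Qed.

Section PosteriorSum.
Context (R : realType) (n Q : nat) (psi : R -> R) (ps : 'M[R]_Q).
Context (a1 a2 v V : R) (hpsi : curved psi a1 a2 v V) (a12 : a1 <= a2).
Context (rho eps : R) (rho0 : 0 <= rho) (eps0 : 0 <= eps).
Context (zs : assignment n Q) (y : 'I_n -> 'I_n -> R) (r : 'I_n -> 'I_n -> bool).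
Hypothesis hquiet : quiet (fun q l => derive1 psi (ps q l)) rho eps zs y r.
Hypothesis hps : forall q l, a1 <= ps q l <= a2.
Hypothesis rows : forall q q', (forall l, ps q l = ps q' l) -> q = q'.

Let ell : assignment n Q -> param R Q -> R := complete_loglik psi y r.

(** Each assignment is charged to the automorphism [s] given by
    [separation]; after relabelling it loses a factor [q] per misclassified
    node against the true memberships with parameter [perm_param s t], and the
    sum of these losses is explicit. The prior contributes at most the factor
    [1 / c] per misclassified node. *)
Lemma posterior_sum (N f0 kap del c : R) (t : param R Q) :
  (forall q, Q%:R * N <= \sum_i (zs i == q)%:R) -> 1 <= N -> 0 <= f0 ->
  (forall q l q' l', ps q l != ps q' l' -> f0 <= bregman psi (ps q l) (ps q' l')) ->
  0 <= kap -> kap * n%:R * 2 <= (N - 1) * f0 -> kap * (n%:R * n%:R) * 2 <= N * ((N - 1) * f0) ->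
  0 < c -> (forall q, c <= t.1 0 q <= 1) -> (forall q l, a1 <= t.2 q l <= a2) ->
  0 <= del -> (forall q l, `|t.2 q l - ps q l| <= del) ->
  4 * Q%:R ^+ 4 * ((a2 - a1) + V * (a2 - a1) ^+ 2) * eps <= kap ->
  12 * V * (a2 - a1) * del <= kap ->
  \sum_z expR (ell z t) <=
   (1 + Q.-1%:R * (c^-1 * expR (- kap * rho * n%:R / 2))) ^+ n *
     \sum_(s : 'S_Q) expR (ell zs (perm_param s t)).
Proof.
move=> sizes N1 f00 hf kap0 k1 k2 c0 ht1 ht2 del0 hd e1 e2.
set q := c^-1 * _.
have q0 : 0 <= q by rewrite mulr_ge0 ?expR_ge0 // invr_ge0 ltW.
have main z : expR (ell z t) <= \sum_(s : 'S_Q)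
    expR (ell zs (perm_param s t)) * q ^+ hamming zs (relabel (s^-1)%g z).
  have [s [aut hs]] := separation (D := bregman psi) (fun q l q' l' => bregman_ge0 hpsi (hps q l) (hps q' l'))
     rows sizes N1 z f00 hf.
  rewrite (bigD1 s) //=; apply: ler_wpDr.
    by apply: sumr_ge0 => s' _; rewrite mulr_ge0 ?expR_ge0 ?exprn_ge0.
  set z' := relabel (s^-1)%g z.
  have zz' : z = relabel s z' by apply/ffunP => i; rewrite !ffunE permKV.
  have hh : hamming (relabel s zs) z = hamming zs z'.
    by apply: eq_bigr => i _; rewrite zz' !ffunE (inj_eq perm_inj).
  rewrite hh in hs.
  have hsum : kap * (n%:R * (hamming zs z')%:R) * 2 <= \sum_(k | off k)
       bregman psi (ps (zs k.1) (zs k.2)) (ps (z' k.1) (z' k.2)).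
    rewrite (_ : \sum_(k | off k) _ = \sum_(k : 'I_n * 'I_n | off k)
       bregman psi (ps (zs k.1) (zs k.2)) (ps (z k.1) (z k.2))); last first.
      by apply: eq_bigr => k _; rewrite zz' !ffunE aut.
    have hn : (hamming zs z')%:R <= n%:R :> R by rewrite ler_nat hamming_le.
    case: hs => hs; apply: le_trans hs.
      rewrite mulrC (_ : 2 * _ = (hamming zs z')%:R * (kap * n%:R * 2)); last by ring.
      by apply: ler_wpM2l.
    apply: le_trans k2; rewrite ler_wpM2r // ler_wpM2l // ler_wpM2l //.
  have ps2 q' l : `|(perm_pi s t.2) q' l - ps q' l| <= del by rewrite mxE -aut.
  have pr2 q' l : a1 <= (perm_pi s t.2) q' l <= a2 by rewrite mxE.
  have near := fit_near hpsi a12 rho0 eps0 hquiet hps del0 pr2 ps2 e1 e2 hsum.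
  have pr1 q' : c <= (perm_alpha s t.1) 0 q' <= 1 by rewrite mxE.
  have l1 := ln_sum_hamming_le zs z' c0 pr1.
  (* One misclassified node costs the likelihood a factor [q]. *)
  have qE : q = expR (- ln c + - kap * rho * n%:R / 2).
    by rewrite expRD expRN lnK.
  rewrite {1}zz' /ell complete_loglik_relabel qE -expRM_natr -expRD ler_expR /complete_loglik /=.
  have := lerD l1 near; set H : R := (hamming zs z')%:R.
  rewrite (_ : (- ln c + - kap * rho * n%:R / 2) * H =
    H * - ln c + - kap * rho * n%:R * H / 2); last by field.
  by move=> h; lra.
have -> : (1 + Q.-1%:R * q) ^+ n = \sum_z q ^+ hamming zs z by rewrite sum_exp_hamming.
rewrite mulr_sumr; apply: (le_trans (ler_sum _ (fun z _ => main z))).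
rewrite exchange_big /=; apply: ler_sum => s _; rewrite -mulr_sumr mulrC.
apply: ler_wpM2r; first exact: expR_ge0.
rewrite [X in _ <= X](reindex (@relabel n Q (s^-1)%g)) //=.
exact/onW_bij/relabel_bij.
Qed.

End PosteriorSum.

(** With [X] and [A] the square roots of [x] and [a], the inequality
    [ln u <= u - 1] at [u = A / X] shows that the right side is at least
    [(X - A) ^+ 2], a squared Hellinger distance; and [X + A <= 2]. *)
Lemma bernoulli_kl_ge (R : realType) (x a : R) : 0 < x -> x <= 1 -> 0 < a -> a <= 1 ->
  (x - a) ^+ 2 / 4 <= x * (ln x - ln a) - x + a.
Proof.
move=> x0 x1 a0 a1.
pose X := Num.sqrt x; pose A := Num.sqrt a.
have X0 : 0 < X by rewrite sqrtr_gt0.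
have A0 : 0 < A by rewrite sqrtr_gt0.
have xX : x = X ^+ 2 by rewrite sqr_sqrtr // ltW.
have aA : a = A ^+ 2 by rewrite sqr_sqrtr // ltW.
have X1 : X <= 1 by rewrite -sqrtr1 ler_sqrt.
have A1 : A <= 1 by rewrite -sqrtr1 ler_sqrt.
have h : ln (A / X) <= A / X - 1.
  have := @le_ln1Dx R (A / X - 1); rewrite (_ : 1 + (A / X - 1) = A / X); last by ring.
  by apply; rewrite ltrBDl subrr; exact: divr_gt0.
rewrite ln_div ?posrE // in h.
have lx : ln x = 2 * ln X by rewrite {1}xX lnXn // mulr_natl.
have la : ln a = 2 * ln A by rewrite {1}aA lnXn // mulr_natl.
rewrite lx la xX aA; clearbody X A.
have h2 : X ^+ 2 * (2 * (ln A - ln X)) <= X ^+ 2 * (2 * (A / X - 1)).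
  by rewrite ler_wpM2l ?sqr_ge0 // ler_wpM2l.
have e : X ^+ 2 * (2 * (A / X - 1)) = 2 * A * X - 2 * X ^+ 2.
  by field; rewrite gt_eqF.
rewrite e in h2.
have h3 : 0 <= (X - A) ^+ 2 * (4 - (X + A) ^+ 2).
  rewrite mulr_ge0 ?sqr_ge0 // subr_ge0 (_ : 4 = 2 ^+ 2); last by ring.
  by rewrite lerXn2r ?nnegrE //; lra.
have -> : (X ^+ 2 - A ^+ 2) ^+ 2 / 4 = (X - A) ^+ 2 - (X - A) ^+ 2 * (4 - (X + A) ^+ 2) / 4.
  by field.
lra.
Qed.

(** The competitors other than the best one contribute at most
    [#|I| * expR (- h)] relative to [expR M], so the best one has to make up for
    nearly all of [expR M]. *)
Lemma selection (R : realType) (I : finType) (E G : I -> R) (M B x h : R) :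
  expR M <= B * \sum_s expR (E s) -> 1 <= B -> B <= 1 + x ->
  (forall s, G s <= M - E s) ->
  (forall s s', G s < h -> s' != s -> h <= G s') ->
  x + #|I|%:R * expR (- h) <= 1 / 2 -> 0 <= x ->
  exists s, G s < h /\ M - E s <= 2 * (x + #|I|%:R * expR (- h)).
Proof.
move=> hM B1 Bx hG sep hxi x0.
set K := #|I|%:R * expR (- h) in hxi *.
have K0 : 0 <= K by rewrite mulr_ge0 ?expR_ge0.
have B0 : 0 < B by apply: lt_le_trans B1.
have Bn0 : B != 0 := lt0r_neq0 B0.
have hB : 1 <= B * \sum_s expR (E s - M).
  rewrite -(ler_pM2r (expR_gt0 M)) mul1r -mulrA mulr_suml.
  apply: (le_trans hM); rewrite le_eqVlt; apply/orP; left; apply/eqP; congr (_ * _).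
  by apply: eq_bigr => s _; rewrite -expRD subrK.
have far s : h <= G s -> expR (E s - M) <= expR (- h).
  by move=> hs; rewrite ler_expR; have := hG s; lra.
have invB : 1 - x <= B^-1.
  rewrite -(ler_pM2r B0) mulVf //.
  have : 0 <= (1 - x) * (1 + x - B) by apply: mulr_ge0; lra.
  rewrite (_ : (1 - x) * (1 + x - B) = 1 - x ^+ 2 - (1 - x) * B); last by ring.
  have := sqr_ge0 x; lra.
have hS : 1 - x <= \sum_s expR (E s - M).
  apply: (le_trans invB); by rewrite -(ler_pM2l B0) mulfV.
have [[s hs]|] := pselect (exists s, G s < h); last first.
  move=> /forallNP hn; have : \sum_s expR (E s - M) <= K.
    rewrite /K mulr_natl -sumr_const; apply: ler_sum => s _; apply: far.
    by rewrite leNgt; apply/negP.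
  lra.
exists s; split => //.
have hs2 : 1 - (x + K) <= expR (E s - M).
  have : \sum_(s' | s' != s) expR (E s' - M) <= K.
    rewrite /K mulr_natl -sumr_const; rewrite big_mkcond; apply: ler_sum => s' _.
    by case: ifP => [ne|_]; [apply: far; exact: sep hs ne|exact: expR_ge0].
  by move: hS; rewrite (bigD1 s) //=; lra.
set xi := x + K in hxi hs2 *.
have : expR (- (2 * xi)) <= 1 - xi.
  have p0 : 0 < 1 + 2 * xi by rewrite /xi; lra.
  rewrite expRN; apply: (@le_trans _ _ (1 + 2 * xi)^-1).
    by rewrite lef_pV2 ?posrE ?expR_gt0 // expR_ge1Dx.
  rewrite -[X in X <= _]mul1r ler_pdivrMr //.
  have : 0 <= xi * (1 / 2 - xi) by rewrite mulr_ge0 ?subr_ge0 // /xi addr_ge0.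
  rewrite (_ : (1 - xi) * (1 + 2 * xi) = 1 + 2 * (xi * (1 / 2 - xi))); last by field.
  lra.
by move=> /le_trans/(_ hs2); rewrite ler_expR; lra.
Qed.

(** * The variational objective as a bound on the evidence *)

Section Evidence.
Context (R : realType) (n Q : nat) (b psi : R -> R).
Context (y : 'I_n -> 'I_n -> R) (r : 'I_n -> 'I_n -> bool).
Hypothesis b_gt0 : forall i j, i != j -> 0 < b (y i j).

Definition base_mass : R := \prod_(k : 'I_n * 'I_n | off k && r k.1 k.2) b (y k.1 k.2).

Lemma base_mass_gt0 : 0 < base_mass.
Proof. by apply: prodr_gt0 => k /andP[ok _]; exact: b_gt0. Qed.

Lemma lik_expR (z : assignment n Q) (t : param R Q) : (forall q, 0 < t.1 0 q) ->
  lik b psi y r z t = base_mass * expR (complete_loglik psi y r z t).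
Proof.
move=> t0; rewrite /lik /complete_loglik expRD expR_sum mulrCA; congr (_ * _).
  by apply: eq_bigr => i _; rewrite lnK // posrE.
rewrite pair_big_dep /= (eq_bigl (fun k : 'I_n * 'I_n => off k && r k.1 k.2)); last first.
  by move=> k; rewrite /off eq_sym.
rewrite /dyad_fit expR_sum /base_mass [X in _ = _ * X](bigID (fun k : 'I_n * 'I_n => r k.1 k.2)) /=.
rewrite [X in _ = _ * (_ * X)]big1 ?mulr1; last first.
  by move=> k /andP[_ /negPf ->]; rewrite mul0r expR0.
rewrite -big_split /=; apply: eq_bigr => k /andP[_ ->].
by rewrite mul1r.
Qed.

(** Gibbs' inequality, through [ln u <= u - 1]. *)
Lemma elbo_le_evidence (q : {ffun assignment n Q -> R}) (t : param R Q) :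
  (forall z, 0 <= q z) -> \sum_z q z = 1 -> (forall z, 0 < lik b psi y r z t) ->
  elbo b psi y r q t <= ln (\sum_z lik b psi y r z t).
Proof.
move=> q0 q1 l0; set L := \sum_z lik _ _ _ _ _ _.
have [z0 qz0] : exists z0, 0 < q z0.
  apply: contrapT => /forallNP h; have : \sum_z q z = 0.
    apply: big1 => z _; apply/eqP; rewrite eq_le q0 andbT leNgt; exact/negP.
  by rewrite q1 => /eqP; rewrite oner_eq0.
have L0 : 0 < L by rewrite /L (bigD1 z0) //= ltr_wpDr // sumr_ge0 // => z _; exact: ltW.
rewrite /elbo -sumrB -subr_le0 -[ln L]mul1r -q1 mulr_suml -sumrB.
apply: (@le_trans _ _ (\sum_z (lik b psi y r z t / L - q z))); last first.
  by rewrite sumrB q1 -mulr_suml -/L mulfV ?subrr // lt0r_neq0.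
apply: ler_sum => z _; have := q0 z; rewrite le_eqVlt => /orP[/eqP <-|qz].
  by rewrite !mul0r !subr0 divr_ge0 // ltW.
have p0 : 0 < lik b psi y r z t / L / q z by rewrite !divr_gt0.
have : ln (lik b psi y r z t / L / q z) <= lik b psi y r z t / L / q z - 1.
  have := @le_ln1Dx R (lik b psi y r z t / L / q z - 1).
  rewrite (_ : 1 + (_ - 1) = lik b psi y r z t / L / q z); last by ring.
  by apply; rewrite ltrBDl subrr.
rewrite !ln_div ?posrE ?divr_gt0 // => h0; have h := ler_wpM2l (ltW qz) h0.
rewrite (_ : _ - _ = q z * (ln (lik b psi y r z t) - ln L - ln (q z))); last by ring.
apply: (le_trans h); rewrite le_eqVlt; apply/orP; left; apply/eqP; field.
by rewrite !lt0r_neq0.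
Qed.

Definition point_mass (zs : assignment n Q) : {ffun assignment n Q -> R} :=
  [ffun z => (z == zs)%:R].

Lemma point_mass_sum (zs : assignment n Q) (F : assignment n Q -> R) :
  \sum_z point_mass zs z * F z = F zs.
Proof.
rewrite (bigD1 zs) //= ffunE eqxx mul1r big1 ?addr0 // => z /negPf ne.
by rewrite ffunE ne mul0r.
Qed.

Lemma point_mass_product (zs : assignment n Q) : product_distr (point_mass zs).
Proof.
split.
- by move=> z; rewrite ffunE.
- by rewrite -[RHS](point_mass_sum zs (fun=> 1)); apply: eq_bigr => z _; rewrite mulr1.
have marg i k : marginal (point_mass zs) i k = (zs i == k)%:R.
  rewrite /marginal big_mkcond /= -(point_mass_sum zs (fun z => (z i == k)%:R)).
  by apply: eq_bigr => z _; case: ifP => _; rewrite ?mulr1 ?mulr0.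
move=> z; rewrite ffunE (eq_bigr (fun i => (zs i == z i)%:R)); last by move=> i _; exact: marg.
have [->|ne] := eqVneq z zs; first by rewrite big1 // => i _; rewrite eqxx.
have [i hi] : exists i, zs i != z i.
  apply: contrapT => /forallNP h; move/eqP: ne; apply; apply/ffunP => i.
  by apply/esym/eqP; have /negP := h i; rewrite negbK.
by rewrite (bigD1 i) //= (negPf hi) mul0r.
Qed.

Lemma elbo_point_mass (zs : assignment n Q) (t : param R Q) :
  elbo b psi y r (point_mass zs) t = ln (lik b psi y r zs t).
Proof.
rewrite /elbo point_mass_sum point_mass_sum ffunE eqxx ln1 subr0 //.
Qed.

(** A point mass is a product distribution, so the objective at [t] is at
    least the complete-data likelihood at the true memberships; at the
    estimator it is at most the evidence. The base measure factors out. *)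
Lemma variational_evidence (Theta : set (param R Q)) (that t : param R Q) (zs : assignment n Q) :
  (forall t', Theta t' -> forall q, 0 < t'.1 0 q) ->
  is_variational_estimate b psi Theta y r that -> Theta t ->
  expR (complete_loglik psi y r zs t) <= \sum_z expR (complete_loglik psi y r z that).
Proof.
move=> Tpos [Tthat hmax] Tt; have B0 := base_mass_gt0.
have lpos t' z : Theta t' -> 0 < lik b psi y r z t'.
  by move=> /Tpos h; rewrite lik_expR // mulr_gt0 // expR_gt0.
have ub t' : Theta t' -> ubound [set elbo b psi y r q t' | q in product_distr]
    (ln (\sum_z lik b psi y r z t')).
  by move=> Tt' _ [q [q0 q1 _] <-]; apply: elbo_le_evidence => // z; exact: lpos.
have mem t' : [set elbo b psi y r q t' | q in product_distr] (ln (lik b psi y r zs t')).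
  by exists (point_mass zs); [exact: point_mass_product|exact: elbo_point_mass].
have low : ln (lik b psi y r zs t) <= elbo_max b psi y r t.
  apply: ub_le_sup (mem t); by exists (ln (\sum_z lik b psi y r z t)); exact: ub.
have up : elbo_max b psi y r that <= ln (\sum_z lik b psi y r z that).
  by apply: ge_sup; [exists (ln (lik b psi y r zs that)); exact: mem|exact: ub].
have := le_trans low (le_trans (hmax _ Tt) up).
rewrite ler_ln ?posrE ?lpos //; last first.
  by rewrite (bigD1 zs) //= ltr_wpDr ?lpos // sumr_ge0 // => z _; apply/ltW/lpos.
rewrite lik_expR; last exact: Tpos.
rewrite (eq_bigr (fun z => base_mass * expR (complete_loglik psi y r z that))).
  by rewrite -mulr_sumr ler_pM2l.
by move=> z _; rewrite lik_expR //; exact: Tpos.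
Qed.

End Evidence.

(** * Strong concavity of the complete-data likelihood *)

Section CompleteMle.
Context (R : realType) (n Q : nat) (psi : R -> R).
Context (a1 a2 v V : R) (hpsi : curved psi a1 a2 v V).
Context (zs : assignment n Q) (y : 'I_n -> 'I_n -> R) (r : 'I_n -> 'I_n -> bool).

Let same q l (k : 'I_n * 'I_n) := (zs k.1, zs k.2) == (q, l).

Lemma dyad_sumE (x : 'I_n -> 'I_n -> R) q l :
  \sum_i \sum_(j | j != i) x i j * (zs i == q)%:R * (zs j == l)%:R =
  \sum_(k | off k && same q l k) x k.1 k.2.
Proof.
rewrite pair_big_dep /= [RHS]big_mkcondr /=; apply: eq_big => k; first by rewrite /off eq_sym.
move=> _; rewrite /same xpair_eqE; case: (zs k.1 == q); case: (zs k.2 == l);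
  by rewrite ?mulr1 ?mulr0.
Qed.

Lemma dyad_countE q l : dyad_count r zs q l = \sum_(k | off k && same q l k) (r k.1 k.2)%:R :> R.
Proof. exact: dyad_sumE (fun i j => (r i j)%:R) q l. Qed.

Lemma y_hatE q l : y_hat y r zs q l =
  (\sum_(k | off k && same q l k) y k.1 k.2 * (r k.1 k.2)%:R) / dyad_count r zs q l.
Proof. by rewrite /y_hat (dyad_sumE (fun i j => y i j * (r i j)%:R)). Qed.

(** The first-order conditions defining [p0] turn the difference of the
    likelihoods into a weighted sum of Bregman divergences. *)
Lemma fit_gap (p0 p : 'M[R]_Q) :
  (forall q l, dyad_count r zs q l != 0 :> R) ->
  (forall q l, derive1 psi (p0 q l) = y_hat y r zs q l) ->
  dyad_fit psi y r zs p0 - dyad_fit psi y r zs p =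
  \sum_q \sum_l dyad_count r zs q l * bregman psi (p0 q l) (p q l).
Proof.
move=> N0 hm; rewrite /dyad_fit -sumrB.
rewrite (partition_big (fun k : 'I_n * 'I_n => (zs k.1, zs k.2)) predT) //=.
rewrite pair_bigA /=; apply: eq_bigr => -[q l] _ /=.
rewrite (eq_bigr (fun k => (p0 q l - p q l) * (y k.1 k.2 * (r k.1 k.2)%:R) +
   (psi (p q l) - psi (p0 q l)) * (r k.1 k.2)%:R)); last first.
  by move=> k /andP[_ /eqP[-> ->]]; ring.
rewrite big_split /= -!mulr_sumr -/(same q l) -dyad_countE.
have -> : \sum_(i | off i && same q l i) y i.1 i.2 * (r i.1 i.2)%:R =
   derive1 psi (p0 q l) * dyad_count r zs q l by rewrite hm y_hatE divfK.
by rewrite /bregman; ring.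
Qed.

Lemma prior_gap (a : 'I_Q -> R) : (0 < n)%N -> (forall q, 0 < a q <= 1) -> \sum_q a q = 1 ->
  (forall q, 0 < alpha_hat (R := R) zs 0 q) -> forall q0,
  n%:R / 4 * (alpha_hat zs 0 q0 - a q0) ^+ 2 <=
  \sum_i ln (alpha_hat zs 0 (zs i)) - \sum_i ln (a (zs i)).
Proof.
move=> n0 ha a1' hpos q0; pose ah q : R := alpha_hat zs 0 q.
have nR : n%:R != 0 :> R by rewrite pnatr_eq0 -lt0n.
have ahE q : \sum_i (zs i == q)%:R = n%:R * ah q by rewrite /ah mxE mulrA mulfV // mul1r.
have ah1 : \sum_q ah q = 1.
  apply: (mulfI nR); rewrite mulr1 mulr_sumr.
  rewrite (eq_bigr (fun q => \sum_i (zs i == q)%:R)); last by move=> q _; rewrite ahE.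
  rewrite exchange_big /= (eq_bigr (fun=> 1)) ?sumr_const ?card_ord // => i _.
  by rewrite (bigD1 (zs i)) //= eqxx big1 ?addr0 // => l ne; rewrite eq_sym (negPf ne).
have ahle q : ah q <= 1.
  by rewrite -ah1 (bigD1 q) //= lerDl sumr_ge0 // => l _; apply/ltW/hpos.
rewrite -sumrB (partition_big zs predT) //=.
rewrite (eq_bigr (fun q => n%:R * (ah q * (ln (ah q) - ln (a q)) - ah q + a q) +
   n%:R * (ah q - a q))); last first.
  move=> q _; rewrite (eq_bigr (fun=> ln (ah q) - ln (a q))); last by move=> i /eqP ->.
  rewrite big_mkcond /= (eq_bigr (fun i => (zs i == q)%:R * (ln (ah q) - ln (a q)))); last first.
    by move=> i _; case: (zs i == q); rewrite ?mul1r ?mul0r.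
  by rewrite -mulr_suml ahE; ring.
rewrite big_split /= -2!mulr_sumr [\sum_i (ah i - a i)]sumrB ah1 a1' subrr mulr0 addr0.
have term q : 0 <= ah q * (ln (ah q) - ln (a q)) - ah q + a q /\
   (ah q - a q) ^+ 2 / 4 <= ah q * (ln (ah q) - ln (a q)) - ah q + a q.
  have h := @bernoulli_kl_ge R (ah q) (a q) (hpos q) (ahle q).
  have /andP[h1 h2] := ha q; have := h h1 h2 => h3; split => //.
  by apply: le_trans h3; rewrite divr_ge0 ?sqr_ge0.
rewrite (bigD1 q0) //=.
apply: (@le_trans _ _ (n%:R * (ah q0 * (ln (ah q0) - ln (a q0)) - ah q0 + a q0))).
  rewrite -mulrA; apply: ler_wpM2l => //; rewrite mulrC; exact: (term q0).2.
by apply: ler_wpM2l => //; rewrite lerDl sumr_ge0 // => q _; exact: (term q).1.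
Qed.

(** Classes contribute a curvature of order [n], connections a curvature
    proportional to the number of sampled dyads. *)
Lemma loglik_gap (p0 : 'M[R]_Q) (t : param R Q) (nu : R) : (0 < n)%N -> 0 < nu ->
  (forall q, 0 < alpha_hat (R := R) zs 0 q) ->
  (forall q l, a1 <= p0 q l <= a2) -> (forall q l, a1 <= t.2 q l <= a2) ->
  (forall q, 0 < t.1 0 q <= 1) -> \sum_q t.1 0 q = 1 ->
  (forall q l, nu <= dyad_count r zs q l) ->
  (forall q l, derive1 psi (p0 q l) = y_hat y r zs q l) ->
  let gap := complete_loglik psi y r zs (alpha_hat zs, p0) - complete_loglik psi y r zs t in
  (forall q, n%:R / 4 * (alpha_hat zs 0 q - t.1 0 q) ^+ 2 <= gap) /\
  (forall q l, nu * v * (p0 q l - t.2 q l) ^+ 2 <= gap).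
Proof.
move=> n0 nu0 hpos h0 ht ht1 ht1s hN hm gap.
have gapE : gap = (\sum_i ln (alpha_hat zs 0 (zs i)) - \sum_i ln (t.1 0 (zs i))) +
   \sum_q \sum_l dyad_count r zs q l * bregman psi (p0 q l) (t.2 q l).
  rewrite -fit_gap //; last by move=> q l; rewrite lt0r_neq0 // (lt_le_trans nu0).
  by rewrite /gap /complete_loglik /=; ring.
case: hpsi => v0 V0 _ hD.
have N0 q l : 0 <= dyad_count r zs q l :> R by apply: le_trans (hN q l); exact: ltW.
have term q l : nu * v * (p0 q l - t.2 q l) ^+ 2 <=
    dyad_count r zs q l * bregman psi (p0 q l) (t.2 q l).
  have /andP[d1 _] := hD _ _ (h0 q l) (ht q l).
  apply: (@le_trans _ _ (dyad_count r zs q l * (v * (t.2 q l - p0 q l) ^+ 2))).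
    rewrite (_ : nu * v * _ = nu * (v * (t.2 q l - p0 q l) ^+ 2)); last by ring.
    by apply: ler_wpM2r => //; rewrite mulr_ge0 ?sqr_ge0 // ltW.
  exact: ler_wpM2l.
have term0 q l : 0 <= dyad_count r zs q l * bregman psi (p0 q l) (t.2 q l).
  by apply: le_trans (term q l); rewrite mulr_ge0 ?sqr_ge0 // mulr_ge0 ?(ltW nu0) ?(ltW v0).
have sum0 : 0 <= \sum_q \sum_l dyad_count r zs q l * bregman psi (p0 q l) (t.2 q l).
  by apply: sumr_ge0 => q _; apply: sumr_ge0.
have prior q := prior_gap n0 ht1 ht1s hpos q.
split=> [q|q l]; rewrite gapE.
  by apply: (le_trans (prior q)); rewrite lerDl.
apply: (@le_trans _ _ (\sum_q \sum_l dyad_count r zs q l * bregman psi (p0 q l) (t.2 q l))).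
  apply: (le_trans (term q l)); rewrite (bigD1 q) //= (bigD1 l) //=.
  rewrite -addrA lerDl addr_ge0 //; first exact: sumr_ge0.
  by apply: sumr_ge0 => q' _; apply: sumr_ge0.
by rewrite lerDr; apply: le_trans (prior q); rewrite mulr_ge0 ?sqr_ge0 // divr_ge0.
Qed.

Context (rho eps : R) (rho0 : 0 < rho) (ps : 'M[R]_Q).
Hypothesis hquiet : quiet (fun q l => derive1 psi (ps q l)) rho eps zs y r.

(** Both claims concern the blocks [tau] with equal pairs of labels at
    [z = zs]. *)
Lemma count_and_mean (S nu : R) :
  (forall q, S <= \sum_i (zs i == q)%:R) -> 1 <= S ->
  2 * nu * (n * n)%:R <= S * (S - 1) -> eps <= nu -> forall q l,
  nu * rho * (n * n)%:R <= dyad_count r zs q l /\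
  `|\sum_(k | off k && same q l k) y k.1 k.2 * (r k.1 k.2)%:R -
      derive1 psi (ps q l) * dyad_count r zs q l| <= eps * rho * (n * n)%:R.
Proof.
move=> hS S1 hnu heps q l.
have lab k : (joint_label zs zs k == ((q, l), (q, l))) = same q l k.
  by rewrite /joint_label /same xpair_eqE andbb.
have e : (fun k => off k && (joint_label zs zs k == ((q, l), (q, l)))) =1
         (fun k => off k && same q l k) by move=> k; rewrite lab.
have h1 := hquiet zs false ((q, l), (q, l)); have h2 := hquiet zs true ((q, l), (q, l)).
rewrite /block_noise /block_scale eqxx /dyad_noise (eq_bigl _ _ e) in h1.
rewrite /block_noise /block_scale eqxx /dyad_noise (eq_bigl _ _ e) in h2.
split.
  have : \sum_(k | off k && same q l k) ((r k.1 k.2)%:R - rho) >= - (eps * rho * (n * n)%:R).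
    by move: h1; rewrite ler_norml => /andP[].
  rewrite sumrB -dyad_countE => h3.
  have hc : S * (S - 1) <= \sum_(k | off k && same q l k) (1 : R).
    rewrite big_mkcondr /=.
    have f0 k : off k -> 0 <= (if same q l k then 1 else 0) :> R by case: ifP.
    have f1 i j : zs i == q -> zs j == l -> i != j ->
        1 <= (if same q l (i, j) then 1 else 0) :> R.
      by move=> /eqP e1 /eqP e2 _; rewrite /same /= e1 e2 eqxx.
    have := @count_off_ge R n (fun k => if same q l k then 1 else 0) (fun i => zs i == q)
      (fun _ j => zs j == l) S 1 f0 ler01 (fun _ _ => hS l) f1.
    rewrite mulr1 => /(le_trans _); apply.
    by apply: ler_wpM2r => //; rewrite subr_ge0.
  have h4 : rho * (2 * nu * (n * n)%:R) <= \sum_(k | off k && same q l k) rho.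
    rewrite (eq_bigr (fun k => rho * 1)) ?mulr_sumr => [|k _]; last by rewrite mulr1.
    by rewrite -mulr_sumr; apply: ler_wpM2l; [exact: ltW|exact: le_trans hc].
  have h5 : eps * (rho * (n * n)%:R) <= nu * (rho * (n * n)%:R).
    by apply: ler_wpM2r => //; rewrite mulr_ge0 // ltW.
  have := lerD h3 h4; lra.
move: h2; rewrite dyad_countE mulr_sumr -sumrB.
rewrite (eq_bigr (fun k => y k.1 k.2 * (r k.1 k.2)%:R - derive1 psi (ps q l) * (r k.1 k.2)%:R)) //.
by move=> k /andP[_ /eqP[-> ->]]; ring.
Qed.

End CompleteMle.

(** * The estimator on the good event *)

Lemma perm_paramM (R : realType) (Q : nat) (s s0 : 'S_Q) (t : param R Q) :
  perm_param s (perm_param s0 t) = perm_param (s * s0)%g t.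
Proof.
rewrite /perm_param /perm_alpha /perm_pi /=; congr (_, _).
  by apply/rowP => q; rewrite !mxE permM.
by apply/matrixP => q l; rewrite !mxE !permM.
Qed.

Lemma perm_alpha_sum (R : realType) (Q : nat) (s : 'S_Q) (a : 'rV[R]_Q) :
  \sum_q perm_alpha s a 0 q = \sum_q a 0 q.
Proof.
rewrite [RHS](reindex_inj (@perm_inj _ s)) /=.
by apply: eq_bigr => q _; rewrite mxE.
Qed.

Lemma sqr_le_norm (R : realType) (x e : R) : 0 <= e -> x ^+ 2 <= e ^+ 2 -> `|x| <= e.
Proof. by move=> e0 h; rewrite -(ler_pXn2r (n := 2)) ?nnegrE // real_normK ?num_real. Qed.

(** The assumptions in quantitative form, with [d0] the radius of a
    neighbourhood of the true parameter inside the parameter space, [gap] a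
    lower bound on the distance between different connection parameters, and
    [dis] one on the displacement of the true parameter by a nontrivial
    permutation. *)
Record sbm_identified (R : realType) (Q : nat) (psi : R -> R)
    (Theta : set (param R Q)) (ts : param R Q) (c a1 a2 v V d0 gap dis : R) : Prop :=
  SbmIdentified {
  id_Q : (0 < Q)%N;
  id_c : 0 < c;
  id_a12 : a1 <= a2;
  id_curved : curved psi a1 a2 v V;
  id_param : forall t, Theta t -> is_param t;
  id_range1 : forall t, Theta t -> forall q, c <= t.1 0 q <= 1;
  id_range2 : forall t, Theta t -> forall q l, a1 <= t.2 q l <= a2;
  id_true : Theta ts;
  id_nbhd : forall t, is_param t -> (forall q, `|t.1 0 q - ts.1 0 q| <= d0) ->
     (forall q l, `|t.2 q l - ts.2 q l| <= d0) -> Theta t;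
  id_d0 : 0 < d0;
  id_rows : forall q q', (forall l, ts.2 q l = ts.2 q' l) -> q = q';
  id_gap0 : 0 < gap;
  id_gap : forall q l q' l', ts.2 q l != ts.2 q' l' -> gap <= `|ts.2 q l - ts.2 q' l'|;
  id_dis0 : 0 < dis;
  id_dis : forall u : 'S_Q, u != 1%g ->
     (exists q, dis <= `|ts.1 0 (u q) - ts.1 0 q|) \/
     (exists q l, dis <= `|ts.2 (u q) (u l) - ts.2 q l|)
}.

Section Assembly.
Context (R : realType) (Q n : nat).
Context (mu : {measure set (measurableTypeR R) -> \bar R}).
Context (A : set R) (b psi : R -> R) (hfam : regular_expfam mu A b psi).
Context (Theta : set (param R Q)) (ts : param R Q) (c a1 a2 v V d0 gap dis : R).
Hypothesis hid : sbm_identified psi Theta ts c a1 a2 v V d0 gap dis.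
Hypothesis aA : [set` `[a1, a2]] `<=` interior A.
Context (rho eps : R) (zs : assignment n Q) (y : 'I_n -> 'I_n -> R) (r : 'I_n -> 'I_n -> bool).
Hypothesis hbal : balanced ts.1 eps zs.
Hypothesis hquiet : quiet (fun q l => derive1 psi (ts.2 q l)) rho eps zs y r.
Hypothesis hb : forall i j, i != j -> 0 < b (y i j).
Context (pi0 : 'M[R]_Q).

Let ell := complete_loglik (Q := Q) psi y r.
Let nu := c ^+ 2 / 16.
Let mle : param R Q := (alpha_hat zs, pi_hat A psi pi0 y r zs).

Lemma class_sizes : eps <= c / 2 -> forall q, c * n%:R / 2 <= \sum_i (zs i == q)%:R.
Proof.
move=> he q; have := hbal q; rewrite ler_norml => /andP[h _].
have /andP[cq _] := id_range1 hid (id_true hid) q.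
have h1 : c * n%:R <= n%:R * ts.1 0 q by rewrite mulrC; apply: ler_wpM2l.
have h2 : eps * n%:R <= c / 2 * n%:R by apply: ler_wpM2r.
lra.
Qed.

Lemma alpha_hat_close : (0 < n)%N -> forall q, `|alpha_hat zs 0 q - ts.1 0 q| <= eps.
Proof.
move=> n0 q; have nR : 0 < n%:R :> R by rewrite ltr0n.
rewrite -(ler_pM2l nR) -[X in X * _ <= _](gtr0_norm nR) -normrM mulrBr mxE mulrA.
by rewrite mulfV ?lt0r_neq0 // mul1r [n%:R * eps]mulrC.
Qed.

Lemma alpha_hat_sum : (0 < n)%N -> \sum_q alpha_hat (R := R) zs 0 q = 1.
Proof.
move=> n0; have nR : n%:R != 0 :> R by rewrite pnatr_eq0 -lt0n.
rewrite (eq_bigr (fun q => n%:R^-1 * \sum_i (zs i == q)%:R)); last by move=> q _; rewrite mxE.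
rewrite -mulr_sumr exchange_big /= (eq_bigr (fun=> 1)) ?sumr_const ?card_ord ?mulVf // => i _.
by rewrite (bigD1 (zs i)) //= eqxx big1 ?addr0 // => l ne; rewrite eq_sym (negPf ne).
Qed.

Let sizes_count : (0 < n)%N -> 4 <= c * n%:R -> eps <= c / 2 -> eps <= nu -> 0 < rho ->
  forall q l, nu * rho * (n * n)%:R <= dyad_count r zs q l /\
  `|\sum_(k | off k && ((zs k.1, zs k.2) == (q, l))) y k.1 k.2 * (r k.1 k.2)%:R -
      derive1 psi (ts.2 q l) * dyad_count r zs q l| <= eps * rho * (n * n)%:R.
Proof.
move=> n0 cn e1 e2 r0.
have := @count_and_mean R n Q psi zs y r rho eps r0 ts.2 hquiet (c * n%:R / 2) nu
  (class_sizes e1).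
apply => //; first by lra.
rewrite natrM /nu; set N : R := n%:R in cn *.
have h : 0 <= (c * N) * (c * N - 4) by rewrite mulr_ge0 //; lra.
rewrite mulrBr in h; rewrite expr2; lra.
Qed.

(** The observed means are close to the true ones, so the intermediate value
    theorem produces a preimage, and injectivity of the mean identifies it with
    the one chosen in [pi_hat]. The segments used stay in the range of the
    parameter space because a shift of all the connection parameters at once is
    admissible. *)
Lemma pi_hat_close (eta : R) : (0 < n)%N -> 4 <= c * n%:R -> eps <= c / 2 -> eps <= nu ->
  0 < rho -> 0 <= eta -> eta <= d0 -> eps <= nu * v * eta -> forall q l,
  [/\ `|mle.2 q l - ts.2 q l| <= eta, a1 <= mle.2 q l <= a2 &
      derive1 psi (mle.2 q l) = y_hat y r zs q l].
Proof.
move=> n0 cn e1 e2 r0 eta0 etad e3 q l.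
have [hN hY] := sizes_count n0 cn e1 e2 r0 q l.
have c0 := id_c hid; have nu0 : 0 < nu by rewrite /nu divr_gt0 // exprn_gt0.
have nR : 0 < (n * n)%:R :> R by rewrite ltr0n muln_gt0 n0.
have N0 : 0 < dyad_count r zs q l :> R.
  by apply: lt_le_trans hN; rewrite !mulr_gt0.
set p := ts.2 q l in hY *; set m := derive1 psi p in hY.
have [v0 V0 hs _] := id_curved hid.
have hy : `|y_hat y r zs q l - m| <= v * eta.
  rewrite -(ler_pM2r N0) -[X in _ * X <= _](gtr0_norm N0) -normrM mulrBl y_hatE.
  rewrite divfK ?lt0r_neq0 //; apply: (le_trans hY).
  apply: (@le_trans _ _ (v * eta * (nu * rho * (n * n)%:R))).
    rewrite -mulrA (_ : v * eta * _ = nu * v * eta * (rho * (n * n)%:R)); last by ring.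
    by apply: ler_wpM2r => //; rewrite mulr_ge0 // ltW.
  by apply: ler_wpM2l => //; rewrite mulr_ge0 // ltW.
(* Shifting all the connection parameters by [x] stays in the parameter space. *)
have in_range x : `|x| <= d0 -> a1 <= p + x <= a2.
  move=> hx; have [hp1 hp2] := id_param hid (id_true hid).
  pose t : param R Q := (ts.1, \matrix_(q', l') (ts.2 q' l' + x)).
  have /(id_range2 hid) h : Theta t.
    apply: (id_nbhd hid) => /=; first by split.
      by move=> q'; rewrite subrr normr0 ltW // (id_d0 hid).
    by move=> q' l'; rewrite mxE [_ + x]addrC addrK.
  by have := h q l; rewrite /t /= mxE.
have /andP[lo1 lo2] := in_range (- eta) ltac:(rewrite normrN ger0_norm //).
have /andP[hi1 hi2] := in_range eta ltac:(rewrite ger0_norm //).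
have /andP[p1 p2] := id_range2 hid (id_true hid) q l; rewrite -/p in p1 p2.
have /andP[sl _] : v * (p - (p - eta)) <= m - derive1 psi (p - eta) <= V * (p - (p - eta)).
  by apply: hs; rewrite ?lo1 ?p1 //; lra.
have /andP[sh _] : v * (p + eta - p) <= derive1 psi (p + eta) - m <= V * (p + eta - p).
  by apply: hs; rewrite ?hi1 ?p1 //; lra.
have [x xin xe] : exists2 x, p - eta <= x <= p + eta & derive1 psi x = y_hat y r zs q l.
  apply: (mean_ivt hfam aA) => //; first by lra.
  move: hy; rewrite ler_norml => /andP[hy1 hy2]; apply/andP; split; lra.
have xr : a1 <= x <= a2.
  by case/andP: xin => x1 x2; rewrite (le_trans lo1 x1) (le_trans x2 hi2).
have hpi : mle.2 q l = x.
  rewrite mxE (negPf (lt0r_neq0 N0)).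
  case: xgetP => [x' _ [Ax' ex']|/(_ x) []]; last first.
    by split => //; apply: aA; rewrite /= in_itv.
  by apply: (mean_inj hfam) => //; [apply: aA; rewrite /= in_itv|rewrite ex' xe].
rewrite hpi; split => //; rewrite ler_norml; case/andP: xin => *; apply/andP; split; lra.
Qed.

Section Estimator.
Context (that : param R Q) (hvar : is_variational_estimate b psi Theta y r that).

Let w := a2 - a1.
Let g := w + V * w ^+ 2.
Let kN := c / (2 * Q%:R).

Let evidence t : Theta t -> expR (ell zs t) <= \sum_z expR (ell z that).
Proof.
move=> Tt; apply: (variational_evidence hb zs _ hvar Tt) => t' Tt' q.
by have /andP[h _] := id_range1 hid Tt' q; exact: lt_le_trans (id_c hid) h.
Qed.

Let kN_sizes : eps <= c / 2 -> forall q, Q%:R * (kN * n%:R) <= \sum_i (zs i == q)%:R.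
Proof.
move=> e1 q; apply: le_trans (class_sizes e1 q); rewrite le_eqVlt; apply/orP; left; apply/eqP.
by rewrite /kN; field; rewrite pnatr_eq0 -lt0n (id_Q hid).
Qed.

(** The evidence at the estimator exceeds the likelihood of the truth, so some
    assignment [z] loses at most a factor [Q ^ n]; this is negligible against
    the number [rho * n ^ 2] of sampled dyads. *)
Lemma that_near_orbit (del : R) : (0 < n)%N -> 0 < rho -> 0 <= eps -> eps <= c / 2 ->
  2 <= kN * n%:R -> 0 < del -> 2 * del < gap ->
  8 * Q%:R ^+ 4 * g * eps <= kN ^+ 2 * (v * del ^+ 2) ->
  4 * (ln Q%:R - ln c) <= kN ^+ 2 * (v * del ^+ 2) * (rho * n%:R) ->
  exists s : 'S_Q, forall q l, `|that.2 (s q) (s l) - ts.2 q l| <= del.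
Proof.
move=> n0 r0 e0 e1 hN del0 hgap he hn.
have c0 := id_c hid; have hcurv := id_curved hid; have [v0 V0 _ hD] := hcurv.
have Tthat := hvar.1; have Q0 := id_Q hid.
have QR : 0 < Q%:R :> R by rewrite ltr0n.
have nR : 0 < n%:R :> R by rewrite ltr0n.
have [z hz] : exists z, ell zs ts - n%:R * ln Q%:R <= ell z that.
  apply: contrapT => /forallNP hz.
  have : \sum_z expR (ell z that) < expR (ell zs ts).
    apply: (@lt_le_trans _ _ (\sum_(z : assignment n Q) expR (ell zs ts - n%:R * ln Q%:R))).
      apply: ltr_sum => [|z _]; last by rewrite ltr_expR ltNge; apply/negP; exact: hz.
      by apply/hasP; exists zs; rewrite ?mem_index_enum.
    rewrite sumr_const card_ffun !card_ord expRD expRN expRM_natl lnK ?posrE //.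
    by rewrite -[X in X <= _]mulr_natr natrX mulfVK // expf_neq0 // lt0r_neq0.
  by rewrite ltNge (evidence (id_true hid)).
have a1n (t : param R Q) (z' : assignment n Q) : Theta t ->
    n%:R * ln c <= \sum_i ln (t.1 0 (z' i)) /\ \sum_i ln (t.1 0 (z' i)) <= 0.
  move=> Tt; split; last first.
    by apply: sumr_le0 => i _; apply: ln_le0; have /andP[] := id_range1 hid Tt (z' i).
  have -> : n%:R * ln c = \sum_(i < n) ln c by rewrite sumr_const card_ord mulr_natl.
  apply: ler_sum => i _.
  have /andP[h _] := id_range1 hid Tt (z' i).
  by rewrite ler_ln ?posrE // (lt_le_trans c0).
have [_ h1] := a1n that z Tthat; have [h2 _] := a1n ts zs (id_true hid).
have far := fit_far hcurv (ltW r0) e0 hquiet (id_range2 hid (id_true hid)) z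
  (id_range2 hid Tthat).
set K := \sum_(k | off k) _ in far.
have KD : kN * n%:R - 1 >= kN * n%:R / 2 by lra.
have vd : 0 < v * del ^+ 2 by rewrite mulr_gt0 // exprn_gt0.
apply: (consistency (D := bregman psi) (zs := zs) (ps := ts.2) (N := kN * n%:R)
   (id_rows hid) (kN_sizes e1) (z := z) (e := K) v0 (ltW del0)) => //.
- by lra.
- by move=> q l q' l'; case/andP: (hD _ _ (id_range2 hid (id_true hid) q l) (id_range2 hid Tthat q' l')).
- by move=> q l q' l' ne; apply: (lt_le_trans hgap); exact: id_gap hid _ _ _ _ ne.
have rn : 0 < rho * n%:R by rewrite mulr_gt0.
have hz' : - (n%:R * (ln Q%:R - ln c)) <=
    dyad_fit psi y r z that.2 - dyad_fit psi y r zs ts.2.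
  move: hz h1 h2; rewrite /ell /complete_loglik; lra.
have hK : rho * K <= 2 * Q%:R ^+ 4 * g * eps * (rho * (n * n)%:R) + n%:R * (ln Q%:R - ln c).
  by move: far; rewrite -/w -/g => far; lra.
have t1 : 2 * Q%:R ^+ 4 * g * eps * (rho * (n * n)%:R) <=
    kN ^+ 2 * (v * del ^+ 2) / 4 * (rho * (n * n)%:R).
  apply: ler_wpM2r; first by rewrite mulr_ge0 // ltW.
  lra.
have t2 : n%:R * (ln Q%:R - ln c) <= n%:R * (kN ^+ 2 * (v * del ^+ 2) * (rho * n%:R) / 4).
  by apply: ler_wpM2l; [exact: ltW|lra].
have t3 : rho * K <= rho * (kN ^+ 2 * (v * del ^+ 2) * (n%:R * n%:R) / 2).
  apply: (le_trans hK); apply: (le_trans (lerD t1 t2)); rewrite natrM.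
  by rewrite le_eqVlt; apply/orP; left; apply/eqP; field.
rewrite ler_pM2l // in t3; apply: (le_trans t3).
apply: (@le_trans _ _ (kN * n%:R * (kN * n%:R / 2 * (v * del ^+ 2)))).
  by rewrite le_eqVlt; apply/orP; left; apply/eqP; field.
apply: ler_wpM2l; first by lra.
by apply: ler_wpM2r; [exact: ltW|].
Qed.

Let kap := kN ^+ 2 * (v * gap ^+ 2) / 4.

(** Both the sum over assignments and the complete-data maximum likelihood
    estimator enter through [selection], with the permutations as competitors.
    Two permutations within [h] of the maximum would both bring the estimator
    close to the true parameter, making the latter nearly invariant under a
    nontrivial permutation. *)
Lemma estimator_close (del eta x : R) :
  (0 < n)%N -> 0 < rho -> 0 <= eps -> eps <= c / 2 -> eps <= nu -> eps <= eta ->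
  eps <= nu * v * eta -> 0 < eta -> eta <= d0 -> 8 * eta <= dis ->
  4 <= c * n%:R -> 2 <= kN * n%:R -> 0 < del -> 2 * del < gap ->
  8 * Q%:R ^+ 4 * g * eps <= kN ^+ 2 * (v * del ^+ 2) ->
  4 * (ln Q%:R - ln c) <= kN ^+ 2 * (v * del ^+ 2) * (rho * n%:R) ->
  4 * Q%:R ^+ 4 * g * eps <= kap -> 12 * V * w * del <= kap ->
  1 <= nu * v * (rho * n%:R) ->
  (1 + Q.-1%:R * (c^-1 * expR (- kap * rho * n%:R / 2))) ^+ n <= 1 + x -> 0 <= x ->
  x + #|{: 'S_Q}|%:R * expR (- (eta ^+ 2 / 4 * n%:R)) <= 1 / 2 ->
  exists s : 'S_Q,
   (forall q, n%:R / 4 * (mle.1 0 q - that.1 0 (s q)) ^+ 2 <=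
      2 * (x + #|{: 'S_Q}|%:R * expR (- (eta ^+ 2 / 4 * n%:R)))) /\
   (forall q l, nu * rho * (n * n)%:R * v * (mle.2 q l - that.2 (s q) (s l)) ^+ 2 <=
      2 * (x + #|{: 'S_Q}|%:R * expR (- (eta ^+ 2 / 4 * n%:R)))).
Proof.
move=> n0 r0 e0 e1 e2 e3 e4 eta0 etad etadis cn kn del0 dgap c1 c2 c3 c4 c5 hB x0 hxi.
have c0 := id_c hid; have hcurv := id_curved hid; have [v0 V0 _ hD] := hcurv.
have Tthat := hvar.1; have Q0 := id_Q hid; have gap0 := id_gap0 hid.
have QR : 0 < Q%:R :> R by rewrite ltr0n.
have nR : 0 < n%:R :> R by rewrite ltr0n.
have nu0 : 0 < nu by rewrite /nu divr_gt0 // exprn_gt0.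
have kN0 : 0 < kN by rewrite /kN divr_gt0 // mulr_gt0.
have kN1 : kN <= 1.
  have /andP[l1 l2] := id_range1 hid (id_true hid) (Ordinal Q0).
  rewrite /kN ler_pdivrMr ?mulr_gt0 // mul1r.
  have : 1 <= Q%:R :> R by rewrite ler1n.
  by have := le_trans l1 l2; lra.
have [s0 hs0] := that_near_orbit n0 r0 e0 e1 kn del0 dgap c1 c2.
pose t0 := perm_param s0 that.
have mle_close q l := pi_hat_close n0 cn e1 e2 r0 (ltW eta0) etad e4 q l.
have alpha_close q : `|mle.1 0 q - ts.1 0 q| <= eta.
  by apply: le_trans e3; exact: alpha_hat_close.
have alpha_pos q : 0 < alpha_hat (R := R) zs 0 q.
  have := alpha_hat_close n0 q; rewrite ler_norml => /andP[h _].
  by have /andP[h' _] := id_range1 hid (id_true hid) q; lra.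
have Tmle : Theta mle.
  apply: (id_nbhd hid).
  - by split; [move=> q; exact: ltW|exact: alpha_hat_sum].
  - by move=> q; apply: le_trans etad.
  - by move=> q l; have [h _ _] := mle_close q l; apply: le_trans etad.
pose M := ell zs mle; pose E (s : 'S_Q) := ell zs (perm_param s t0).
set f0 := v * gap ^+ 2.
have f00 : 0 < f0 by rewrite mulr_gt0 // exprn_gt0.
have kap0 : 0 <= kap by rewrite /kap divr_ge0 // mulr_ge0 ?sqr_ge0 // ltW.
have KD : kN * n%:R / 2 <= kN * n%:R - 1 by lra.
have hM : expR M <= (1 + Q.-1%:R * (c^-1 * expR (- kap * rho * n%:R / 2))) ^+ n *
    \sum_s expR (E s).
  apply: (le_trans (evidence Tmle)).
  rewrite (reindex (@relabel n Q s0)) /=; last exact/onW_bij/relabel_bij.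
  rewrite (eq_bigr (fun z => expR (ell z t0))); last first.
    by move=> z _; rewrite /ell complete_loglik_relabel.
  apply: (@posterior_sum R n Q psi ts.2 a1 a2 v V hcurv (id_a12 hid) rho eps (ltW r0) e0 zs y r
    hquiet (id_range2 hid (id_true hid)) (id_rows hid) (kN * n%:R) f0 kap del c t0) => //.
  - exact: kN_sizes.
  - by lra.
  - exact: ltW.
  - move=> q l q' l' ne; have /andP[h _] := hD _ _ (id_range2 hid (id_true hid) q l)
      (id_range2 hid (id_true hid) q' l').
    apply: le_trans h; apply: ler_wpM2l; first exact: ltW.
    rewrite -[X in _ <= X]real_normK ?num_real // lerXn2r ?nnegrE ?(ltW gap0) //.
    by rewrite distrC; exact: id_gap hid _ _ _ _ ne.
  - apply: (@le_trans _ _ (kN * n%:R / 2 * f0)); last by apply: ler_wpM2r => //; exact: ltW.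
    have : 0 <= (1 - kN) * (kN * n%:R * f0).
      by rewrite mulr_ge0 ?subr_ge0 // !mulr_ge0 // ltW.
    by rewrite /kap -/f0; lra.
  - apply: (@le_trans _ _ (kN * n%:R * (kN * n%:R / 2 * f0))).
      by rewrite /kap -/f0 le_eqVlt; apply/orP; left; apply/eqP; field.
    apply: ler_wpM2l; first by lra.
    by apply: ler_wpM2r => //; exact: ltW.
  - by move=> q; rewrite /t0 /= mxE; exact: (id_range1 hid Tthat).
  - by move=> q l; rewrite /t0 /= mxE; exact: (id_range2 hid Tthat).
  - exact: ltW.
  - by move=> q l; rewrite /t0 /= mxE.
have nunn : 0 < nu * rho * (n * n)%:R by rewrite natrM !mulr_gt0.
have gaps s : (forall q, n%:R / 4 * (mle.1 0 q - (perm_param s t0).1 0 q) ^+ 2 <= M - E s) /\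
    (forall q l, nu * rho * (n * n)%:R * v * (mle.2 q l - (perm_param s t0).2 q l) ^+ 2 <= M - E s).
  have := @loglik_gap R n Q psi a1 a2 v V hcurv zs y r mle.2 (perm_param s t0)
    (nu * rho * (n * n)%:R) n0 nunn alpha_pos.
  apply.
  - by move=> q l; have [] := mle_close q l.
  - by move=> q l; rewrite /= !mxE; exact: (id_range2 hid Tthat).
  - move=> q; rewrite /= !mxE; have /andP[h1 h2] := id_range1 hid Tthat (s0 (s q)).
    by rewrite h2 (lt_le_trans c0 h1).
  - by rewrite /= !perm_alpha_sum; exact: (id_param hid Tthat).2.
  - by move=> q l; have [] := sizes_count n0 cn e1 e2 r0 q l.
  - by move=> q l; have [] := mle_close q l.
pose h := eta ^+ 2 / 4 * n%:R.
(* Within [h] of the maximum, strong concavity gives closeness to the true parameter. *)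
have close s : M - E s < h ->
    (forall q, `|(perm_param s t0).1 0 q - ts.1 0 q| <= 2 * eta) /\
    (forall q l, `|(perm_param s t0).2 q l - ts.2 q l| <= 2 * eta).
  move=> Gs; have [g1 g2] := gaps s; split=> [q|q l].
    rewrite -(subrKA (mle.1 0 q)) (le_trans (ler_normD _ _)) //.
    rewrite [2 * eta]mulr_natl mulr2n; apply: lerD => //; rewrite distrC.
    apply: sqr_le_norm (ltW eta0) _; rewrite -(ler_pM2l nR).
    by have := le_lt_trans (g1 q) Gs; rewrite /h; lra.
  rewrite -(subrKA (mle.2 q l)) (le_trans (ler_normD _ _)) //.
  have [m1 _ _] := mle_close q l.
  rewrite [2 * eta]mulr_natl mulr2n; apply: lerD => //; rewrite distrC.
  apply: sqr_le_norm (ltW eta0) _; rewrite -(ler_pM2l nR).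
  have := le_lt_trans (g2 q l) Gs; rewrite /h; set X := _ ^+ 2 => hX.
  have X0 : 0 <= X by exact: sqr_ge0.
  have : 0 <= (nu * v * (rho * n%:R) - 1) * (n%:R * X).
    by rewrite mulr_ge0 ?subr_ge0 // mulr_ge0 // ltW.
  rewrite natrM in hX; move=> hY; have : 0 <= eta ^+ 2 * n%:R.
    by rewrite mulr_ge0 ?sqr_ge0 // ltW.
  by lra.
have sep s s' : M - E s < h -> s' != s -> h <= M - E s'.
  move=> Gs ne; rewrite leNgt; apply/negP => Gs'.
  have [p1 p2] := close s Gs; have [p1' p2'] := close s' Gs'.
  (* Two competitors close to the truth differ by a near symmetry of the truth. *)
  have une : (s' * s^-1)%g != 1%g.
    by apply: contraNneq ne => e; rewrite -(mulgKV s s') e mul1g.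
  have us q : s ((s' * s^-1)%g q) = s' q by rewrite permM permKV.
  case: (id_dis hid une) => [[q hq]|[q [l hq]]].
    have := p1 ((s' * s^-1)%g q); have := p1' q; rewrite /= !mxE us => k1 k2.
    have := ler_normB ((t0.1 0 (s' q)) - ts.1 0 q) (t0.1 0 (s' q) - ts.1 0 ((s' * s^-1)%g q)).
    rewrite /t0 /= !mxE (_ : _ - _ - (_ - _) = ts.1 0 ((s' * s^-1)%g q) - ts.1 0 q); last by ring.
    by move=> k3; lra.
  have := p2 ((s' * s^-1)%g q) ((s' * s^-1)%g l); have := p2' q l; rewrite /= !mxE !us => k1 k2.
  have := ler_normB ((t0.2 (s' q) (s' l)) - ts.2 q l)
     (t0.2 (s' q) (s' l) - ts.2 ((s' * s^-1)%g q) ((s' * s^-1)%g l)).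
  rewrite /t0 /= !mxE (_ : _ - _ - (_ - _) =
     ts.2 ((s' * s^-1)%g q) ((s' * s^-1)%g l) - ts.2 q l); last by ring.
  by move=> k3; lra.
have B1 : 1 <= (1 + Q.-1%:R * (c^-1 * expR (- kap * rho * n%:R / 2))) ^+ n.
  by apply: exprn_ege1; rewrite lerDl !mulr_ge0 ?expR_ge0 // invr_ge0 ltW.
have [s [_ hs]] := selection (G := fun s => M - E s) hM B1 hB (fun s => lexx _) sep hxi x0.
exists (s * s0)%g; have [g1 g2] := gaps s; rewrite perm_paramM in g1 g2.
split=> [q|q l].
  apply: le_trans hs; have := g1 q.
  by rewrite (_ : (perm_param _ that).1 0 q = that.1 0 ((s * s0)%g q)) // [LHS]mxE.
apply: le_trans hs; have := g2 q l.
by rewrite (_ : (perm_param _ that).2 q l = that.2 ((s * s0)%g q) ((s * s0)%g l)) // [LHS]mxE.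
Qed.

End Estimator.

End Assembly.

(** * Constants and rates *)

Lemma small_pos (R : realType) (s : seq R) : (forall x, x \in s -> 0 < x) ->
  exists2 e : R, 0 < e & forall x, x \in s -> e <= x.
Proof.
elim: s => [|x s IH] hs; first by exists 1.
have [|e e0 he] := IH; first by move=> u us; apply: hs; rewrite inE us orbT.
exists (Num.min x e); first by rewrite lt_min e0 hs // inE eqxx.
move=> u; rewrite inE => /orP[/eqP ->|us]; first by rewrite ge_min lexx.
by rewrite ge_min (he u us) orbT.
Qed.

Lemma finite_gap (R : realType) (I : finType) (f : I -> R) :
  exists2 e : R, 0 < e & forall i, 0 < f i -> e <= f i.
Proof.
have [|e e0 he] := @small_pos R [seq f i | i <- enum I & 0 < f i].
  by move=> x /mapP[i]; rewrite mem_filter => /andP[h _] ->.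
exists e => // i fi; apply: he; apply/mapP; exists i => //.
by rewrite mem_filter fi mem_enum.
Qed.

Section Identification.
Context (R : realType) (Q : nat) (mu : {measure set (measurableTypeR R) -> \bar R}).
Context (A : set R) (b psi : R -> R) (hfam : regular_expfam mu A b psi).
Context (Theta : set (param R Q)) (ts : param R Q).

Lemma distinct_rows : injective (fun q : 'I_Q =>
    \sum_(l < Q) derive1 psi (ts.2 q l) * ts.1 0 l) ->
  forall q q', (forall l, ts.2 q l = ts.2 q' l) -> q = q'.
Proof.
by move=> inj q q' h; apply: inj; apply: eq_bigr => l _; rewrite h.
Qed.

(** A common symmetry of the proportions and of the connection parameters
    permutes the coordinates of the vector assumed to have distinct
    coordinates. *)
Lemma no_symmetry (u : 'S_Q) : injective (fun q : 'I_Q =>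
    \sum_(l < Q) derive1 psi (ts.2 q l) * ts.1 0 l) ->
  (forall q, ts.1 0 (u q) = ts.1 0 q) -> (forall q l, ts.2 (u q) (u l) = ts.2 q l) ->
  u = 1%g.
Proof.
move=> inj h1 h2; apply/permP => q; rewrite perm1; apply: inj.
rewrite (reindex_inj (@perm_inj _ u)) /=; apply: eq_bigr => l _.
by rewrite h1 h2.
Qed.

Lemma identified_of_assumptions (c a1 a2 : R) : (1 <= Q)%N ->
  (forall t, Theta t -> is_param t) -> Theta ts -> 0 < c ->
  [set` `[a1, a2]] `<=` interior A ->
  (forall t, Theta t -> (forall q, c <= t.1 0 q <= 1 - c) /\
             (forall q l, a1 <= t.2 q l <= a2)) ->
  (\forall t \near ts, is_param t -> Theta t) ->
  injective (fun q : 'I_Q => \sum_(l < Q) derive1 psi (ts.2 q l) * ts.1 0 l) ->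
  exists v V d0 gap dis, sbm_identified psi Theta ts c a1 a2 v V d0 gap dis.
Proof.
move=> Q0 hpar hts c0 aA hrange hnear hinj.
have a12 : a1 <= a2.
  have /andP[h1 h2] := (hrange ts hts).2 (Ordinal Q0) (Ordinal Q0).
  exact: le_trans h1 h2.
have [v [V hcurv]] := expfam_curved hfam a12 aA.
have /nbhs_ballP[e /= e0 he] := hnear.
have [gap gap0 hgap] := finite_gap (fun x : ('I_Q * 'I_Q) * ('I_Q * 'I_Q) =>
   `|ts.2 x.1.1 x.1.2 - ts.2 x.2.1 x.2.2|).
have [dis1 dis10 hdis1] := finite_gap (fun x : 'S_Q * 'I_Q => `|ts.1 0 (x.1 x.2) - ts.1 0 x.2|).
have [dis2 dis20 hdis2] := finite_gap (fun x : 'S_Q * ('I_Q * 'I_Q) =>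
   `|ts.2 (x.1 x.2.1) (x.1 x.2.2) - ts.2 x.2.1 x.2.2|).
exists v, V, (e / 2), gap, (Num.min dis1 dis2); split => //.
- move=> t Tt q; have /andP[h1 h2] := (hrange t Tt).1 q; rewrite h1 /=; lra.
- by move=> t Tt q l; exact: (hrange t Tt).2.
- move=> t tp h1 h2; apply: he => //; have e2 : e / 2 < e by lra.
  split; split => // i j; rewrite /ball /= distrC.
    by rewrite [i]ord1; apply: le_lt_trans e2.
  exact: le_lt_trans (h2 i j) e2.
- by lra.
- exact: distinct_rows.
- move=> q l q' l' ne; apply: (hgap ((q, l), (q', l'))) => /=.
  by rewrite normr_gt0 subr_eq0.
- by rewrite lt_min dis10.
- move=> u u1; apply: contrapT => /not_orP[/forallNP h1 /forallNP h2].
  move/eqP: u1; apply; apply: (no_symmetry hinj).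
    move=> q; apply/eqP; rewrite -subr_eq0 -normr_eq0; apply/eqP.
    apply/eqP; apply: contraT => n0; exfalso; apply: (h1 q).
    rewrite ge_min (hdis1 (u, q)) //= lt0r n0 normr_ge0 //.
  move=> q l; apply/eqP; rewrite -subr_eq0 -normr_eq0.
  apply: contraT => n0; exfalso; have /forallNP/(_ l) := h2 q; apply.
  by rewrite ge_min (hdis2 (u, (q, l))) ?orbT //= lt0r n0 normr_ge0.
Qed.

End Identification.

Lemma compound_le (R : realType) (n : nat) (u : R) : 0 <= u -> n%:R * u <= 1 / 2 ->
  (1 + u) ^+ n <= 1 + 2 * (n%:R * u).
Proof.
move=> u0 nu; apply: (@le_trans _ _ (expR (n%:R * u))).
  by rewrite expRM_natl lerXn2r ?nnegrE ?addr_ge0 ?expR_ge0 ?expR_ge1Dx.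
apply: (le_trans (expR_le_quad nu)).
have : 0 <= (n%:R * u) * (1 / 2 - n%:R * u) by rewrite mulr_ge0 ?subr_ge0 // mulr_ge0.
by rewrite mulrBr expr2; lra.
Qed.

Lemma expRN_le_inv_sqr (R : realType) (x : R) : 0 < x -> expR (- x) <= 2 / x ^+ 2.
Proof.
move=> x0; rewrite expRN -[X in _ <= X]invrK lef_pV2 ?posrE ?expR_gt0 ?invr_gt0 //;
  last by rewrite divr_gt0 // exprn_gt0.
rewrite invfM invrK; have := @expR_ge1Dxn R x 1 (ltW x0).
have -> : (2`!)%:R = 2 :> R by [].
by move=> h; apply: le_trans h; rewrite mulrC lerDr.
Qed.

(** The fourth power leaves an error of order [n ^ -2] after multiplication
    by the number of nodes, with a power to spare. *)
Lemma expRN_ln4 (R : realType) (n : nat) (x : R) : (0 < n)%N ->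
  4 * ln (n%:R : R) <= x -> expR (- x) <= (n%:R ^+ 4)^-1.
Proof.
move=> n0 hx; have nR : 0 < n%:R :> R by rewrite ltr0n.
rewrite -[X in _ <= X^-1](@lnK R) ?posrE ?exprn_gt0 // -expRN ler_expR lerN2.
by rewrite lnXn // mulr_natl in hx *.
Qed.

Section RateLarge.
Context (R : realType) (rho : nat -> R).
Hypothesis hrho : (fun n : nat => n%:R * rho n / ln (n%:R : R)) @ \oo --> +oo.

Lemma rate_large (K : R) : 0 <= K -> exists N : nat, forall n, (N <= n)%N ->
  [/\ (2 <= n)%N, K * ln (n%:R : R) <= n%:R * rho n & K <= n%:R * rho n].
Proof.
move=> K0; have l2 : 0 < ln (2 : R) by rewrite ln_gt0 // ltr1n.
have /cvgryPge/(_ (K + K / ln 2))[N _ hN] := hrho.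
exists (maxn N 2) => n; rewrite geq_max => /andP[Nn n2].
have lnn : ln 2 <= ln (n%:R : R).
  by rewrite ler_ln ?posrE ?ltr0n ?ler_nat // (leq_trans _ n2).
have ln0 : 0 < ln (n%:R : R) by apply: lt_le_trans lnn.
have := hN n Nn; rewrite /= ler_pdivlMr // => h.
have K2 : 0 <= K / ln 2 by rewrite divr_ge0 // ltW.
split => //; apply: le_trans h; rewrite mulrDl.
  by rewrite lerDl mulr_ge0 // ltW.
apply: (@le_trans _ _ (K / ln 2 * ln (n%:R : R))).
  by rewrite -mulrA ler_peMr // ler_pdivlMl // mulr1.
by rewrite lerDr mulr_ge0 // ltW.
Qed.

Lemma large_nat (K : R) : exists N : nat, forall n, (N <= n)%N -> K <= n%:R.
Proof.
exists (Num.truncn K).+1 => n hn; apply: ltW; apply: lt_le_trans (truncnS_gt K) _.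
by rewrite ler_nat.
Qed.

Lemma posterior_rate (Q : nat) (c k : R) : 0 < c -> 0 < k -> exists (N : nat),
  forall n, (N <= n)%N ->
  (1 + Q.-1%:R * (c^-1 * expR (- k * rho n * n%:R / 2))) ^+ n <=
    1 + 2 * Q%:R / c / n%:R ^+ 2.
Proof.
move=> c0 k0; have [N1 h1] := rate_large (K := 8 / k) ltac:(by rewrite divr_ge0 // ltW).
have [N2 h2] := large_nat (2 * Q%:R / c); exists (maxn N1 N2) => n.
rewrite geq_max => /andP[/h1[n2 hk _] /h2 hn].
have n0 : (0 < n)%N by apply: leq_trans n2.
have nR : 0 < n%:R :> R by rewrite ltr0n.
have nR1 : 1 <= n%:R :> R by rewrite ler1n.
have he : expR (- k * rho n * n%:R / 2) <= (n%:R ^+ 4)^-1.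
  rewrite (_ : - k * rho n * n%:R / 2 = - (k / 2 * (n%:R * rho n))); last by field.
  apply: expRN_ln4 => //.
  have := ler_wpM2l (ltW k0) hk; rewrite (_ : k * (8 / k * ln n%:R) = 8 * ln (n%:R : R)); last first.
    by field; rewrite gt_eqF.
  by lra.
set u := Q.-1%:R * _; set C := Q%:R / c.
have C0 : 0 <= C by rewrite divr_ge0 // ltW.
have u0 : 0 <= u by rewrite !mulr_ge0 ?expR_ge0 // invr_ge0 ltW.
have uC : n%:R * u <= C / n%:R ^+ 3.
  apply: (@le_trans _ _ (n%:R * (Q%:R * (c^-1 * (n%:R ^+ 4)^-1)))).
    apply: ler_wpM2l => //; apply: ler_pM => //.
    - by rewrite mulr_ge0 ?expR_ge0 // invr_ge0 ltW.
    - by rewrite ler_nat leq_pred.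
    - by apply: ler_wpM2l; rewrite // invr_ge0 ltW.
  by rewrite le_eqVlt /C; apply/orP; left; apply/eqP; field; rewrite !lt0r_neq0.
have n3 : C / n%:R ^+ 3 <= C / n%:R ^+ 2.
  apply: ler_wpM2l => //; rewrite lef_pV2 ?posrE ?exprn_gt0 //.
  by rewrite exprS ler_peMl // exprn_ge0 // ltW.
have hC : C / n%:R ^+ 2 <= 1 / 2.
  rewrite ler_pdivrMr ?exprn_gt0 // (le_trans (y := n%:R / 2)) //.
    by rewrite /C; lra.
  have : 0 <= n%:R * (n%:R - 1) :> R by rewrite mulr_ge0 ?subr_ge0.
  by rewrite mulrBr expr2; lra.
have h := le_trans uC n3.
apply: (le_trans (compound_le u0 (le_trans h hC))); rewrite lerD2l.
rewrite (_ : 2 * Q%:R / c / n%:R ^+ 2 = 2 * (C / n%:R ^+ 2)); last by rewrite /C; field;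
  rewrite !lt0r_neq0.
by rewrite ler_wpM2l.
Qed.

Lemma failure_rate (Q : nat) (lam eps : R) : (0 < Q)%N -> 0 < lam -> 0 < eps ->
  exists (C : R) (N : nat), forall n, (N <= n)%N ->
   failure_bound Q n (rho n) lam eps <= C / n%:R ^+ 2.
Proof.
move=> Q0 lam0 eps0; pose k := lam * eps / 2.
have k0 : 0 < k by rewrite /k !mulr_gt0 // invr_gt0.
have QR : 0 < Q%:R :> R by rewrite ltr0n.
have [N1 h1] := rate_large (K := (1 + ln Q%:R) / k)
  ltac:(by rewrite divr_ge0 ?addr_ge0 ?ln_ge0 ?ler1n // ltW).
have [N2 h2] := posterior_rate Q (c := 1) (k := 4 * k) ltr01 ltac:(by rewrite mulr_gt0).
exists (2 * Q%:R * (2 / (eps ^+ 2 / 8) ^+ 2) + 4 * Q%:R ^+ 4 * (2 + 2 * Q%:R)).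
exists (maxn N1 N2) => n; rewrite geq_max => /andP[/h1[n2 _ hk] /h2 hn].
have n0 : (0 < n)%N by apply: leq_trans n2.
have nR : 0 < n%:R :> R by rewrite ltr0n.
rewrite /failure_bound -/k [X in _ <= X]mulrDl; apply: lerD.
  rewrite -[X in _ <= X]mulrA; apply: ler_wpM2l; first by rewrite mulr_ge0.
  rewrite mulNr; apply: (le_trans (expRN_le_inv_sqr _)).
    by rewrite mulr_gt0 // divr_gt0 // exprn_gt0.
  rewrite exprMn invfM mulrA //.
rewrite -[X in _ <= X]mulrA; apply: ler_wpM2l; first by rewrite mulr_ge0 // exprn_ge0.
rewrite [X in _ <= X]mulrDl; apply: lerD.
  rewrite -[Q%:R ^+ n](@lnK R) ?posrE ?exprn_gt0 // lnXn // -expRD.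
  apply: (le_trans _ (expRN_le_inv_sqr nR)); rewrite ler_expR.
  rewrite -[ln _ *+ n]mulr_natl natrM.
  move: hk; rewrite ler_pdivrMr // => hk.
  have := ler_wpM2l (ltW nR) hk; lra.
rewrite lerBlDl; move: hn; rewrite invr1 mul1r mulr1.
rewrite (_ : - (4 * k) * rho n * n%:R / 2 = - k * (rho n * (2 * n)%:R)) //.
by rewrite natrM; field.
Qed.

End RateLarge.

(** * The estimator for large networks *)

Section EstimatorRate.
Context (R : realType) (Q : nat) (mu : {measure set (measurableTypeR R) -> \bar R}).
Context (A : set R) (b psi : R -> R) (hfam : regular_expfam mu A b psi).
Context (Theta : set (param R Q)) (ts : param R Q) (c a1 a2 v V d0 gap dis : R).
Hypothesis hid : sbm_identified psi Theta ts c a1 a2 v V d0 gap dis.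
Hypothesis aA : [set` `[a1, a2]] `<=` interior A.
Context (rho : nat -> R).
Hypothesis hrho : (fun n : nat => n%:R * rho n / ln (n%:R : R)) @ \oo --> +oo.
Context (pi0 : 'M[R]_Q).

(** The squared error [C / n ^ 3] suffices for both claims. The curvature in
    the connection parameters is only known to be at least of order [n], so a
    bounded loss of likelihood would not give the rate [1 / n]; a loss of order
    [n ^ -2] does. *)
Lemma estimator_rate : exists (eps C : R) (N : nat), [/\ 0 < eps, eps <= 1, 0 <= C &
  forall n, (N <= n)%N -> forall (zs : assignment n Q) y r that,
    balanced ts.1 eps zs -> quiet (fun q l => derive1 psi (ts.2 q l)) (rho n) eps zs y r ->
    (forall i j, i != j -> 0 < b (y i j)) ->
    is_variational_estimate b psi Theta y r that ->
    exists s : 'S_Q,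
      (forall q, (alpha_hat zs 0 q - that.1 0 (s q)) ^+ 2 <= C / n%:R ^+ 3) /\
      (forall q l, (pi_hat A psi pi0 y r zs q l - that.2 (s q) (s l)) ^+ 2 <= C / n%:R ^+ 3)].
Proof.
have c0 := id_c hid; have [v0 V0 _ _] := id_curved hid.
have a12 := id_a12 hid; have d00 := id_d0 hid; have gap0 := id_gap0 hid.
have dis0 := id_dis0 hid.
have QR : 0 < Q%:R :> R by rewrite ltr0n (id_Q hid).
pose w := a2 - a1; have w0 : 0 <= w by rewrite subr_ge0.
pose g := w + V * w ^+ 2.
have g0 : 0 <= g by rewrite addr_ge0 // mulr_ge0 ?sqr_ge0 // ltW.
pose gQ := Q%:R ^+ 4 * g; have gQ0 : 0 <= gQ by rewrite mulr_ge0 ?exprn_ge0 // ltW.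
pose kN := c / (2 * Q%:R); have kN0 : 0 < kN by rewrite divr_gt0 // mulr_gt0.
pose kap := kN ^+ 2 * (v * gap ^+ 2) / 4.
have kap0 : 0 < kap.
  by apply: divr_gt0 => //; apply: mulr_gt0; rewrite ?exprn_gt0 // mulr_gt0 ?exprn_gt0.
pose nu := c ^+ 2 / 16; have nu0 : 0 < nu by rewrite divr_gt0 // exprn_gt0.
pose Vw := V * w; have Vw0 : 0 <= Vw by rewrite mulr_ge0 // ltW.
(* [del] is the admissible distance to the orbit of the true connection parameters: it
   must not blur different parameters, nor consume the separation [kap]. *)
have [del del0] := @small_pos R [:: gap / 3; kap / (1 + 12 * Vw)] ltac:(
  move=> x; rewrite !inE => /orP[] /eqP ->; [by lra|by rewrite divr_gt0 // ltr_pwDl // mulr_ge0]).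
move=> hdel; have del1 : del <= gap / 3 by apply: hdel; rewrite !inE eqxx.
have del2 : del <= kap / (1 + 12 * Vw) by apply: hdel; rewrite !inE eqxx orbT.
(* Parameters closer than [eta] to the maximum likelihood estimator stay in the
   parameter space, and cannot be close to two images of the true parameter. *)
have [eta eta0] := @small_pos R [:: d0; dis / 8] ltac:(
  move=> x; rewrite !inE => /orP[] /eqP ->; by lra).
move=> heta; have eta1 : eta <= d0 by apply: heta; rewrite !inE eqxx.
have eta2 : eta <= dis / 8 by apply: heta; rewrite !inE eqxx orbT.
have vd0 : 0 < kN ^+ 2 * (v * del ^+ 2).
  by apply: mulr_gt0; rewrite ?exprn_gt0 // mulr_gt0 ?exprn_gt0.
(* All the noise must fit into the margins chosen so far. *)
have [eps eps0] := @small_pos R [:: c / 2; nu; eta; nu * v * eta; 1;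
   kN ^+ 2 * (v * del ^+ 2) / (1 + 8 * gQ); kap / (1 + 4 * gQ)] ltac:(
  move=> x; rewrite !inE => /or4P[|||/or4P[]] /eqP ->;
  [by lra|by []|by []|by rewrite !mulr_gt0|by []
  |by rewrite divr_gt0 // ltr_pwDl // mulr_ge0|by rewrite divr_gt0 // ltr_pwDl // mulr_ge0]).
move=> heps.
have e1 : eps <= c / 2 by apply: heps; rewrite !inE eqxx ?orbT.
have e2 : eps <= nu by apply: heps; rewrite !inE eqxx ?orbT.
have e3 : eps <= eta by apply: heps; rewrite !inE eqxx ?orbT.
have e4 : eps <= nu * v * eta by apply: heps; rewrite !inE eqxx ?orbT.
have e5 : eps <= 1 by apply: heps; rewrite !inE eqxx ?orbT.
have e6 : eps <= kN ^+ 2 * (v * del ^+ 2) / (1 + 8 * gQ).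
  by apply: heps; rewrite !inE eqxx ?orbT.
have e7 : eps <= kap / (1 + 4 * gQ) by apply: heps; rewrite !inE eqxx ?orbT.
have absorb (x K G : R) : 0 <= G -> 0 <= x -> x <= K / (1 + G) -> G * x <= K.
  move=> G0 x0; rewrite ler_pdivlMr; last by rewrite ltr_pwDl.
  by rewrite mulrDr mulr1 mulrC; lra.
have e6' := absorb _ _ _ (mulr_ge0 (ler0n _ 8) gQ0) (ltW eps0) e6.
have e7' := absorb _ _ _ (mulr_ge0 (ler0n _ 4) gQ0) (ltW eps0) e7.
have del2' := absorb _ _ _ (mulr_ge0 (ler0n _ 12) Vw0) (ltW del0) del2.
pose F : R := #|{: 'S_Q}|%:R; have F0 : 0 <= F by exact: ler0n.
pose k3 := eta ^+ 2 / 4; have k30 : 0 < k3 by rewrite divr_gt0 // exprn_gt0.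
pose C1 := 2 * Q%:R / c + F * (2 / k3 ^+ 2).
have C10 : 0 <= C1.
  by rewrite addr_ge0 // ?divr_ge0 ?mulr_ge0 ?invr_ge0 ?exprn_ge0 // ltW.
have [N1 h1] := posterior_rate hrho Q c0 kap0.
(* The sampled degree [rho * n] must beat the entropy [ln Q - ln c] per node. *)
pose K := 1 + (nu * v)^-1 + `|4 * (ln Q%:R - ln c)| / (kN ^+ 2 * (v * del ^+ 2)).
have nv0 : 0 < nu * v by rewrite mulr_gt0.
have K0 : 0 <= K by rewrite !addr_ge0 ?invr_ge0 ?divr_ge0 // ltW.
have [N2 h2] := rate_large hrho K0.
have [N3 h3] := large_nat (4 / c + 2 / kN + 2 * C1).
pose C := 8 * C1 + 2 * C1 / (nu * v).
have C0 : 0 <= C by rewrite addr_ge0 ?mulr_ge0 ?invr_ge0 // ltW.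
exists eps, C, (maxn N1 (maxn N2 N3)); split => // n; rewrite !geq_max => /and3P[n1 n2' n3].
move=> zs y r that hbal hquiet hb hvar.
have [n2 _ hK] := h2 n n2'.
have n0 : (0 < n)%N by apply: leq_trans n2.
have nR : 0 < n%:R :> R by rewrite ltr0n.
have nR1 : 1 <= n%:R :> R by rewrite ler1n.
have t1 : 0 < 4 / c by rewrite divr_gt0.
have t2 : 0 < 2 / kN by rewrite divr_gt0.
have hn := h3 n n3.
have cn : 4 <= c * n%:R by rewrite mulrC -ler_pdivrMr //; lra.
have kn : 2 <= kN * n%:R by rewrite mulrC -ler_pdivrMr //; lra.
have i1 : 0 <= (nu * v)^-1 by rewrite invr_ge0 ltW.
have i2 : 0 <= `|4 * (ln Q%:R - ln c)| / (kN ^+ 2 * (v * del ^+ 2)).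
  by rewrite divr_ge0 // ltW.
have rn1 : 1 <= rho n * n%:R by rewrite mulrC; move: hK; rewrite /K; lra.
have r0 : 0 < rho n by rewrite -(pmulr_lgt0 _ nR); lra.
have q1 : 1 <= nu * v * (rho n * n%:R).
  by rewrite mulrC -ler_pdivrMr // mul1r [rho n * _]mulrC; move: hK; rewrite /K; lra.
have q2 : 4 * (ln Q%:R - ln c) <= kN ^+ 2 * (v * del ^+ 2) * (rho n * n%:R).
  apply: (le_trans (ler_norm _)).
  by rewrite [X in _ <= X]mulrC -ler_pdivrMr // [rho n * _]mulrC; move: hK; rewrite /K; lra.
pose x := 2 * Q%:R / c / n%:R ^+ 2.
have x0 : 0 <= x by rewrite !mulr_ge0 ?invr_ge0 ?exprn_ge0 // ltW.
have hxi : x + F * expR (- (k3 * n%:R)) <= C1 / n%:R ^+ 2.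
  rewrite /C1 [X in _ <= X]mulrDl lerD2l -[X in _ <= X]mulrA; apply: ler_wpM2l => //.
  apply: (le_trans (expRN_le_inv_sqr _)); first by rewrite mulr_gt0.
  by rewrite exprMn invfM mulrA.
have n2le : C1 / n%:R ^+ 2 <= 1 / 2.
  rewrite ler_pdivrMr ?exprn_gt0 // (le_trans (y := n%:R / 2)) //; first by lra.
  have : 0 <= n%:R * (n%:R - 1) :> R by rewrite mulr_ge0 ?subr_ge0.
  by rewrite mulrBr expr2; lra.
have c1 : 8 * Q%:R ^+ 4 * (a2 - a1 + V * (a2 - a1) ^+ 2) * eps <=
    (c / (2 * Q%:R)) ^+ 2 * (v * del ^+ 2).
  by rewrite (_ : 8 * _ * _ * eps = 8 * gQ * eps) //; rewrite /gQ /g /w; ring.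
have c3 : 4 * Q%:R ^+ 4 * (a2 - a1 + V * (a2 - a1) ^+ 2) * eps <=
    (c / (2 * Q%:R)) ^+ 2 * (v * gap ^+ 2) / 4.
  by rewrite (_ : 4 * _ * _ * eps = 4 * gQ * eps) //; rewrite /gQ /g /w; ring.
have c4 : 12 * V * (a2 - a1) * del <= (c / (2 * Q%:R)) ^+ 2 * (v * gap ^+ 2) / 4.
  by rewrite (_ : 12 * _ * _ * del = 12 * Vw * del) //; rewrite /Vw /w; ring.
have dgap : 2 * del < gap by lra.
have edis : 8 * eta <= dis by lra.
have [s [hs1 hs2]] := estimator_close hfam hid aA hbal hquiet hb pi0 hvar
  (eta := eta) (del := del) (x := x)
  n0 r0 (ltW eps0) e1 e2 e3 e4 eta0 eta1 edis cn kn del0 dgap c1 q2 c3 c4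
  q1 (h1 n n1) x0 (le_trans hxi n2le).
have n3R : 0 < n%:R ^+ 3 :> R by rewrite exprn_gt0.
have n2R : 0 < n%:R ^+ 2 :> R by rewrite exprn_gt0.
exists s; split=> [q|q l].
  have := hs1 q => /= h; have {}h : n%:R / 4 * (alpha_hat zs 0 q - that.1 0 (s q)) ^+ 2 <=
     2 * (C1 / n%:R ^+ 2) by apply: (le_trans h); rewrite ler_pM2l.
  rewrite ler_pdivlMr //.
  move: h; rewrite mulrA ler_pdivlMr //; set X := _ ^+ 2 => h.
  have e : 4 * (n%:R / 4 * X * n%:R ^+ 2) = X * n%:R ^+ 3 by field.
  rewrite -e; have z1 : 0 <= 2 * C1 / (nu * v) by rewrite !mulr_ge0.
  by rewrite /C; lra.
have := hs2 q l => /= h; have {}h : nu * rho n * (n * n)%:R * v *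
   (pi_hat A psi pi0 y r zs q l - that.2 (s q) (s l)) ^+ 2 <= 2 * (C1 / n%:R ^+ 2).
  by apply: (le_trans h); rewrite ler_pM2l.
rewrite ler_pdivlMr //.
move: h; rewrite mulrA ler_pdivlMr //; set X := _ ^+ 2 => h.
have X0 : 0 <= X by exact: sqr_ge0.
have h' : X * n%:R ^+ 3 <= 2 * C1 / (nu * v).
  rewrite ler_pdivlMr //; apply: le_trans h; rewrite natrM.
  have hh : 0 <= (rho n * n%:R - 1) * (nu * v * X * n%:R ^+ 3).
    apply: mulr_ge0; first by rewrite subr_ge0.
    by apply: mulr_ge0; [apply: mulr_ge0 => //|]; exact: ltW.
  rewrite (_ : (rho n * n%:R - 1) * _ = nu * rho n * (n%:R * n%:R) * v * X * n%:R ^+ 2 -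
    X * n%:R ^+ 3 * (nu * v)) in hh; last by ring.
  by rewrite subr_ge0 in hh.
by apply: (le_trans h'); rewrite /C lerDr mulr_ge0.
Qed.

End EstimatorRate.

(** * Stochastic order of the error *)

Lemma mx_norm_le (R : realType) (m n : nat) (M : 'M[R]_(m, n)) (e : R) :
  0 <= e -> (forall i j, `|M i j| <= e) -> `|M| <= e.
Proof.
move=> e0 h; rewrite /Num.norm /= mx_normrE; apply: bigmax_le => // ij _; exact: h.
Qed.

(** A single sequence of exceptional events serves all levels [e]. *)
Lemma small_oP_of_rate (R : realType) (W : normedModType R) (d : nat -> measure_display)
    (T : forall n, measurableType (d n)) (P : forall n, probability (T n) R)
    (X : forall n, T n -> W) (a : nat -> R) (B : forall n, set (T n)) (C : R) (N : nat) :
  (forall n, measurable (B n)) ->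
  (forall n, (N <= n)%N -> (P n (B n) <= (C / n%:R ^+ 2)%:E)%E) ->
  (forall e : R, 0 < e -> exists N', forall n, (N' <= n)%N ->
     forall w, ~ B n w -> `|X n w| <= e * a n) ->
  small_oP P X a.
Proof.
move=> mB PB hX e e0; have [N' hN'] := hX e e0.
pose N0 := maxn N (maxn N' 2).
exists (fun n => if (N0 <= n)%N then B n else setT); split.
- by move=> n; case: ifP.
- move=> n w /= h; case: ifP => // hn; apply: contrapT => nB.
  have := hN' n _ w nB; rewrite leNgt h => /(_ _)/negP; apply => //.
  by apply: leq_trans hn; rewrite /N0 !leq_max leqnn orbT.
have C1 : (fun n => (`|C| * harmonic n)%:E) @ \oo --> (0 : \bar R).
  have h : (fun n => `|C| * harmonic n : R) @ \oo --> `|C| * 0.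
    by apply: cvgM; [exact: cvg_cst|exact: cvg_harmonic].
  by rewrite mulr0 in h; apply/cvg_EFin; [near=> n|exact: h].
apply: squeeze_cvge (cvg_cst 0%E) C1.
near=> n; rewrite measure_ge0 /=.
have hn : (N0 <= n)%N by near: n; exists N0.
rewrite hn; have n2 : (2 <= n)%N by apply: leq_trans hn; rewrite /N0 !leq_max leqnn !orbT.
apply: (le_trans (PB n _)); first by apply: leq_trans hn; rewrite /N0 leq_max leqnn.
rewrite lee_fin; apply: (@le_trans _ _ (`|C| / n%:R ^+ 2)).
  by apply: ler_wpM2r; [rewrite invr_ge0 exprn_ge0|exact: ler_norm].
apply: ler_wpM2l => //; rewrite /harmonic /= lef_pV2 ?posrE ?ltr0n //; last first.
  by rewrite exprn_gt0 // ltr0n (leq_trans _ n2).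
rewrite -natrX ler_nat; apply: (@leq_trans (2 * n)).
  by rewrite mul2n -addnn -addn1 leq_add2l (leq_trans _ n2).
by rewrite expnS expn1 leq_mul2r n2 orbT.
Unshelve. all: by end_near. Qed.

Unset Implicit Arguments.

Theorem corollary5p2 (R : realType) (Q : nat) (hQ : (1 <= Q)%N)
    (* exponential family *)
    (mu : {measure set (measurableTypeR R) -> \bar R})
    (A : set R) (b psi : R -> R) (hfam : regular_expfam mu A b psi)
    (* parameter space and true parameter *)
    (Theta : set (param R Q)) (thetas : param R Q)
    (hTheta : forall t, Theta t -> is_param t)
    (hthetas : Theta thetas)
    (* (A1) *)
    (hA1 : exists c a1 a2 : R,
       [/\ 0 < c, [set` `[a1, a2]] `<=` interior A &
           forall t, Theta t ->
             (forall q, c <= t.1 0 q <= 1 - c) /\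
             (forall q l, a1 <= t.2 q l <= a2)])
    (* (A2): interior relative to the set of parameters (alpha in the simplex) *)
    (hA2 : \forall t \near thetas, is_param t -> Theta t)
    (* (A3) *)
    (hA3 : set_inj A (fun p y => expfam b psi y p))
    (* (A4) *)
    (hA4 : injective (fun q : 'I_Q =>
             \sum_(l < Q) derive1 psi (thetas.2 q l) * thetas.1 0 l))
    (* sampling rates *)
    (rho : nat -> R) (hrho01 : forall n, 0 <= rho n <= 1)
    (hrho : (fun n : nat => n%:R * rho n / ln (n%:R : R)) @ \oo --> +oo)
    (* data, for each number n of nodes *)
    (d : nat -> measure_display) (T : forall n, measurableType (d n))
    (P : forall n, probability (T n) R)
    (z : forall n, T n -> assignment n Q)
    (y : forall n, T n -> 'I_n -> 'I_n -> R)
    (r : forall n, T n -> 'I_n -> 'I_n -> bool)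
    (hdata : forall n,
       sbm_dyad_sampling mu b psi thetas (rho n) (P n) (z n) (y n) (r n))
    (* arbitrary value of pi_hat when undefined *)
    (pi0 : 'M[R]_Q)
    (* variational estimator *)
    (thetavar : forall n, T n -> param R Q)
    (hvar : forall n, \forall w \ae P n,
       is_variational_estimate b psi Theta (y n w) (r n w) (thetavar n w)) :
  exists s : forall n, T n -> 'S_Q,
    small_oP P
      (fun n w => alpha_hat (z n w) - perm_alpha (s n w) (thetavar n w).1)
      (fun n => (Num.sqrt n%:R)^-1)
    /\
    small_oP P
      (fun n w => pi_hat A psi pi0 (y n w) (r n w) (z n w)
                  - perm_pi (s n w) (thetavar n w).2)
      (fun n => n%:R^-1).
Proof.
case: hA1 => c [a1 [a2 [c0 aA hrange]]].
have [v [V [d0 [gap [dis hid]]]]] :=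
  identified_of_assumptions hfam hQ hTheta hthetas c0 aA hrange hA2 hA4.
have [eps [C [N [eps0 eps1 C0 hrate]]]] := estimator_rate hfam hid aA hrho pi0.
have [v0 V0 _ hD] := id_curved hid; have d00 := id_d0 hid.
have V2 : 0 < 2 * (2 + 2 * V) by rewrite mulr_gt0 // ltr_wpDr // mulr_ge0 // ltW.
(* The tilt of the Chernoff bounds must keep the parameters in their range. *)
pose lam := Num.min d0 (eps / (2 * (2 + 2 * V))).
have lam0 : 0 < lam by rewrite lt_min d00 divr_gt0.
have lam_d0 : lam <= d0 by rewrite /lam ge_min lexx.
have lam_eps : (2 + 2 * V) * lam <= eps / 2.
  have : lam <= eps / (2 * (2 + 2 * V)) by rewrite /lam ge_min lexx orbT.
  by rewrite ler_pdivlMr // => h; lra.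
have Vlam0 : 0 <= V * lam by rewrite mulr_ge0 // ltW.
have lam2 : lam <= 1 / 2 by lra.
have Vlam : V * lam ^+ 2 <= 1 / 2.
  have : V * lam * lam <= V * lam * 1 by apply: ler_wpM2l => //; lra.
  by rewrite expr2; lra.
have tsr := id_range2 hid hthetas.
have tA q l : A (thetas.2 q l).
  by apply: interior_subset; apply: aA; rewrite /= in_itv /=; exact: tsr.
have tlam q l x : `|x| = lam -> A (thetas.2 q l + x) /\
    0 <= bregman psi (thetas.2 q l) (thetas.2 q l + x) <= V * lam ^+ 2.
  move=> xl; have [p1 p2] := hTheta _ hthetas.
  pose t : param R Q := (thetas.1, \matrix_(q', l') (thetas.2 q' l' + x)).
  have /(id_range2 hid)/(_ q l) : Theta t.
    apply: (id_nbhd hid) => //= [q'|q' l']; first by rewrite subrr normr0 ltW.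
    by rewrite mxE [_ + x]addrC addrK xl.
  rewrite /t /= mxE => tr; split; first by apply: interior_subset; apply: aA; rewrite /= in_itv.
  rewrite (bregman_ge0 (id_curved hid)) //=.
  have /andP[_] := hD _ _ (tsr q l) tr.
  by rewrite [_ + x - _]addrAC subrr add0r -(real_normK (num_real x)) xl.
have [C' [N' hfail]] := failure_rate hrho (lam := lam) (eps := eps) hQ lam0 eps0.
have hB n : exists B : set (T n), [/\ measurable B,
    (forall w, ~ B w -> [/\ balanced thetas.1 eps (z n w),
       quiet (fun q l => derive1 psi (thetas.2 q l)) (rho n) eps (z n w) (y n w) (r n w),
       forall i j, i != j -> 0 < b (y n w i j) &
       is_variational_estimate b psi Theta (y n w) (r n w) (thetavar n w)]) &
    (P n B <= (failure_bound Q n (rho n) lam eps)%:E)%E].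
  have [B [mB sB pB]] := good_event hfam (hdata n) (hrho01 n) (hTheta _ hthetas) tA
    (ltW V0) lam0 lam2 Vlam eps0 eps1 lam_eps tlam.
  have [Z [mZ PZ sZ]] := hvar n.
  exists (B `|` Z); split; first exact: measurableU.
    move=> w /not_orP[nB nZ].
    have [h1 h2 h3] : [/\ balanced thetas.1 eps (z n w),
       quiet (fun q l => derive1 psi (thetas.2 q l)) (rho n) eps (z n w) (y n w) (r n w) &
       forall i j, i != j -> 0 < b (y n w i j)].
      by apply: contrapT => h; apply: nB; exact: sB.
    by split => //; apply: contrapT => h; apply: nZ; exact: sZ.
  apply: (le_trans (measureU2 _ mB mZ)); rewrite -[X in (_ <= X)%E]adde0.
  apply: leeD => //.
  by rewrite le_eqVlt; apply/orP; left; apply/eqP; exact: PZ.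
pose B n := projT1 (cid (hB n)).
have HB n := projT2 (cid (hB n)).
pose close n w (s : 'S_Q) :=
  (forall q, (alpha_hat (z n w) 0 q - (thetavar n w).1 0 (s q)) ^+ 2 <= C / n%:R ^+ 3) /\
  (forall q l, (pi_hat A psi pi0 (y n w) (r n w) (z n w) q l -
                 (thetavar n w).2 (s q) (s l)) ^+ 2 <= C / n%:R ^+ 3).
have sex n w : exists s, (exists s', close n w s') -> close n w s.
  have [[s hs]|nos] := pselect (exists s', close n w s'); first by exists s.
  by exists 1%g => /nos.
pose s n w := projT1 (cid (sex n w)).
have hs n w : (N <= n)%N -> ~ B n w -> close n w (s n w).
  move=> hn nB; apply: (projT2 (cid (sex n w))).
  have [_ /(_ w nB)[h1 h2 h3 h4] _] := HB n.
  exact: hrate hn (z n w) (y n w) (r n w) (thetavar n w) h1 h2 h3 h4.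
have entry (e : R) (n : nat) (x : R) : 0 < e -> (0 < n)%N -> C / e ^+ 2 <= n%:R ->
    x ^+ 2 <= C / n%:R ^+ 3 -> `|x| <= e / n%:R.
  move=> e0 n0 hn hx; have nR : 0 < n%:R :> R by rewrite ltr0n.
  apply: sqr_le_norm; first by rewrite divr_ge0 // ltW.
  apply: (le_trans hx); rewrite ler_pdivrMr ?exprn_gt0 //.
  rewrite (_ : (e / n%:R) ^+ 2 * n%:R ^+ 3 = n%:R * e ^+ 2); last by field; rewrite lt0r_neq0.
  by rewrite -ler_pdivrMr // exprn_gt0.
exists s; split; apply: (small_oP_of_rate (B := B) (C := C') (N := N')).
- by move=> n; case: (HB n).
- by move=> n hn; case: (HB n) => _ _ h; apply: (le_trans h); rewrite lee_fin hfail.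
- move=> e e0; have [N1 hN1] := large_nat (C / e ^+ 2).
  exists (maxn N (maxn N1 1)) => n; rewrite !geq_max => /and3P[n1 n2 n3] w nB.
  have nR : 1 <= n%:R :> R by rewrite ler1n.
  have sq0 : 0 < Num.sqrt (n%:R : R) by rewrite sqrtr_gt0; lra.
  apply: mx_norm_le; first by rewrite divr_ge0 // ltW.
  move=> i q; rewrite [i]ord1 !mxE.
  have := (hs n w n1 nB).1 q; rewrite mxE => /(entry _ _ _ e0 n3 (hN1 n n2)) h.
  apply: (le_trans h); apply: ler_wpM2l; first exact: ltW.
  rewrite lef_pV2 ?posrE //; last by lra.
  have sq1 : 1 <= Num.sqrt (n%:R : R) by rewrite -[X in X <= _]sqrtr1 ler_sqrt //; lra.
  rewrite -[X in _ <= X](@sqr_sqrtr R n%:R) // expr2.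
  by apply: ler_peMr => //; exact: ltW.
- by move=> n; case: (HB n).
- by move=> n hn; case: (HB n) => _ _ h; apply: (le_trans h); rewrite lee_fin hfail.
move=> e e0; have [N1 hN1] := large_nat (C / e ^+ 2).
exists (maxn N (maxn N1 1)) => n; rewrite !geq_max => /and3P[n1 n2 n3] w nB.
apply: mx_norm_le; first by rewrite divr_ge0 // ltW.
move=> q l; have entryB (M1 M2 : 'M[R]_Q) : (M1 - M2) q l = M1 q l - M2 q l by rewrite !mxE.
rewrite entryB [perm_pi _ _ _ _]mxE.
exact: entry e0 n3 (hN1 n n2) ((hs n w n1 nB).2 q l).
Qed.
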